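(* There are universal constants $L_0$ and $C$ such that for all integers $L>L_0$ and $n\ge4L$, the mixing time of the $L$-reversal chain on $n$ cards satisfies $$T_{\rm mix}\le C\,\max\Big(n,\frac{n^3}{L^3}\Big)\log^3 n.$$
   Context: $L$-reversal chain: $n$ cards are located at the vertices of an $n$-cycle, labelled $0,\dots,n-1$. At each step, a vertex $v\in\{0,\dots,n-1\}$ and a number $l\in\{0,\dots,L\}$ are chosen independently and uniformly at random, and the order of the cards in the interval of positions $v,v+1,\dots,v+l$ (mod $n$) is reversed. Successive steps are independent. This is a Markov chain on the $n!$ arrangements with uniform stationary distribution. For a Markov chain with transition probabilities $p(x,y)$ on a finite state space $V$ with uniform stationary distribution $\mathcal U$, the mixing time is $T_{\rm mix}=\min\{k:\|p^k(x,\cdot)-\mathcal U\|\le\frac14\text{ for all }x\in V\}$, where $\|\mu-\nu\|=\sum_{x\in V}|\mu(x)-\nu(x)|$. *)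

(* Defs.v *)
From mathcomp Require Import all_boot all_order all_algebra all_fingroup.
From mathcomp Require Import classical_sets reals constructive_ereal ereal.
Set Implicit Arguments.
Unset Strict Implicit.
Unset Printing Implicit Defensive.
Import Order.TTheory GRing.Theory Num.Theory.
Local Open Scope ring_scope.

Section MixingTime.
Variables (R : realType) (V : finType).
Implicit Type p : V -> V -> R.

Fixpoint kstep p (k : nat) (x y : V) : R :=
  if k is k'.+1 then \sum_z kstep p k' x z * p z y else (x == y)%:R.

(* No factor 1/2 in the distance: it is twice the total variation distance. *)
Definition l1dist (mu nu : V -> R) : R := \sum_x `|mu x - nu x|.

Definition uniform : V -> R := fun=> #|V|%:R^-1.

Definition mixed p (k : nat) : Prop :=
  forall x, l1dist (kstep p k x) uniform <= 4^-1.

(* The least k with [mixed p k], and +oo if there is none. *)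
Definition Tmix p : \bar R := ereal_inf [set k%:R%:E | k in mixed p]%classic.

End MixingTime.

Section ReversalChain.
Variable n : nat.

Definition pos_add (v : 'I_n) (k : nat) : 'I_n :=
  Ordinal (ltn_pmod (v + k) (leq_ltn_trans (leq0n v) (ltn_ord v))).

(* Exchanges the positions v + d and v + (l - d) for 0 <= d <= l; here d is
   recovered as the cyclic distance from v to i. *)
Definition rev_pos (v : 'I_n) (l : nat) (i : 'I_n) : 'I_n :=
  let d := ((i + (n - v)) %% n)%N in
  if (d <= l)%N then pos_add v (l - d) else i.

Lemma rev_posK (v : 'I_n) (l : nat) : (l < n)%N -> involutive (rev_pos v l).
Proof.
move=> ln i.
have dK k : (k < n)%N -> (((v + k) %% n + (n - v)) %% n = k)%N.
  move=> kn; rewrite modnDml -addnA addnCA subnKC ?(ltnW (ltn_ord v)) //.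
  by rewrite modnDr modn_small.
rewrite {2}/rev_pos; case: leqP => [dl|ld]; last first.
  by rewrite /rev_pos leqNgt ld.
rewrite /rev_pos /= dK ?leq_subr ?(leq_ltn_trans (leq_subr _ _)) // subKn //.
apply: val_inj => /=; rewrite modnDmr addnCA subnKC ?(ltnW (ltn_ord v)) //.
by rewrite modnDr modn_small.
Qed.

(* An arrangement x : 'S_n sends each position to the label of the card there.
   The successor of x for the choice (v, l) is x \o rev_pos v l, which is a
   permutation as soon as l < n by rev_posK. *)
Definition reversal_kernel (R : realType) (L : nat) (x y : 'S_n) : R :=
  #|[set vl : 'I_n * 'I_L.+1 | [forall i, y i == x (rev_pos vl.1 vl.2 i)]]|%:R
  / (n * L.+1)%:R.

End ReversalChain.

(* Main.v *)
(* Entropy method of Morris. The reversal of length l at v and the reversal of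
   length l - 2 at v + 1 differ by the transposition of v and v + l, so a step
   may be seen as a reversal followed, on a fair coin, by the swap of two cards
   (a "collision"). Averaging a law over independent swaps of disjoint pairs
   decreases its entropy at least by the sum of the gains of the pairs, where
   the gain of {i, j} with j < i is the squared Hellinger distance between the
   law of the cards at the positions >= i and its image under the swap. By the
   chain rule, the part of the relative entropy revealed at the positions
   k/2 <= i < k is at most O(log n) times the average of these gains over
   j <= i.

   It remains to bound below the probability that two given cards at distance
   < k collide in a window of w steps, w of order min(n, n k^2 / L^3), started
   at a time of order n k^2 / L^3. Their distance moves like a walk of variance
   L^3/n per step. For cards at distance <= L, the symmetry of the two-card
   kernel turns the return probability into a squared L^2 norm, which is at
   least 1 / (size of the region reached) by Cauchy-Schwarz; farther cards are
   treated with an exponential subsolution of the two-card heat equation. The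
   pair then meets within distance L with probability of order L/k.

   Hence at the dyadic scale, among O(log n), which carries most of the
   relative entropy, a fraction w / (n log^2 n) of it disappears in time O(w).
   The relative entropy is at most n log n initially, so it is small after
   O(log n) relaxation times max(n, n^3/L^3) log^2 n, and it dominates the
   squared Hellinger distance to the uniform law, hence the l1 distance. *)
Require Import Defs.
From mathcomp Require Import all_boot all_order all_algebra all_fingroup.
From mathcomp Require Import reals constructive_ereal sequences exp.
From mathcomp Require boolp.
From mathcomp Require Import ring lra zify.
Import Order.TTheory GRing.Theory Num.Theory.
Local Open Scope ring_scope.
Set Implicit Arguments.
Unset Strict Implicit.
Unset Printing Implicit Defensive.

(** * Entropy and Hellinger distance *)

Section ScalarInequalities.
Variable R : realType.
Implicit Types a b c x : R.

(** A single window of collisions cannot be long: the swapped pairs must be disjoint, so a card may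
    be used only in its first collision, and it collides with probability of order 1/n per step.
    Diffusion over a distance k can take far more than n steps. Hence t steps pass without any swap
    before the w harvested ones; only convexity of entropy is used for them, and the price is a
    factor w / (w + t), balanced in [window_exists].

    Squared Hellinger distances serve as gains because they contract under averaging and are
    comparable with relative entropy up to the logarithm of a likelihood ratio; exposing one card at
    a time keeps that ratio at most n.

    Avoiding earlier collisions means killing the two-card walk. The killing sites are invariant
    under each reversal, so the killed kernel stays self-adjoint and the squared norm argument
    survives. That argument only bounds the return to a whole band of offsets; a minimum principle
    turns it into a bound for every pair at distance at most L. *)

Lemma xlnx_tangent x c : 0 <= x -> 0 < c -> x * ln c + x - c <= x * ln x.
Proof.
move=> x0 c0; have [->|xn0] := eqVneq x 0.
  by rewrite !mul0r add0r sub0r oppr_le0 ltW.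
have xp : 0 < x by rewrite lt_def xn0.
have := @le_ln1Dx R (c / x - 1); rewrite (addrC 1) subrK.
have -> : -1 < c / x - 1 by rewrite ltrBrDr addNr divr_gt0.
move=> /(_ isT).
rewrite ln_div ?posrE // => /(ler_wpM2l x0).
rewrite mulrBr (mulrBr x (c / x)) mulrCA divff // !mulr1.
by set u := x * ln c; set v := x * ln x; lra.
Qed.

(* Substituting x = (sqrt x)^2 in the tangent inequality at sqrt x. *)
Lemma sqr_sqrt_le_xlnx x c : 0 <= x -> 0 < c ->
  (Num.sqrt x - Num.sqrt c) ^+ 2 + x * ln c + x - c <= x * ln x.
Proof.
move=> x0 c0; have [->|xn0] := eqVneq x 0.
  by rewrite sqrtr0 sub0r sqrrN sqr_sqrtr ?(ltW c0) // !mul0r; lra.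
have xp : 0 < x by rewrite lt_def xn0.
have sx : 0 < Num.sqrt x by rewrite sqrtr_gt0.
have sc : 0 < Num.sqrt c by rewrite sqrtr_gt0.
have lnsq (y : R) : 0 < y -> ln y = ln (Num.sqrt y) *+ 2.
  by move=> y0; rewrite -lnXn ?sqrtr_gt0 // sqr_sqrtr ?(ltW y0).
have key (s t : R) : 0 < s -> 0 < t ->
    (s - t) ^+ 2 + s ^+ 2 * (ln t *+ 2) + s ^+ 2 - t ^+ 2 <= s ^+ 2 * (ln s *+ 2).
  move=> s0 t0; have := ler_wpM2l (ltW s0) (xlnx_tangent (ltW s0) t0).
  by rewrite !mulr2n; set u := ln s; set v := ln t; lra.
have := key _ _ sx sc; rewrite -!lnsq // (sqr_sqrtr x0) (sqr_sqrtr (ltW c0)); exact.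
Qed.

(** Add the sharpened tangent inequalities at the midpoint m: the linear terms cancel, and with s,
    t, u the square roots of a, b, m the remainder (s - u)^2 + (t - u)^2 is at least (s - t)^2 /
    2. *)
Lemma xlnx_midpoint a b : 0 <= a -> 0 <= b ->
  (Num.sqrt a - Num.sqrt b) ^+ 2 / 2 <=
  a * ln a + b * ln b - 2 * ((a + b) / 2 * ln ((a + b) / 2)).
Proof.
move=> a0 b0; have [m0|mn0] := eqVneq (a + b) 0.
  have -> : a = 0 by lra.
  have -> : b = 0 by lra.
  by rewrite !(mul0r, addr0, sqrtr0, subrr, expr0n, mulr0).
have m0 : 0 < (a + b) / 2 by rewrite divr_gt0 // lt_def mn0 addr_ge0.
have := sqr_sqrt_le_xlnx a0 m0; have := sqr_sqrt_le_xlnx b0 m0.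
set m := (a + b) / 2; set s := Num.sqrt a; set t := Num.sqrt b.
set u := Num.sqrt m; set l := ln m.
have -> : (2 * (m * l)) = a * l + b * l by rewrite /m; lra.
have : 0 <= (s + t - 2 * u) ^+ 2 by apply: sqr_ge0.
by rewrite /m; nra.
Qed.

(** Converse of the Hellinger bound, at the price of the logarithm of the likelihood ratio. Dividing
    by b leaves 2 y^2 ln y - y^2 + 1 with y = sqrt (a / b). For y <= 2, ln y <= y - 1 bounds it by
    (y - 1)^2 (2 y + 1), hence the 5; for y > 2, y^2 <= 4 (y - 1)^2 and 2 ln y <= ln N. *)
Lemma xlnx_le_hellinger (N : R) a b : expR 1 <= N -> 0 <= a -> a <= N * b ->
  a * ln a - a * ln b - a + b <= 5 * ln N * (Num.sqrt a - Num.sqrt b) ^+ 2.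
Proof.
move=> Ne a0 aNb.
have N0 : 0 < N by apply: lt_le_trans Ne; apply: expR_gt0.
have lnN1 : 1 <= ln N by rewrite -(expRK 1) ler_ln ?posrE // expR_gt0.
have b0 : 0 <= b by rewrite -(pmulr_rge0 b N0) (le_trans a0).
have [bz|bn0] := eqVneq b 0.
  have -> : a = 0 by apply/eqP; rewrite eq_le a0 andbT (le_trans aNb) ?bz ?mulr0.
  by rewrite bz !(mul0r, subrr, sqrtr0, addr0, expr0n, mulr0).
have bp : 0 < b by rewrite lt_def bn0.
have [->|an0] := eqVneq a 0.
  have -> : (Num.sqrt 0 - Num.sqrt b) ^+ 2 = b.
    by rewrite sqrtr0 sub0r sqrrN sqr_sqrtr.
  rewrite !mul0r !subrr add0r; have := ler_wpM2r b0 lnN1; lra.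
have ap : 0 < a by rewrite lt_def an0.
set s := Num.sqrt a; set t := Num.sqrt b.
have s0 : 0 < s by rewrite sqrtr_gt0.
have t0 : 0 < t by rewrite sqrtr_gt0.
have as2 : a = s ^+ 2 by rewrite sqr_sqrtr.
have bt2 : b = t ^+ 2 by rewrite sqr_sqrtr.
have -> : a * ln a - a * ln b = a * (2 * ln (s / t)).
  by rewrite -mulrBr -ln_div ?posrE // as2 bt2 -expr_div_n lnXn ?divr_gt0 // mulr2n; lra.
set y := s / t.
have y0 : 0 < y by rewrite divr_gt0.
have sy : s = y * t by rewrite /y divfK // gt_eqF.
suff key : y ^+ 2 * (2 * ln y) - y ^+ 2 + 1 <= 5 * ln N * (y - 1) ^+ 2.
  move: key => /(ler_wpM2r (ltW bp)); rewrite as2 bt2 sy.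
  set l := ln y; set q := ln N; lra.
have lny : ln y <= y - 1.
  by have := @le_ln1Dx R (y - 1); rewrite (addrC 1) subrK; apply; lra.
have [y2|y2] := leP y 2.
  have h1 : y ^+ 2 * (2 * ln y) - y ^+ 2 + 1 <= (y - 1) ^+ 2 * (2 * y + 1).
    have : y ^+ 2 * ln y <= y ^+ 2 * (y - 1) by rewrite ler_wpM2l // sqr_ge0.
    by set l := ln y; nra.
  apply: (le_trans h1); rewrite [leRHS]mulrC ler_wpM2l ?sqr_ge0 //; lra.
have lnyN : 2 * ln y <= ln N.
  have -> : 2 * ln y = ln (y ^+ 2) by rewrite lnXn // mulr2n; lra.
  rewrite ler_ln ?posrE ?exprn_gt0 //.
  by rewrite expr_div_n -as2 -bt2 ler_pdivrMr.
have h : y ^+ 2 <= 4 * (y - 1) ^+ 2 by nra.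
have h2 : y ^+ 2 * (2 * ln y) <= y ^+ 2 * ln N by rewrite ler_wpM2l // sqr_ge0.
have h3 : y ^+ 2 * ln N <= 4 * (y - 1) ^+ 2 * ln N by rewrite ler_wpM2r //; lra.
have h4 : 0 <= (y - 1) ^+ 2 * ln N by rewrite mulr_ge0 ?sqr_ge0 //; lra.
nra.
Qed.

(* Cauchy-Schwarz. *)
Lemma hellinger_jensen (I : finType) (P : pred I) (a b : I -> R) :
  (forall i, P i -> 0 <= a i) -> (forall i, P i -> 0 <= b i) ->
  (Num.sqrt (\sum_(i | P i) a i) - Num.sqrt (\sum_(i | P i) b i)) ^+ 2 <=
  \sum_(i | P i) (Num.sqrt (a i) - Num.sqrt (b i)) ^+ 2.
Proof.
move=> a0 b0.
set A := \sum_(i | P i) a i; set B := \sum_(i | P i) b i.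
have A0 : 0 <= A by apply: sumr_ge0.
have B0 : 0 <= B by apply: sumr_ge0.
have expand x y : 0 <= x -> 0 <= y ->
    (Num.sqrt x - Num.sqrt y) ^+ 2 = x + y - 2 * (Num.sqrt x * Num.sqrt y).
  by move=> x0 y0; rewrite sqrrB !sqr_sqrtr //; rewrite mulr2n; lra.
rewrite expand //.
rewrite (eq_bigr (fun i => a i + b i - 2 * (Num.sqrt (a i) * Num.sqrt (b i)))); last first.
  by move=> i Pi; rewrite expand ?a0 ?b0.
rewrite sumrB big_split /= -/A -/B lerD2l lerN2 -mulr_sumr ler_pM2l //.
have [Az|An0] := eqVneq A 0.
  rewrite big1 ?mulr_ge0 ?sqrtr_ge0 // => i Pi.
  suff -> : a i = 0 by rewrite sqrtr0 mul0r.
  apply/eqP; by rewrite (psumr_eq0P a0 Az Pi).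
have [Bz|Bn0] := eqVneq B 0.
  rewrite big1 ?mulr_ge0 ?sqrtr_ge0 // => i Pi.
  suff -> : b i = 0 by rewrite sqrtr0 mulr0.
  apply/eqP; by rewrite (psumr_eq0P b0 Bz Pi).
have sA : 0 < Num.sqrt A by rewrite sqrtr_gt0 lt_def An0.
have sB : 0 < Num.sqrt B by rewrite sqrtr_gt0 lt_def Bn0.
set u := Num.sqrt A in sA *; set v := Num.sqrt B in sB *.
have uA : u ^+ 2 = A by rewrite sqr_sqrtr.
have vB : v ^+ 2 = B by rewrite sqr_sqrtr.
(* AM-GM term by term, weighted so that the bounds add up to exactly [u * v]. *)
have : \sum_(i | P i) Num.sqrt (a i) * Num.sqrt (b i) <=
    \sum_(i | P i) (a i * (v / (2 * u)) + b i * (u / (2 * v))).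
  apply: ler_sum => i Pi.
  set s := Num.sqrt (a i); set t := Num.sqrt (b i).
  have -> : a i = s ^+ 2 by rewrite sqr_sqrtr ?a0.
  have -> : b i = t ^+ 2 by rewrite sqr_sqrtr ?b0.
  rewrite -subr_ge0.
  have -> : s ^+ 2 * (v / (2 * u)) + t ^+ 2 * (u / (2 * v)) - s * t =
     (s * v - t * u) ^+ 2 / (2 * u * v).
    by field; rewrite !gt_eqF.
  by rewrite divr_ge0 ?sqr_ge0 // !mulr_ge0 // ltW.
move/le_trans; apply.
rewrite big_split /= -!mulr_suml -/A -/B -uA -vB.
rewrite [leLHS](_ : _ = u * v) //; field; by rewrite !gt_eqF.
Qed.

End ScalarInequalities.

(** * Entropy, Hellinger distance and averages over subgroups *)

Section GroupEntropy.
Variables (R : realType) (gT : finGroupType).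
Implicit Types (f g h : gT -> R) (s t : gT) (H K : {group gT}).

Definition entropy f : R := \sum_y f y * ln (f y).

Definition hellinger f g : R := \sum_y (Num.sqrt (f y) - Num.sqrt (g y)) ^+ 2.

Definition lshift s f : gT -> R := fun y => f (s * y)%g.

Definition midpoint t f : gT -> R := fun y => (f y + f (t * y)%g) / 2.

(** Conditional expectation given the right coset H y. *)
Definition group_avg H f : gT -> R := fun y => (\sum_(s in H) f (s * y)%g) / #|H|%:R.

Definition entropy_drop t f : R := entropy f - entropy (midpoint t f).

Lemma sum_lshift s f : \sum_y f (s * y)%g = \sum_y f y.
Proof. by rewrite [RHS](reindex_inj (mulgI s)). Qed.

Lemma entropy_lshift s f : entropy (lshift s f) = entropy f.
Proof. exact: (sum_lshift s (fun y => f y * ln (f y))). Qed.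

Lemma hellinger_ge0 f g : 0 <= hellinger f g.
Proof. by apply: sumr_ge0 => y _; apply: sqr_ge0. Qed.

Lemma entropy_avg_le (E : finType) (F : E -> gT -> R) : (0 < #|E|)%N ->
  (forall e y, 0 <= F e y) ->
  entropy (fun y => (\sum_e F e y) / #|E|%:R) <= (\sum_e entropy (F e)) / #|E|%:R.
Proof.
move=> E0 F0; have N0 : 0 < #|E|%:R :> R by rewrite ltr0n.
rewrite exchange_big mulr_suml; apply: ler_sum => y _.
rewrite mulrAC ler_pM2r ?invr_gt0 //.
set c := (\sum_e F e y) / #|E|%:R.
have S0 : 0 <= \sum_e F e y by apply: sumr_ge0.
have [c0|c0] := eqVneq c 0.
  have S : \sum_e F e y = 0.
    by apply/eqP; move/eqP: c0; rewrite mulf_eq0 invr_eq0 (gt_eqF N0) orbF.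
  rewrite S mul0r; apply: sumr_ge0 => e _.
  by rewrite (psumr_eq0P (fun e _ => F0 e y) S) // mul0r.
have cp : 0 < c by rewrite lt_def c0 divr_ge0 // ltW.
have : \sum_e (F e y * ln c + F e y - c) <= \sum_e (F e y * ln (F e y)).
  by apply: ler_sum => e _; apply: xlnx_tangent.
apply: le_trans; rewrite sumrB big_split /= -mulr_suml sumr_const -mulr_natr.
by rewrite /c divfK ?gt_eqF // addrK.
Qed.

Lemma entropy_drop_ge t f : (forall y, 0 <= f y) ->
  hellinger f (lshift t f) / 4 <= entropy_drop t f.
Proof.
move=> f0; rewrite /entropy_drop /entropy.
have -> : \sum_y f y * ln (f y) =
    \sum_y (f y * ln (f y) + f (t * y)%g * ln (f (t * y)%g)) / 2.
  by rewrite -mulr_suml big_split /= (sum_lshift t (fun y => f y * ln (f y))); lra.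
rewrite -sumrB /hellinger mulr_suml; apply: ler_sum => y _.
have := xlnx_midpoint (f0 y) (f0 (t * y)%g); rewrite /midpoint /lshift.
set u := (_ + _) / 2 * _; set v := f y * _; set w := f _ * _; lra.
Qed.

Lemma entropy_drop_ge0 t f : (forall y, 0 <= f y) -> 0 <= entropy_drop t f.
Proof.
move=> /entropy_drop_ge h; apply: le_trans (h t).
by rewrite divr_ge0 // hellinger_ge0.
Qed.

Lemma entropy_drop1 f : entropy_drop 1%g f = 0.
Proof.
rewrite /entropy_drop; apply/eqP; rewrite subr_eq0; apply/eqP.
by apply: eq_bigr => y _; rewrite /midpoint mul1g mulrDl -splitr.
Qed.

Lemma group_avg_ge0 H f : (forall y, 0 <= f y) -> forall y, 0 <= group_avg H f y.
Proof. by move=> f0 y; rewrite divr_ge0 ?ler0n // sumr_ge0. Qed.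

Lemma cardGR_gt0 H : 0 < #|H|%:R :> R.
Proof. by rewrite ltr0n cardG_gt0. Qed.

Lemma group_avg_lshift H s f y : s \in H -> group_avg H f (s * y)%g = group_avg H f y.
Proof.
move=> sH; rewrite /group_avg; congr (_ / _).
rewrite [RHS](reindex_inj (mulIg s)) /=.
by apply: eq_big => [u|u _]; rewrite ?groupMr // mulgA.
Qed.

Lemma sum_group_avg H f : \sum_y group_avg H f y = \sum_y f y.
Proof.
rewrite -mulr_suml exchange_big /=.
rewrite (eq_bigr (fun=> \sum_y f y)) => [|s _]; last exact: sum_lshift.
by rewrite sumr_const -[X in X / _]mulr_natr mulfK // gt_eqF ?cardGR_gt0.
Qed.

Lemma sum_group_avg_mul H f g : (forall s y, s \in H -> g (s * y)%g = g y) ->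
  \sum_y group_avg H f y * g y = \sum_y f y * g y.
Proof.
move=> gH; rewrite -[RHS](sum_group_avg H); apply: eq_bigr => y _.
rewrite /group_avg mulrAC; congr (_ / _); rewrite mulr_suml.
by apply: eq_bigr => s sH; rewrite gH.
Qed.

Lemma hellinger_group_avg H f g : (forall y, 0 <= f y) -> (forall y, 0 <= g y) ->
  hellinger (group_avg H f) (group_avg H g) <= hellinger f g.
Proof.
move=> f0 g0; have H0 := cardGR_gt0 H.
rewrite [leRHS]/hellinger -(sum_group_avg H); apply: ler_sum => y _.
rewrite /group_avg !sqrtrM ?sumr_ge0 // -mulrBl exprMn sqr_sqrtr ?invr_ge0 ?(ltW H0) //.
by rewrite ler_pM2r ?invr_gt0 // hellinger_jensen.
Qed.

(** The logarithm of the K-average is invariant under K, hence under H, so either average has the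
    same integral against it as f: the difference of entropies is a relative entropy. The terms - a
    + b sum to zero; they make each summand comparable with a Hellinger summand. *)
Lemma entropy_subE H K f : H \subset K ->
  entropy (group_avg H f) - entropy (group_avg K f) =
  \sum_y (group_avg H f y * ln (group_avg H f y) - group_avg H f y * ln (group_avg K f y)
           - group_avg H f y + group_avg K f y).
Proof.
move=> HK; set a := group_avg H f; set b := group_avg K f.
have bK s y : s \in K -> b (s * y)%g = b y by exact: group_avg_lshift.
have bH s y : s \in H -> b (s * y)%g = b y by move/(subsetP HK); exact: bK.
have -> : entropy b = \sum_y a y * ln (b y).
  rewrite (@sum_group_avg_mul H f (fun y => ln (b y))) => [|s y sH]; last by rewrite bH.
  by rewrite -(@sum_group_avg_mul K f (fun y => ln (b y))) // => s y sK; rewrite bK.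
rewrite /entropy -sumrB.
have sab : \sum_y a y = \sum_y b y by rewrite !sum_group_avg.
by rewrite [RHS]big_split /= [X in _ = X + _]sumrB sab addrNK.
Qed.

Lemma entropy_sub_le H K f (N : R) : (forall y, 0 <= f y) -> H \subset K ->
  expR 1 <= N ->
  (forall y, group_avg H f y <= N * group_avg K f y) ->
  entropy (group_avg H f) - entropy (group_avg K f) <=
  5 * ln N * hellinger (group_avg H f) (group_avg K f).
Proof.
move=> f0 HK Ne fN; rewrite entropy_subE // mulr_sumr; apply: ler_sum => y _.
exact: (xlnx_le_hellinger Ne (group_avg_ge0 H f0 y) (fN y)).
Qed.

Lemma hellinger_le_entropy_sub H K f : (forall y, 0 <= f y) -> H \subset K ->
  hellinger (group_avg H f) (group_avg K f) <=
  entropy (group_avg H f) - entropy (group_avg K f).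
Proof.
move=> f0 HK; rewrite entropy_subE //; apply: ler_sum => y _.
have a0 := group_avg_ge0 H f0 y; have b0 := group_avg_ge0 K f0 y.
have [bz|bn] := eqVneq (group_avg K f y) 0.
  suff az : group_avg H f y = 0 by rewrite az bz !(mul0r, subrr, addr0, expr0n).
  have f_eq0 s : s \in K -> f (s * y)%g = 0.
    move: bz => /eqP; rewrite mulf_eq0 invr_eq0 (gt_eqF (cardGR_gt0 K)) orbF => /eqP.
    by move/psumr_eq0P => h sK; apply: h.
  by rewrite /group_avg big1 ?mul0r // => s /(subsetP HK) /f_eq0.
have := sqr_sqrt_le_xlnx a0 (c := group_avg K f y); rewrite lt_def bn b0 => /(_ isT).
by set u := _ * ln _; set v := _ * ln _; set x := _ ^+ 2; lra.
Qed.

End GroupEntropy.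

(** * Chain rule for laws on permutations *)

(** Arithmetic of the induction in [entropy_block_le]: b is the size of the block, e and u are the
    entropies before and after averaging over it, and X is the sum of the entropies with one point
    exposed. Adding b times the bound on b e - X to b - 1 times the bound on X - b u leaves a slack
    of l S. *)
Lemma block_induction_arith (R : realFieldType) (X e u l S b : R) : 2 <= b -> 0 <= l -> 0 <= S ->
  (b - 1) * (b * e - X) <= l * ((b - 2) * S) ->
  b * (X - b * u) <= l * S -> b * (e - u) <= l * S.
Proof.
move=> b2 l0 S0 h1 h2.
have b1 : 0 < b - 1 by lra.
have b0 : 0 < b by lra.
have lS : 0 <= l * S by rewrite mulr_ge0.
rewrite -(ler_pM2l b1) -(ler_pM2l b0).
have : b * ((b - 1) * (b * e - X)) <= b * (l * ((b - 2) * S)) by rewrite ler_pM2l.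
have : (b - 1) * (b * (X - b * u)) <= (b - 1) * (l * S) by rewrite ler_pM2l.
set Y := X in h1 h2 *.
move=> h3 h4.
have -> : b * ((b - 1) * (b * (e - u))) =
    b * ((b - 1) * (b * e - X)) + (b - 1) * (b * (X - b * u)) by rewrite /Y; ring.
apply: le_trans (lerD h4 h3) _.
rewrite -subr_ge0.
have -> : b * ((b - 1) * (l * S)) - (b * (l * ((b - 2) * S)) + (b - 1) * (l * S)) = l * S by ring.
exact: lS.
Qed.

Section PermutationEntropy.
Variables (R : realType) (T : finType).
Implicit Types (f g : {perm T} -> R) (B : {set T}) (i j : T).

(** In [s * y] the permutation [s] acts first, on positions: averaging over [Sym B] forgets how the
    cards inside B are arranged and keeps the law of the cards outside B. *)
Definition sym_avg B f := group_avg (Sym_group B) f.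

(** Cosets of the stabilizer of i in [Sym B], indexed by the point that is sent to i. *)
Lemma sum_Sym_coset B i (F : {perm T} -> R) : i \in B ->
  \sum_(s in Sym B) F s =
  \sum_(j in B) \sum_(s in Sym (B :\ i)) F (tperm i j * s)%g.
Proof.
move=> iB; rewrite (partition_big (fun s : {perm T} => (s^-1)%g i) (mem B)); last first.
  move=> s; rewrite inE => sB /=.
  by rewrite (perm_closed _ (perm_onV sB)).
apply: eq_bigr => j /= jB.
rewrite (reindex_inj (mulgI (tperm i j))) /=; apply: eq_bigl => s.
rewrite !inE invMg permM tpermV.
have tB : perm_on B (tperm i j).
  apply/subsetP => x; rewrite inE => /=; case: tpermP => [->|->|] //.
  by rewrite eqxx.
apply/andP/idP => [[sB /eqP sj]|sB].
  have si : s i = i.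
    by move: sj; rewrite -{2}(tpermL i j) => /perm_inj => e; rewrite -{1}e permKV.
  apply/subsetP => x; rewrite !inE => sx.
  apply/andP; split; first by apply: contraNneq sx => ->; rewrite si.
  have sB' : perm_on B s.
    by rewrite -[s](mulKg (tperm i j)) tpermV perm_onM.
  by apply: (subsetP sB'); rewrite inE.
have si : s i = i by apply: (out_perm sB); rewrite !inE eqxx.
split; last by rewrite -{2}si permK tpermL.
by apply: perm_onM => //; apply: subset_trans sB (subD1set _ _).
Qed.

Lemma SymS (A B : {set T}) : A \subset B -> Sym A \subset Sym B.
Proof. by move=> AB; apply/subsetP => s; rewrite !inE => sA; apply: subset_trans sA AB. Qed.

Lemma card_Sym_coset B i : i \in B ->
  #|Sym B|%:R = #|B|%:R * #|Sym (B :\ i)|%:R :> R.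
Proof.
move=> iB; rewrite !card_Sym [in LHS](cardsD1 i) iB (cardsD1 i B) iB add1n.
by rewrite factS natrM.
Qed.

Lemma sym_avg_coset B i f y : i \in B ->
  sym_avg B f y =
  (\sum_(j in B) sym_avg (B :\ i) (lshift (tperm i j) f) y) / #|B|%:R.
Proof.
move=> iB; rewrite /sym_avg /group_avg /= (sum_Sym_coset _ iB) (card_Sym_coset iB).
rewrite invfM mulrA mulrAC; congr (_ / _); rewrite -mulr_suml; congr (_ / _).
by apply: eq_bigr => j _; apply: eq_bigr => s _; rewrite /lshift mulgA.
Qed.

Definition pair_gain f B i j :=
  hellinger (sym_avg (B :\ i) f) (sym_avg (B :\ i) (lshift (tperm i j) f)).

Lemma pair_gain_ge0 f B i j : 0 <= pair_gain f B i j.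
Proof. exact: hellinger_ge0. Qed.

Lemma pair_gain_le_drop f B i j : (forall y, 0 <= f y) ->
  pair_gain f B i j <= 4 * entropy_drop (tperm i j) f.
Proof.
move=> f0; apply: (@le_trans _ _ (hellinger f (lshift (tperm i j) f))).
  by apply: hellinger_group_avg => // y; rewrite /lshift.
by have := entropy_drop_ge (tperm i j) f0; lra.
Qed.

(** By [sym_avg_coset] the average over [Sym B] is the mean over j of the swapped laws, so this is
    convexity of the squared Hellinger distance. *)
Lemma sum_pair_gain_ge f B i : (forall y, 0 <= f y) -> i \in B ->
  #|B|%:R * hellinger (sym_avg (B :\ i) f) (sym_avg B f) <=
  \sum_(j in B) pair_gain f B i j.
Proof.
move=> f0 iB.
have B0 : 0 < #|B|%:R :> R by rewrite ltr0n card_gt0; apply/set0Pn; exists i.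
rewrite /pair_gain /hellinger exchange_big mulr_sumr; apply: ler_sum => y _ /=.
rewrite (sym_avg_coset _ _ iB).
set a := sym_avg _ f y; pose g j := sym_avg (B :\ i) (lshift (tperm i j) f) y.
have a0 : 0 <= a by apply: group_avg_ge0.
have g0 j : 0 <= g j by apply: group_avg_ge0 => z; rewrite /lshift.
clearbody a.
have e : a = (\sum_(j in B) a) / #|B|%:R.
  by rewrite sumr_const -[X in X / _]mulr_natr mulfK // gt_eqF.
have S0 : 0 <= \sum_(j in B) g j by apply: sumr_ge0 => j _; apply: g0.
have A0 : 0 <= \sum_(j in B) a by apply: sumr_ge0 => j _; apply: a0.
rewrite {1}e !sqrtrM //  -mulrBl exprMn sqr_sqrtr ?invr_ge0 ?(ltW B0) //.
by rewrite mulrCA mulfV ?gt_eqF // mulr1; apply: (@hellinger_jensen _ _ _ (fun=> a) g).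
Qed.

Lemma entropy_expose_le f B i (N : R) : (forall y, 0 <= f y) -> i \in B ->
  expR 1 <= N -> #|B|%:R <= N ->
  #|B|%:R * (entropy (sym_avg (B :\ i) f) - entropy (sym_avg B f)) <=
  5 * ln N * \sum_(j in B) pair_gain f B i j.
Proof.
move=> f0 iB Ne BN.
have B0 : 0 < #|B|%:R :> R by rewrite ltr0n card_gt0; apply/set0Pn; exists i.
have lnN0 : 0 <= 5 * ln N.
  by rewrite mulr_ge0 // ln_ge0 // (le_trans _ Ne) // (le_trans _ (expR_ge1Dx 1)) // lerDl.
apply: le_trans (ler_wpM2l lnN0 (sum_pair_gain_ge f0 iB)).
rewrite mulrCA ler_pM2l //; apply: entropy_sub_le => //; first exact/SymS/subD1set.
(* The likelihood ratio is at most |B|: the term j = i of the coset decomposition is the law on the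
   left. *)
move=> y; apply: (@le_trans _ _ (#|B|%:R * sym_avg B f y)); last first.
  by apply: ler_wpM2r => //; apply: group_avg_ge0.
rewrite (sym_avg_coset _ _ iB) mulrC divfK ?gt_eqF // (bigD1 i) //=.
have -> : lshift (tperm i i) f = f by apply: boolp.funext => z; rewrite /lshift tperm1 mul1g.
by rewrite lerDl sumr_ge0 // => j _; apply: group_avg_ge0 => z; rewrite /lshift.
Qed.

Lemma sym_avg_trivial B f : (#|B| <= 1)%N -> sym_avg B f = f.
Proof.
move=> B1; apply: boolp.funext => y; rewrite /sym_avg /group_avg /=.
have -> : Sym B = 1%g.
  apply/setP => s; rewrite !inE; apply/idP/eqP => [sB|->]; last exact: perm_on1.
  exact: perm_on_id sB B1.
by rewrite big_set1 cards1 mul1g divr1.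
Qed.

(** A pair of distinct points of B survives the removal of x for |B| - 2 choices of x. *)
Lemma sum_pairs_setD1 B (D : T -> T -> R) : (forall i, D i i = 0) ->
  \sum_(x in B) \sum_(i in B :\ x) \sum_(j in B :\ x) D i j =
  (#|B|%:R - 2) * \sum_(i in B) \sum_(j in B) D i j.
Proof.
move=> D0.
have e x : x \in B -> \sum_(i in B :\ x) \sum_(j in B :\ x) D i j =
   \sum_(i in B) \sum_(j in B) D i j - \sum_(j in B) D x j - \sum_(i in B) D i x.
  move=> xB; rewrite [X in _ = X - _ - _](big_setD1 x) //=.
  rewrite (eq_bigr (fun i => \sum_(j in B) D i j - D i x)).
    rewrite sumrB [X in _ = _ - X](big_setD1 x) //= D0 add0r.
    by rewrite [X in X - _ - _]addrC addrK.
  by move=> i _; rewrite [X in _ = X - _](big_setD1 x) //= addrC addrK.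
rewrite (eq_bigr _ e) !sumrB sumr_const -[X in X - _ - _]mulr_natl.
by rewrite [X in _ - X]exchange_big /=; lra.
Qed.

(* Entropy decay for random transpositions: exposing a uniformly chosen point
   of B first and averaging the chain rule over that choice gives the induction
   on the cardinality of B. *)
Lemma entropy_block_le f B (N : R) : (forall y, 0 <= f y) ->
  expR 1 <= N -> #|B|%:R <= N ->
  #|B|%:R * (entropy f - entropy (sym_avg B f)) <=
  20 * ln N * \sum_(i in B) \sum_(j in B) entropy_drop (tperm i j) f.
Proof.
move=> f0 Ne; have lnN0 : 0 <= 20 * ln N.
  by rewrite mulr_ge0 // ln_ge0 // (le_trans _ Ne) // (le_trans _ (expR_ge1Dx 1)) // lerDl.
set D := fun i j => entropy_drop (tperm i j) f.
have D0 i : D i i = 0 by rewrite /D tperm1 entropy_drop1.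
have Dge0 i j : 0 <= D i j by apply: entropy_drop_ge0.
move: {2}#|B|.+1 (ltnSn #|B|) => m; elim: m B => // m IH B Bm BN.
have [B1|B1] := leqP #|B| 1.
  rewrite sym_avg_trivial // subrr mulr0 mulr_ge0 //.
  by apply: sumr_ge0 => i _; apply: sumr_ge0 => j _; apply: Dge0.
set S := \sum_(i in B) _.
have cD x : x \in B -> #|B :\ x|%:R = #|B|%:R - 1 :> R.
  by move=> xB; rewrite (cardsD1 x B) xB natrD [X in _ = X - 1]addrC addrK.
have IHx x : x \in B -> (#|B|%:R - 1) * (entropy f - entropy (sym_avg (B :\ x) f)) <=
    20 * ln N * \sum_(i in B :\ x) \sum_(j in B :\ x) D i j.
  move=> xB; rewrite -(cD x) //; apply: IH.
    by rewrite (cardsD1 x B) xB in Bm.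
  by rewrite cD //; lra.
have Ex x : x \in B -> #|B|%:R * (entropy (sym_avg (B :\ x) f) - entropy (sym_avg B f)) <=
    20 * ln N * \sum_(j in B) D x j.
  move=> xB; apply: le_trans (entropy_expose_le f0 xB Ne BN) _.
  have : \sum_(j in B) pair_gain f B x j <= 4 * \sum_(j in B) D x j.
    by rewrite mulr_sumr; apply: ler_sum => j _; apply: pair_gain_le_drop.
  move=> h; apply: (@le_trans _ _ (5 * ln N * (4 * \sum_(j in B) D x j))).
    by apply: ler_wpM2l h; lra.
  by set u := \sum_(j in B) _; lra.
have b2 : 2 <= #|B|%:R :> R by rewrite ler_nat.
set b := #|B|%:R in cD IHx Ex b2 *.
have sIH : (b - 1) * (b * entropy f - \sum_(x in B) entropy (sym_avg (B :\ x) f)) <=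
    20 * ln N * ((b - 2) * S).
  rewrite -sum_pairs_setD1 // [leRHS]mulr_sumr.
  have -> : b * entropy f = \sum_(x in B) entropy f by rewrite sumr_const -mulr_natl.
  by rewrite -sumrB [leLHS]mulr_sumr; apply: ler_sum.
have sE : b * (\sum_(x in B) entropy (sym_avg (B :\ x) f) - b * entropy (sym_avg B f)) <=
    20 * ln N * S.
  have -> : b * entropy (sym_avg B f) = \sum_(x in B) entropy (sym_avg B f).
    by rewrite sumr_const -mulr_natl.
  by rewrite -sumrB [leLHS]mulr_sumr [leRHS]mulr_sumr; apply: ler_sum.
have S0 : 0 <= S by apply: sumr_ge0 => i _; apply: sumr_ge0 => j _; apply: Dge0.
exact: (block_induction_arith b2 lnN0 S0 sIH sE).
Qed.

End PermutationEntropy.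

(** * Swaps of disjoint pairs of positions *)

Section Matchings.
Variables (R : realType) (n : nat).
Implicit Types (f : 'S_n -> R) (M : seq ('I_n * 'I_n)) (i j k l : 'I_n).

Fixpoint swap_all M f : 'S_n -> R :=
  if M is p :: M' then midpoint (tperm p.1 p.2) (swap_all M' f) else f.

Definition endpoints M : seq 'I_n := flatten [seq [:: p.1; p.2] | p <- M].

Arguments endpoints : simpl never.

Definition upto i : {set 'I_n} := [set x : 'I_n | (x <= i)%N].

Definition ordered_gain f i j : R :=
  if (j <= i)%N then pair_gain f (upto i) i j else pair_gain f (upto j) j i.

Lemma ordered_gain_ge0 f i j : 0 <= ordered_gain f i j.
Proof. by rewrite /ordered_gain; case: ifP => _; apply: pair_gain_ge0. Qed.

Lemma ordered_gainC f i j : ordered_gain f i j = ordered_gain f j i.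
Proof.
rewrite /ordered_gain; case: (ltngtP i j) => // /val_inj ->; by [].
Qed.

Lemma midpoint_ge0 (gT : finGroupType) (t : gT) (f : gT -> R) :
  (forall y, 0 <= f y) -> forall y, 0 <= midpoint t f y.
Proof. by move=> f0 y; rewrite divr_ge0 // addr_ge0. Qed.

Lemma swap_all_ge0 M f : (forall y, 0 <= f y) -> forall y, 0 <= swap_all M f y.
Proof. by move=> f0; elim: M => //= p M IH; apply: midpoint_ge0. Qed.

Lemma midpointC (gT : finGroupType) (s t : gT) (f : gT -> R) : commute s t ->
  midpoint s (midpoint t f) = midpoint t (midpoint s f).
Proof.
move=> st; apply: boolp.funext => y; rewrite /midpoint !mulgA st.
set a := f y; set b := f _; set c := f (s * y)%g; set d := f _; lra.
Qed.

Lemma group_avg_midpoint (gT : finGroupType) (H : {group gT}) (t : gT) (f : gT -> R) :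
  t \in H -> group_avg H (midpoint t f) = group_avg H f.
Proof.
move=> tH; apply: boolp.funext => y; rewrite /group_avg; congr (_ / _).
rewrite /midpoint -mulr_suml big_split /=.
have -> : \sum_(s in H) f (t * (s * y))%g = \sum_(s in H) f (s * y)%g.
  rewrite [RHS](reindex_inj (mulgI t)) /=.
  by apply: eq_big => [s|s _]; rewrite ?groupMl // mulgA.
lra.
Qed.

Lemma lshift_midpoint (gT : finGroupType) (s t : gT) (f : gT -> R) : commute s t ->
  lshift s (midpoint t f) = midpoint t (lshift s f).
Proof.
by move=> st; apply: boolp.funext => y; rewrite /lshift /midpoint !mulgA st.
Qed.

Lemma commute_tperm i j k l : i \notin [:: k; l] -> j \notin [:: k; l] ->
  commute (tperm i j) (tperm k l).
Proof.
rewrite !inE !negb_or => /andP[ik il] /andP[jk jl].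
apply: (perm_onC (tperm_on i j) (tperm_on k l)).
rewrite -setI_eq0; apply/eqP/setP => x; rewrite !inE.
apply/negP => /andP[/orP[]/eqP-> /orP[]/eqP e].
- by rewrite e eqxx in ik.
- by rewrite e eqxx in il.
- by rewrite e eqxx in jk.
- by rewrite e eqxx in jl.
Qed.

(** The swap of k and l commutes with that of i and j and belongs to the group [Sym (upto i :\ i)]
    averaged over, so it is absorbed. *)
Lemma pair_gain_midpoint f i j k l : (j < i)%N -> (k < i)%N -> (l < i)%N ->
  j \notin [:: k; l] ->
  pair_gain (midpoint (tperm k l) f) (upto i) i j = pair_gain f (upto i) i j.
Proof.
move=> ji ki li jkl.
have tB : tperm k l \in Sym_group (upto i :\ i).
  rewrite inE /=; apply: subset_trans (tperm_on k l) _.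
  by apply/subsetP => x; rewrite !inE => /orP[]/eqP->; rewrite -val_eqE /= ltn_eqF // ltnW.
have ct : commute (tperm i j) (tperm k l).
  by apply: commute_tperm => //; rewrite !inE -!val_eqE /= !gtn_eqF.
by rewrite /pair_gain lshift_midpoint // /sym_avg !group_avg_midpoint.
Qed.

Lemma endpoints_cat M1 M2 : endpoints (M1 ++ M2) = endpoints M1 ++ endpoints M2.
Proof. by rewrite /endpoints map_cat flatten_cat. Qed.

Lemma endpoints_cons p M : endpoints (p :: M) = p.1 :: p.2 :: endpoints M.
Proof. by []. Qed.

Lemma mem_endpoints p M : p \in M -> (p.1 \in endpoints M) && (p.2 \in endpoints M).
Proof.
move=> pM; apply/andP; split; apply/flattenP; exists [:: p.1; p.2];
  rewrite ?inE ?eqxx ?orbT //; exact: map_f.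
Qed.

Lemma endpointsP x M : x \in endpoints M -> exists2 p, p \in M & (x == p.1) || (x == p.2).
Proof.
move=> /flattenP[s /mapP[p pM ->]]; rewrite !inE => xp; by exists p.
Qed.

Lemma swap_all_front M1 p M2 f : uniq (endpoints (M1 ++ p :: M2)) ->
  swap_all (M1 ++ p :: M2) f = swap_all (p :: M1 ++ M2) f.
Proof.
elim: M1 => [//|q M1 IH]; rewrite cat_cons endpoints_cons => /andP[].
rewrite inE negb_or => /andP[_ q1] /andP[q2 u'].
rewrite /= IH //= midpointC //.
have /andP[p1 p2] : (p.1 \in endpoints (M1 ++ p :: M2)) && (p.2 \in endpoints (M1 ++ p :: M2)).
  by apply: mem_endpoints; rewrite mem_cat inE eqxx orbT.
have ne x y : x \notin endpoints (M1 ++ p :: M2) -> y \in endpoints (M1 ++ p :: M2) -> x != y.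
  by move=> xn yn; rewrite eq_sym (memPn xn).
by apply: commute_tperm; rewrite !inE negb_or !ne.
Qed.

Lemma pair_gain_swap_all f i j M : (j < i)%N ->
  (forall x, x \in endpoints M -> (x < i)%N && (x != j)) ->
  pair_gain (swap_all M f) (upto i) i j = pair_gain f (upto i) i j.
Proof.
move=> ji; elim: M => //= p M IH h.
have /andP[p1 p1j] := h p.1 (mem_head _ _).
have /andP[p2 p2j] := h p.2 (mem_behead (s := p.1 :: p.2 :: _) (mem_head _ _)).
rewrite pair_gain_midpoint //; last by rewrite !inE negb_or ![j == _]eq_sym p1j.
by apply: IH => x xM; apply: h; rewrite endpoints_cons !inE xM !orbT.
Qed.

(* The chain rule, applied to the pairs in increasing order of their larger
   endpoint i: the swaps made before only involve positions below i, so they do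
   not affect the conditional laws which define the gain of the pair. *)
Lemma sum_ordered_gain_le M f : (forall y, 0 <= f y) -> uniq (endpoints M) ->
  \sum_(p <- M) ordered_gain f p.1 p.2 <= 4 * (entropy f - entropy (swap_all M f)).
Proof.
move=> f0; move: {2}(size M) (leqnn (size M)) => m; elim: m M => [|m IH] M.
  by rewrite leqn0 size_eq0 => /eqP-> _ /=; rewrite big_nil subrr mulr0.
case: M => [|p0 M0] szM uM; first by rewrite big_nil subrr mulr0.
pose key (p : 'I_n * 'I_n) := maxn p.1 p.2.
have [p pM pmax] : exists2 p, p \in p0 :: M0 & forall q, q \in p0 :: M0 -> (key q <= key p)%N.
  elim: M0 p0 {szM uM} => [|q M1 IH1] p0.
    by exists p0; rewrite ?mem_head // => q; rewrite inE => /eqP->.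
  have [p pM pmax] := IH1 q.
  have [le|lt] := leqP (key p0) (key p).
    by exists p; [rewrite inE pM orbT | move=> r; rewrite inE => /orP[/eqP->|/pmax]].
  exists p0; first exact: mem_head.
  by move=> r; rewrite inE => /orP[/eqP->//|/pmax /leq_trans]; apply; apply: ltnW.
move: (p0 :: M0) pM pmax szM uM => M /splitPr[M1 M2] pmax szM uM.
rewrite swap_all_front // (perm_big (p :: M1 ++ M2)) /=; last first.
  by rewrite -[p :: M2]cat1s perm_catCA perm_refl.
have u2 : uniq (endpoints (p :: M1 ++ M2)).
  move: uM; rewrite endpoints_cons !endpoints_cat endpoints_cons.
  by rewrite -[p.1 :: p.2 :: endpoints M2]/([:: p.1; p.2] ++ endpoints M2) uniq_catCA.
set M' := M1 ++ M2 in u2 *.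
have u3 : uniq (endpoints M') by move: u2; rewrite endpoints_cons => /and3P[].
have szM' : (size M' <= m)%N by move: szM; rewrite !size_cat /= addnS ltnS.
rewrite big_cons.
have := IH M' szM' u3.
set h := swap_all M' f => le1.
have h0 : forall y, 0 <= h y by apply: swap_all_ge0.
suff le2 : ordered_gain f p.1 p.2 <= 4 * (entropy h - entropy (midpoint (tperm p.1 p.2) h)).
  by lra.
have sep x : x \in endpoints M' -> [&& (x < key p)%N, x != p.1 & x != p.2].
  move=> xM; have [q qM xq] := endpointsP xM.
  have qM2 : q \in M1 ++ p :: M2 by move: qM; rewrite !mem_cat inE => /orP[->|->]; rewrite ?orbT.
  have xk : (x <= key p)%N.
    apply: leq_trans (pmax q qM2); rewrite /key leq_max.
    by case/orP: xq => /eqP->; rewrite leqnn ?orbT.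
  move: u2; rewrite endpoints_cons /= inE negb_or => /and3P[/andP[_ n1] n2 _].
  rewrite (memPn n1 _ xM) (memPn n2 _ xM) !andbT ltn_neqAle xk andbT /key.
  by case: (leqP p.1 p.2) => _; rewrite val_eqE ?(memPn n1 _ xM) ?(memPn n2 _ xM).
have p12 : p.1 != p.2.
  by move: u2; rewrite endpoints_cons /= inE negb_or => /andP[/andP[]].
rewrite /ordered_gain; case: leqP => [le|lt].
  have lt : (p.2 < p.1)%N by rewrite ltn_neqAle le eq_sym val_eqE p12.
  rewrite -(pair_gain_swap_all f (M := M')) //; last first.
    by move=> x /sep /and3P[]; rewrite /key (maxn_idPl le) => -> _ ->.
  exact: pair_gain_le_drop.
rewrite -(pair_gain_swap_all f (M := M')) //; last first.
  by move=> x /sep /and3P[]; rewrite /key (maxn_idPr (ltnW lt)) => -> ->.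
by rewrite tpermC; apply: pair_gain_le_drop.
Qed.

End Matchings.

Arguments endpoints : simpl never.

(** * Entropy decrease through collisions, for an abstract random walk on permutations *)

Section CollisionMatching.
Variables (R : realType) (n : nat) (E : finType) (r : E -> 'S_n).
Variables (q : E -> option ('I_n * 'I_n)) (kappa : E -> E).
Hypothesis E_gt0 : (0 < #|E|)%N.
Hypothesis rK : forall e, involutive (r e).
Hypothesis kappaI : injective kappa.
Hypothesis q_kappa : forall e, q (kappa e) = q e.
Hypothesis r_kappa : forall e p, q e = Some p -> r (kappa e) = (tperm p.1 p.2 * r e)%g.
Hypothesis q_neq : forall e p, q e = Some p -> p.1 != p.2.
Implicit Types (f : 'S_n -> R) (M : seq ('I_n * 'I_n)) (H : {set 'I_n}).

Definition mean_op f : 'S_n -> R := fun y => (\sum_e f (r e * y)%g) / #|E|%:R.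

Definition relabel (s : 'S_n) M := [seq (s p.1, s p.2) | p <- M].

Definition collided e : {set 'I_n} :=
  if q e is Some p then [set p.1; p.2] else set0.

Definition fresh_collision e H : seq ('I_n * 'I_n) :=
  if q e is Some p then (if (p.1 \notin H) && (p.2 \notin H) then [:: p] else [::])
  else [::].

(** Expectation of [Phi] at the random matching collected in w steps. H holds the current positions
    of the cards that have already collided; only a collision of two other cards is collected. Later
    pairs are carried back by [relabel], so that all pairs refer to the initial positions. *)
Fixpoint match_mean w H (Phi : seq ('I_n * 'I_n) -> R) : R :=
  if w is w'.+1 then
    (\sum_e match_mean w' (r e @: (H :|: collided e))
       (fun M => Phi (relabel (r e) M ++ fresh_collision e H))) / #|E|%:R
  else Phi [::].

(** The first t steps only move the cards; nothing is collected from them. *)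
Fixpoint late_match_mean t w (Phi : seq ('I_n * 'I_n) -> R) : R :=
  if t is t'.+1 then
    (\sum_e late_match_mean t' w (fun M => Phi (relabel (r e) M))) / #|E|%:R
  else match_mean w set0 Phi.

Let N0 : 0 < #|E|%:R :> R. Proof. by rewrite ltr0n. Qed.

Lemma mean_op_ge0 f : (forall y, 0 <= f y) -> forall y, 0 <= mean_op f y.
Proof. by move=> f0 y; rewrite divr_ge0 ?ler0n // sumr_ge0. Qed.

Lemma iter_mean_op_ge0 t f : (forall y, 0 <= f y) -> forall y, 0 <= iter t mean_op f y.
Proof. by move=> f0; elim: t => //= t IH; apply: mean_op_ge0. Qed.

Lemma sum_mean_op f : \sum_y mean_op f y = \sum_y f y.
Proof.
rewrite -mulr_suml exchange_big /= (eq_bigr (fun=> \sum_y f y)) => [|e _].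
  by rewrite sumr_const -[X in X / _]mulr_natr mulfK // gt_eqF.
exact: sum_lshift.
Qed.

Lemma iter_mean_op_avg t (F : E -> 'S_n -> R) :
  iter t mean_op (fun y => (\sum_e F e y) / #|E|%:R) =
  (fun y => (\sum_e iter t mean_op (F e) y) / #|E|%:R).
Proof.
elim: t => //= t ->; apply: boolp.funext => y; rewrite /mean_op.
rewrite -mulr_suml; congr (_ / _); rewrite exchange_big /= mulr_suml.
by apply: eq_bigr => e _.
Qed.

(** Reindexing by [kappa] averages each move with its partner, which produces the midpoints.
    Freshness depends on [q e] only, hence is the same for both partners, so H is arbitrary. *)
Lemma mean_op_fresh H f :
  mean_op f = (fun y => (\sum_e lshift (r e) (swap_all (fresh_collision e H) f) y) / #|E|%:R).
Proof.
apply: boolp.funext => y; congr (_ / _).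
pose act e := if q e is Some p then (p.1 \notin H) && (p.2 \notin H) else false.
pose F e := f (r e * y)%g.
have act_kappa e : act (kappa e) = act e by rewrite /act q_kappa.
rewrite [LHS](bigID act) [RHS](bigID act) /=; congr (_ + _); last first.
  apply: eq_bigr => e; rewrite /act /lshift /fresh_collision.
  by case: (q e) => [p /negbTE-> //|].
have -> : \sum_(e | act e) lshift (r e) (swap_all (fresh_collision e H) f) y =
    \sum_(e | act e) (F e + F (kappa e)) / 2.
  apply: eq_bigr => e; rewrite /act /lshift /fresh_collision /F.
  case qe: (q e) => [p|//] ->; rewrite /= /midpoint.
  by rewrite (r_kappa qe) mulgA.
rewrite -mulr_suml big_split /=.
have <- : \sum_(e | act e) F e = \sum_(e | act e) F (kappa e).
  rewrite (reindex_inj kappaI) /=; apply: eq_bigl => e; exact: act_kappa.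
by rewrite -/F; lra.
Qed.

Lemma swap_all_cat M1 M2 f : swap_all (M1 ++ M2) f = swap_all M1 (swap_all M2 f).
Proof. by elim: M1 => //= p M1 ->. Qed.

Lemma swap_all_lshift e M f :
  swap_all M (lshift (r e) f) = lshift (r e) (swap_all (relabel (r e) M) f).
Proof.
elim: M => //= p M ->; apply: boolp.funext => y; rewrite /midpoint /lshift.
congr ((_ + swap_all _ _ _) / 2).
have -> : tperm (r e p.1) (r e p.2) = (r e * tperm p.1 p.2 * (r e)^-1)%g.
  have rV : (r e)^-1%g = r e by apply/permP => x; apply: (canLR (permK _)); rewrite rK.
  by rewrite -tpermJ conjgE rV mulgA.
by rewrite !mulgA mulgKV.
Qed.

Lemma match_mean_affine w H (a c : R) Phi :
  match_mean w H (fun M => a * Phi M + c) = a * match_mean w H Phi + c.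
Proof.
elim: w H Phi => //= w IH H Phi.
rewrite (eq_bigr (fun e => a * match_mean w (r e @: (H :|: collided e))
  (fun M => Phi (relabel (r e) M ++ fresh_collision e H)) + c)); last first.
  move=> e _; exact: (IH _ (fun M => Phi (relabel (r e) M ++ fresh_collision e H))).
rewrite big_split /= sumr_const -mulr_sumr mulrDl -mulrA; congr (_ + _).
by rewrite -[X in X / _]mulr_natr mulfK // gt_eqF.
Qed.

Lemma late_match_mean_affine t w (a c : R) Phi :
  late_match_mean t w (fun M => a * Phi M + c) = a * late_match_mean t w Phi + c.
Proof.
elim: t Phi => [Phi|t IH Phi] /=; first exact: match_mean_affine.
rewrite (eq_bigr (fun e => a * late_match_mean t w
  (fun M => Phi (relabel (r e) M)) + c)); last first.
  move=> e _; exact: (IH (fun M => Phi (relabel (r e) M))).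
rewrite big_split /= sumr_const -mulr_sumr mulrDl -mulrA; congr (_ + _).
by rewrite -[X in X / _]mulr_natr mulfK // gt_eqF.
Qed.

Lemma endpoints_relabel (s : 'S_n) M : endpoints (relabel s M) = map s (endpoints M).
Proof. by elim: M => //= p M IH; rewrite !endpoints_cons /= IH. Qed.

(** Only lists that can occur are compared. A collected pair avoids H, and later pairs avoid it
    because its cards join H: this is the disjointness required by [sum_ordered_gain_le]. *)
Lemma match_mean_le w H (Phi Psi : seq ('I_n * 'I_n) -> R) :
  (forall M, uniq (endpoints M) -> {in endpoints M, forall x, x \notin H} ->
     Phi M <= Psi M) ->
  match_mean w H Phi <= match_mean w H Psi.
Proof.
elim: w H Phi Psi => [|w IH] H Phi Psi le /=; first exact: le.
rewrite ler_pM2r ?invr_gt0 //; apply: ler_sum => e _; apply: IH => M uM HM.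
have nH x : x \in endpoints M -> (r e x \notin H) && (r e x \notin collided e).
  move=> /HM xn; rewrite -negb_or -in_setU; apply: contra xn => h.
  by rewrite -(rK e x); apply: imset_f.
have fr x : x \in endpoints (fresh_collision e H) -> (x \notin H) && (x \in collided e).
  rewrite /fresh_collision /collided; case: (q e) => [p|//].
  case: ifP => // /andP[p1 p2]; rewrite !inE.
  by case/orP=> /eqP->; rewrite ?p1 ?p2 eqxx ?orbT.
apply: le.
  rewrite endpoints_cat endpoints_relabel cat_uniq map_inj_uniq ?uM //=; last exact: perm_inj.
  apply/andP; split.
    apply/hasPn => x /fr /andP[_ xc]; apply/negP => /mapP[z /nH /andP[_ zn] xz].
    by rewrite xz (negbTE zn) in xc.
  rewrite /fresh_collision; case qe: (q e) => [p|//]; case: ifP => _ //.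
  by rewrite endpoints_cons /= inE (q_neq qe).
move=> x; rewrite endpoints_cat endpoints_relabel mem_cat => /orP[/mapP[z /nH /andP[zn _] ->] //|].
by move/fr/andP => [].
Qed.

Lemma late_match_mean_le t w (Phi Psi : seq ('I_n * 'I_n) -> R) :
  (forall M, uniq (endpoints M) -> Phi M <= Psi M) ->
  late_match_mean t w Phi <= late_match_mean t w Psi.
Proof.
elim: t Phi Psi => [|t IH] Phi Psi le /=.
  by apply: match_mean_le => M uM _; apply: le.
rewrite ler_pM2r ?invr_gt0 //; apply: ler_sum => e _; apply: IH => M uM.
by apply: le; rewrite endpoints_relabel map_inj_uniq //; apply: perm_inj.
Qed.

Lemma entropy_match_mean w H f : (forall y, 0 <= f y) ->
  entropy (iter w mean_op f) <= match_mean w H (fun M => entropy (swap_all M f)).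
Proof.
elim: w H f => [|w IH] H f f0 //; rewrite iterSr (mean_op_fresh H) iter_mean_op_avg.
have F0 e : forall y, 0 <= lshift (r e) (swap_all (fresh_collision e H) f) y.
  by move=> y; apply: swap_all_ge0.
apply: le_trans (entropy_avg_le _ _) _ => //.
  by move=> e y; apply: iter_mean_op_ge0.
rewrite /= ler_pM2r ?invr_gt0 //; apply: ler_sum => e _.
apply: le_trans (IH (r e @: (H :|: collided e)) _ (F0 e)) _.
apply: match_mean_le => M _ _.
by rewrite swap_all_lshift entropy_lshift swap_all_cat.
Qed.

Lemma entropy_late_match_mean t w f : (forall y, 0 <= f y) ->
  entropy (iter (w + t) mean_op f) <=
  late_match_mean t w (fun M => entropy (swap_all M f)).
Proof.
elim: t f => [|t IH] f f0; first by rewrite addn0; apply: entropy_match_mean.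
rewrite addnS iterSr.
have -> : mean_op f = (fun y => (\sum_e lshift (r e) f y) / #|E|%:R) by [].
rewrite iter_mean_op_avg.
have F0 e : forall y, 0 <= lshift (r e) f y by move=> y; apply: f0.
apply: le_trans (entropy_avg_le _ _) _ => //.
  by move=> e y; apply: iter_mean_op_ge0.
rewrite /= ler_pM2r ?invr_gt0 //; apply: ler_sum => e _.
apply: le_trans (IH _ (F0 e)) _.
apply: late_match_mean_le => M _.
by rewrite swap_all_lshift entropy_lshift.
Qed.

Definition pair_op (h : 'I_n -> 'I_n -> R) : 'I_n -> 'I_n -> R :=
  fun i j => (\sum_e h (r e i) (r e j)) / #|E|%:R.

Definition free_op (h : 'I_n -> 'I_n -> R) : 'I_n -> 'I_n -> R :=
  fun i j => (\sum_(e | (i \notin collided e) && (j \notin collided e))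
                h (r e i) (r e j)) / #|E|%:R.

Definition collision_prob i j : R := #|[set e | q e == Some (i, j)]|%:R / #|E|%:R.

(** Probability that within w steps the cards at i and j collide with each other, in this
    orientation, before either takes part in another collision. Unlike [match_mean], it follows two
    cards only. *)
Fixpoint match_prob w : 'I_n -> 'I_n -> R :=
  if w is w'.+1 then fun i j => collision_prob i j + free_op (match_prob w') i j
  else fun _ _ => 0.

Lemma match_prob_ge0 w i j : 0 <= match_prob w i j.
Proof.
elim: w i j => //= w IH i j; rewrite addr_ge0 ?divr_ge0 ?ler0n //.
by apply: sumr_ge0 => e _.
Qed.

Lemma sum_relabel (g : 'I_n -> 'I_n -> R) (s : 'S_n) M :
  \sum_(p <- relabel s M) g p.1 p.2 = \sum_(p <- M) g (s p.1) (s p.2).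
Proof. by rewrite /relabel big_map. Qed.

Let unhit H (p : 'I_n * 'I_n) := (p.1 \notin H) && (p.2 \notin H).

Lemma sum_collision_prob H (g : 'I_n -> 'I_n -> R) :
  \sum_(p | unhit H p) collision_prob p.1 p.2 * g p.1 p.2 =
  (\sum_e \sum_(p <- fresh_collision e H) g p.1 p.2) / #|E|%:R.
Proof.
rewrite (eq_bigr (fun p => (\sum_e (q e == Some p)%:R * g p.1 p.2) / #|E|%:R)); last first.
  move=> [i j] _ /=; rewrite /collision_prob mulrAC; congr (_ / _).
  by rewrite -mulr_suml -sum1_card natr_sum big_mkcond /=; congr (_ * _);
    apply: eq_bigr => e _; rewrite inE; case: (_ == _).
rewrite -mulr_suml; congr (_ / _); rewrite exchange_big /=; apply: eq_bigr => e _.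
rewrite /fresh_collision; case: (q e) => [p|]; last first.
  by rewrite big_nil big1 // => p _; rewrite mul0r.
case: ifP => pH.
  rewrite big_seq1 (bigD1 p) //= eqxx mul1r big1 ?addr0 // => p' /andP[_ pp'].
  by rewrite (inj_eq Some_inj) eq_sym (negbTE pp') mul0r.
rewrite big_nil big1 // => p' p'H; rewrite (inj_eq Some_inj).
by case: eqVneq => [pp|_]; [move: p'H; rewrite /unhit -pp pH | rewrite mul0r].
Qed.

Lemma sum_free_op H (A g : 'I_n -> 'I_n -> R) :
  \sum_(p | unhit H p) free_op A p.1 p.2 * g p.1 p.2 =
  (\sum_e \sum_(p | unhit (r e @: (H :|: collided e)) p)
     A p.1 p.2 * g (r e p.1) (r e p.2)) / #|E|%:R.
Proof.
pose r2 e (p : 'I_n * 'I_n) := (r e p.1, r e p.2).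
have r2K e : involutive (r2 e) by case=> i j; rewrite /r2 /= !rK.
rewrite (eq_bigr (fun p => (\sum_(e | unhit (collided e) p)
   A (r e p.1) (r e p.2) * g p.1 p.2) / #|E|%:R)); last first.
  by move=> p _; rewrite /free_op mulrAC; congr (_ / _); rewrite mulr_suml.
rewrite -mulr_suml; congr (_ / _).
rewrite (exchange_big_dep predT) //=; apply: eq_bigr => e _.
rewrite [RHS](reindex_inj (inv_inj (r2K e))) /=; apply: eq_big => [p|p _]; last by rewrite !rK.
have mem x : (r e x \notin r e @: (H :|: collided e)) = (x \notin H) && (x \notin collided e).
  by rewrite mem_imset ?in_setU ?negb_or //; apply: perm_inj.
by rewrite /unhit /= !mem; case: (p.1 \in H); case: (p.2 \in H); rewrite ?andbF.
Qed.

(** Linearity of expectation: a sum over the collected matching involves the motion of two cards at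
    a time. *)
Lemma match_mean_sum_ge w H (g : 'I_n -> 'I_n -> R) : (forall i j, 0 <= g i j) ->
  \sum_(p | unhit H p) match_prob w p.1 p.2 * g p.1 p.2 <=
  match_mean w H (fun M => \sum_(p <- M) g p.1 p.2).
Proof.
move=> g0; elim: w H g g0 => [|w IH] H g g0 /=.
  by rewrite big_nil big1 // => p _; rewrite mul0r.
rewrite (eq_bigr (fun p => collision_prob p.1 p.2 * g p.1 p.2 +
  free_op (match_prob w) p.1 p.2 * g p.1 p.2)); last by move=> p _; rewrite mulrDl.
rewrite big_split /= sum_collision_prob sum_free_op -mulrDl ler_pM2r ?invr_gt0 //.
rewrite -big_split /=; apply: ler_sum => e _.
set c := \sum_(p <- fresh_collision e H) _.
pose g' i j := g (r e i) (r e j).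
have -> : (fun M => \sum_(p <- relabel (r e) M ++ fresh_collision e H) g p.1 p.2) =
    (fun M => 1 * (\sum_(p <- M) g' p.1 p.2) + c).
  by apply: boolp.funext => M; rewrite big_cat sum_relabel mul1r.
rewrite match_mean_affine mul1r addrC lerD2r.
by apply: (IH _ g') => i j; apply: g0.
Qed.

Lemma late_match_mean_sum_ge t w (g : 'I_n -> 'I_n -> R) : (forall i j, 0 <= g i j) ->
  \sum_p iter t pair_op (match_prob w) p.1 p.2 * g p.1 p.2 <=
  late_match_mean t w (fun M => \sum_(p <- M) g p.1 p.2).
Proof.
pose r2 e (p : 'I_n * 'I_n) := (r e p.1, r e p.2).
have r2K e : involutive (r2 e) by case=> i j; rewrite /r2 /= !rK.
elim: t g => [|t IH] g g0 /=.
  apply: le_trans (match_mean_sum_ge _ _ g0).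
  rewrite le_eqVlt; apply/orP; left; apply/eqP; apply: eq_bigl => p.
  by rewrite /unhit !in_set0.
set A := iter t pair_op _.
rewrite (eq_bigr (fun p => (\sum_e A (r e p.1) (r e p.2) * g p.1 p.2) / #|E|%:R)); last first.
  by move=> p _; rewrite /pair_op mulrAC; congr (_ / _); rewrite mulr_suml.
rewrite -mulr_suml ler_pM2r ?invr_gt0 // exchange_big /=; apply: ler_sum => e _.
pose g' i j := g (r e i) (r e j).
have -> : (fun M => \sum_(p <- relabel (r e) M) g p.1 p.2) =
    (fun M => \sum_(p <- M) g' p.1 p.2).
  by apply: boolp.funext => M; rewrite sum_relabel.
apply: le_trans (IH g' _); last by move=> i j; apply: g0.
rewrite (reindex_inj (inv_inj (r2K e))) /=.
by apply: ler_sum => p _; rewrite /= !rK.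
Qed.

Theorem entropy_decrease_matching t w f : (forall y, 0 <= f y) ->
  \sum_p iter t pair_op (match_prob w) p.1 p.2 * ordered_gain f p.1 p.2 <=
  4 * (entropy f - entropy (iter (w + t) mean_op f)).
Proof.
move=> f0; apply: le_trans (late_match_mean_sum_ge _ _ (ordered_gain_ge0 f)) _.
apply: le_trans (late_match_mean_le _ _ _) _.
  by move=> M uM; apply: sum_ordered_gain_le.
have -> : (fun M => 4 * (entropy f - entropy (swap_all M f))) =
    (fun M => -4 * entropy (swap_all M f) + 4 * entropy f).
  by apply: boolp.funext => M; lra.
rewrite late_match_mean_affine.
by have := entropy_late_match_mean t w f0; lra.
Qed.

(** A single step collects at most one pair, so the entropy drop itself appears in place of the
    Hellinger gain. This is the form needed for cards at short distance. *)
Lemma entropy_decrease_step f : (forall y, 0 <= f y) ->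
  \sum_p collision_prob p.1 p.2 * entropy_drop (tperm p.1 p.2) f <=
  entropy f - entropy (mean_op f).
Proof.
move=> f0; have := @entropy_match_mean 1 set0 f f0.
have -> : match_mean 1 set0 (fun M => entropy (swap_all M f)) =
   entropy f - \sum_p collision_prob p.1 p.2 * entropy_drop (tperm p.1 p.2) f.
  have -> : \sum_p collision_prob p.1 p.2 * entropy_drop (tperm p.1 p.2) f =
     \sum_(p | unhit set0 p) collision_prob p.1 p.2 * entropy_drop (tperm p.1 p.2) f.
    by apply: eq_bigl => p; rewrite /unhit !in_set0.
  rewrite (sum_collision_prob set0 (fun i j => entropy_drop (tperm i j) f)) /=.
  have {1}-> : entropy f = (\sum_(e : E) entropy f) / #|E|%:R.
    by rewrite sumr_const -[X in X / _]mulr_natr mulfK // gt_eqF.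
  rewrite -mulrBl; congr (_ / _); rewrite -sumrB; apply: eq_bigr => e _.
  rewrite /fresh_collision; case: (q e) => [p|]; last by rewrite big_nil subr0.
  by rewrite !in_set0 /= big_seq1 /entropy_drop subKr.
by move=> h; move: h => /=; lra.
Qed.

End CollisionMatching.

(** * Motion of two cards *)

Section CyclicPositions.
Variable n' : nat.
Local Notation n := n'.+1.
Implicit Types (i j v : 'I_n) (k l : nat).

Definition offset i j : nat := val (j - i).

Lemma offset_lt i j : (offset i j < n)%N. Proof. exact: ltn_ord. Qed.

Lemma pos_addE v k : pos_add v k = v + inZp k.
Proof. by apply: val_inj; rewrite /= modnDmr. Qed.

Lemma rev_posE v l i :
  rev_pos v l i = if (offset v i <= l)%N then v + inZp (l - offset v i) else i.
Proof.
rewrite /rev_pos pos_addE.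
have -> : ((i + (n - v)) %% n = offset v i)%N by rewrite /offset /= modnDmr.
by [].
Qed.

Lemma offset_addr i v k : offset i (v + inZp k) = ((offset i v + k) %% n)%N.
Proof. by rewrite /offset addrAC /= modnDmr. Qed.

Lemma offset_shift i j s : offset (i + s) (j + s) = offset i j.
Proof. by rewrite /offset opprD addrACA subrr addr0. Qed.

Lemma offset_id i : offset i i = 0%N. Proof. by rewrite /offset subrr. Qed.

Lemma offset_self v k : (k < n)%N -> offset v (v + inZp k) = k.
Proof. by move=> kn; rewrite offset_addr offset_id modn_small. Qed.

Lemma add_offset i j : i + inZp (offset i j) = j.
Proof. by rewrite /offset valZpK addrC subrK. Qed.

Lemma offset_trans i v j : offset i j = ((offset i v + offset v j) %% n)%N.
Proof. by rewrite -{1}(add_offset v j) offset_addr. Qed.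

Lemma modn_if a b : (a < n)%N -> (b < n)%N ->
  ((a + b) %% n = if (a + b < n)%N then a + b else a + b - n)%N.
Proof.
move=> an bn; case: ifP => [/modn_small//|/negbT]; rewrite -leqNgt => h.
by rewrite -{1}(subnK h) modnDr modn_small //; lia.
Qed.

Lemma offset_rev i j : offset j i = (if offset i j == 0 then 0 else n - offset i j)%N.
Proof.
have := offset_trans i j i; rewrite offset_id modn_if ?offset_lt //.
have := offset_lt i j; have := offset_lt j i; case: ifP; case: eqP; lia.
Qed.

Lemma offset_eq0 i j : (offset i j == 0)%N = (i == j).
Proof.
rewrite /offset; apply/eqP/eqP => [h|->]; last by rewrite subrr.
by apply/esym/eqP; rewrite -subr_eq0; apply/eqP/val_inj.
Qed.

Definition cyc_dist i j : nat := minn (offset i j) (n - offset i j).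

Lemma cyc_distC i j : cyc_dist i j = cyc_dist j i.
Proof.
rewrite /cyc_dist (offset_rev i j); have := offset_lt i j.
by case: eqP => [->|]; lia.
Qed.

Lemma cyc_dist_gt0 i j : i != j -> (0 < cyc_dist i j)%N.
Proof. by rewrite -offset_eq0 /cyc_dist; have := offset_lt i j; lia. Qed.

Lemma cyc_dist_le i j : (j <= i)%N -> (cyc_dist i j <= i - j)%N.
Proof.
move=> ji; rewrite cyc_distC /cyc_dist.
suff -> : offset j i = (i - j)%N by rewrite geq_minl.
rewrite /offset /= modnDmr addnBA ?(ltnW (ltn_ord j)) // addnC -addnBA // modnDl modn_small //.
exact: leq_ltn_trans (leq_subr _ _) (ltn_ord i).
Qed.

Lemma offset_rev_pos_both v l i j : (l < n)%N -> (offset v i <= l)%N -> (offset v j <= l)%N ->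
  offset (rev_pos v l i) (rev_pos v l j) = offset j i.
Proof.
move=> ln il jl; rewrite !rev_posE il jl offset_addr.
have -> : offset (v + inZp (l - offset v i)) v =
    (if offset v i == l then 0 else n - (l - offset v i))%N.
  rewrite offset_rev offset_self; last by lia.
  by case: eqP; case: eqP; lia.
rewrite (offset_trans j v i) (offset_rev v j) !modn_if; try by case: eqP; lia.
by case: (eqVneq (offset v j) 0%N); case: eqP; repeat case: ifP; lia.
all: lia.
Qed.

Lemma count_interval (P : pred nat) lo hi :
  (forall a, P a -> (lo <= a < hi)%N) -> (\sum_(a < n) P a <= hi - lo)%N.
Proof.
move=> Ph; rewrite -(big_mkord xpredT (fun a => nat_of_bool (P a))).
rewrite -big_mkcond /= sum1_count -size_filter -(size_iota lo (hi - lo)).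
apply: uniq_leq_size; first by rewrite filter_uniq // iota_uniq.
by move=> a; rewrite mem_filter mem_iota => /andP[/Ph ha _]; lia.
Qed.

End CyclicPositions.

(** * Sums over all reversals *)

Section ReversalSums.
Variables (R : realType) (n' L : nat).
Local Notation n := n'.+1.
Hypothesis Ln : (4 * L <= n)%N.
Hypothesis L6 : (6 <= L)%N.
Local Notation E := ('I_n * 'I_L.+1)%type.
Implicit Types (e : E) (i j v : 'I_n) (p : 'I_n * 'I_n) (c : bool).

Definition rv e i := rev_pos e.1 e.2 i.

Let l_lt e : (e.2 < n)%N.
Proof. by have := ltn_ord e.2; lia. Qed.

Let l_le e : (e.2 <= L)%N. Proof. by rewrite -ltnS. Qed.

Lemma rvK e : involutive (rv e).
Proof. exact: rev_posK (l_lt e). Qed.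

Lemma offset_rv e i :
  offset e.1 (rv e i) = (if offset e.1 i <= e.2 then e.2 - offset e.1 i else offset e.1 i)%N.
Proof.
rewrite /rv rev_posE; case: ifP => // _; rewrite offset_self //.
by have := l_lt e; lia.
Qed.

Lemma sum_shape (V : nmodType) (F : E -> V) i :
  \sum_e F e = \sum_(l < L.+1) \sum_(x < n) F (i + x, l).
Proof.
rewrite (eq_bigr (fun e => F (e.1, e.2))); last by case.
rewrite -(pair_bigA _ (fun v l => F (v, l))) exchange_big /=.
by apply: eq_bigr => l _; rewrite (reindex_inj (addrI i)).
Qed.

Lemma sum_offset (V : nmodType) (F : nat -> nat -> V) i :
  \sum_(e : E) F (offset e.1 i) e.2 = \sum_(l < L.+1) \sum_(a < n) F a l.
Proof.
rewrite (sum_shape _ 0); apply: eq_bigr => l _ /=.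
rewrite (reindex_inj (inj_comp (addrI i) oppr_inj)) /=; apply: eq_bigr => a _.
by rewrite /offset add0r opprD opprK addrA subrr add0r.
Qed.

Lemma sum_covered (F : nat -> nat -> R) i :
  \sum_(e : E) (if (offset e.1 i <= e.2)%N then F (offset e.1 i) e.2 else 0) =
  \sum_(l < L.+1) \sum_(a < l.+1) F a l.
Proof.
rewrite (sum_offset (fun a l => if (a <= l)%N then F a l else 0)).
apply: eq_bigr => l _; rewrite -big_mkcond /=.
have ln : (l.+1 <= n)%N by have := ltn_ord l; lia.
by rewrite (big_ord_widen n (fun a => F a l) ln).
Qed.

(** At this distance no interval covers both cards. Covering j at depth a changes the offset by l -
    2 a, covering i changes it by 2 a - l, and exchanging a with l - a identifies the two sums,
    hence the factor 2. *)
Lemma sum_far (Phi : nat -> R) i j : (L < offset i j)%N -> (offset i j + L < n)%N ->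
  \sum_e Phi (offset (rv e i) (rv e j)) =
  \sum_(e : E) Phi (offset i j) +
  \sum_(l < L.+1) \sum_(a < l.+1) (Phi (offset i j + l - 2 * a)%N - Phi (offset i j)) *+ 2.
Proof.
set D := offset i j => LD Dn.
pose G b l := Phi (D + l - 2 * b)%N - Phi D.
pose G' a l := Phi (D + 2 * a - l)%N - Phi D.
have pw e : Phi (offset (rv e i) (rv e j)) =
    Phi D + ((if (offset e.1 j <= e.2)%N then G (offset e.1 j) e.2 else 0) +
             (if (offset e.1 i <= e.2)%N then G' (offset e.1 i) e.2 else 0)).
  have := l_le e; have := offset_trans i e.1 j.
  rewrite modn_if ?offset_lt // (offset_rev e.1 i) -/D.
  rewrite /rv !rev_posE; have := offset_lt e.1 i; have := offset_lt e.1 j.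
  set a := offset e.1 i; set b := offset e.1 j; set l := nat_of_ord e.2.
  move=> bn an De lL.
  case: (leqP a l) => al; case: (leqP b l) => bl.
  - by exfalso; move: De; case: eqP => _; case: ifP; lia.
  - rewrite add0r /G'.
    have -> : offset (e.1 + inZp (l - a)) j = (D + 2 * a - l)%N.
      have h : offset (e.1 + inZp (l - a)) e.1 = (if l == a then 0 else n - (l - a))%N.
        rewrite offset_rev offset_self; last by lia.
        by case: eqP => ?; case: eqP => ?; lia.
      rewrite (offset_trans _ e.1) -/b h modn_if //; last by case: eqP; lia.
      by move: De; case: eqP => ?; case: eqP => ?; repeat case: ifP; lia.
    by rewrite addrC subrK.
  - rewrite addr0 /G.
    have -> : offset i (e.1 + inZp (l - b)) = (D + l - 2 * b)%N.
      rewrite offset_addr (offset_rev e.1) -/a modn_if.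
      + by move: De; case: eqP => ?; repeat case: ifP; lia.
      + by case: eqP; lia.
      + by lia.
    by rewrite addrC subrK.
  - by rewrite -/D !addr0.
rewrite (eq_bigr _ (fun e _ => pw e)) big_split /=; congr (_ + _).
rewrite big_split /= sum_covered sum_covered -big_split /=.
apply: eq_bigr => l _.
have -> : \sum_(a < l.+1) G' a l = \sum_(a < l.+1) G a l.
  rewrite (reindex_inj rev_ord_inj) /=; apply: eq_bigr => a _.
  rewrite /G /G'; congr (Phi _ - _); have := ltn_ord a; lia.
by rewrite -big_split /=; apply: eq_bigr => a _; rewrite mulr2n.
Qed.

End ReversalSums.

(** * Free and killed kernels of two cards *)

Section PairKernels.
Variables (R : realType) (n' L : nat).
Local Notation n := n'.+1.
Hypothesis Ln : (4 * L <= n)%N.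
Hypothesis L6 : (6 <= L)%N.
Local Notation E := ('I_n * 'I_L.+1)%type.
Local Notation pairs := ('I_n * 'I_n)%type.
Implicit Types (e : E) (i j v : 'I_n) (p : pairs) (c : bool) (g h : pairs -> R).

Definition rv2 e p : pairs := (rv e p.1, rv e p.2).

(* Neither end of the reversed interval nor a neighbour outside is at i. *)
Definition clear e i :=
  let a := offset e.1 i in [&& a != 0, a != e.2, a != e.2.+1 & a.+1 != n]%N.

(** For [c = true] the move is killed as soon as one of the two cards is at a possible collision
    site, whatever the coin; for [c = false] it never is. *)
Definition allowed c e p := c ==> clear e p.1 && clear e p.2.

Definition shapes : R := (n * L.+1)%:R.

Definition kernel_op c g p := (\sum_(e | allowed c e p) g (rv2 e p)) / shapes.

Lemma shapes_gt0 : 0 < shapes. Proof. by rewrite ltr0n. Qed.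

Lemma sum_shapes (x : R) : \sum_(e : E) x = shapes * x.
Proof. by rewrite sumr_const card_prod !card_ord -mulr_natl. Qed.

Lemma rv2K e : involutive (rv2 e).
Proof. by case=> i j; rewrite /rv2 /= !(rvK Ln). Qed.

(** The reversal exchanges the offsets 0 and l and fixes l + 1 and n - 1. This invariance of the
    forbidden sites keeps the killed kernel self-adjoint. *)
Lemma clear_rv e i : clear e (rv e i) = clear e i.
Proof.
rewrite /clear offset_rv //; have := offset_lt e.1 i; have := ltn_ord e.2.
by case: ifP; lia.
Qed.

Lemma kernel_op_sym c g h :
  \sum_p h p * kernel_op c g p = \sum_p kernel_op c h p * g p.
Proof.
rewrite (eq_bigr (fun p => (\sum_(e | allowed c e p) h p * g (rv2 e p)) / shapes)); last first.
  by move=> p _; rewrite /kernel_op mulrA -mulr_sumr.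
rewrite [RHS](eq_bigr (fun p => (\sum_(e | allowed c e p) h (rv2 e p) * g p) / shapes)); last first.
  by move=> p _; rewrite /kernel_op mulrAC -mulr_suml.
rewrite -!mulr_suml; congr (_ / _).
rewrite (exchange_big_dep predT) // [RHS](exchange_big_dep predT) //=.
apply: eq_bigr => e _; rewrite [RHS](reindex_inj (inv_inj (rv2K e))) /=.
by apply: eq_big => [p|p _]; rewrite ?rv2K // /allowed /= !clear_rv.
Qed.

Lemma kernel_op_ge0 c g : (forall p, 0 <= g p) -> forall p, 0 <= kernel_op c g p.
Proof. by move=> g0 p; rewrite divr_ge0 ?(ltW shapes_gt0) // sumr_ge0. Qed.

Lemma kernel_op_le c g h p : (forall e, g (rv2 e p) <= h (rv2 e p)) ->
  kernel_op c g p <= kernel_op c h p.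
Proof. by move=> gh; rewrite ler_pM2r ?invr_gt0 ?shapes_gt0 // ler_sum. Qed.

Lemma kernel_op_allowed c c' g p : (c' ==> c) -> (forall p, 0 <= g p) ->
  kernel_op c g p <= kernel_op c' g p.
Proof.
case: c => [|]; case: c' => //= _ g0; rewrite ler_pM2r ?invr_gt0 ?shapes_gt0 //.
rewrite [leRHS](bigID (allowed true ^~ p)) /= lerDl.
by apply: sumr_ge0.
Qed.

Lemma rv2_shift e s p :
  rv2 (e.1 + s, e.2) (p.1 + s, p.2 + s) = ((rv2 e p).1 + s, (rv2 e p).2 + s).
Proof.
have h i : rv (e.1 + s, e.2) (i + s) = rv e i + s.
  rewrite /rv !rev_posE /=.
  rewrite offset_shift.
  by case: ifP => // _; rewrite addrAC.
by rewrite /rv2 /= !h.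
Qed.

Definition shift_invariant g := forall s p, g (p.1 + s, p.2 + s) = g p.

Lemma kernel_op_shift c g : shift_invariant g -> shift_invariant (kernel_op c g).
Proof.
move=> gs s p; rewrite /kernel_op; congr (_ / _).
pose sh e : E := (e.1 + s, e.2).
have shI : injective sh by
    move=> [a b] [a' b'] h; have /= -> := congr1 snd h; have /= /addIr-> := congr1 fst h.
have clear_sh e i : clear (sh e) (i + s) = clear e i.
  by rewrite /clear /= offset_shift.
rewrite (reindex_inj shI) /=; apply: eq_big => [e|e _].
  by rewrite /allowed /= !clear_sh.
by rewrite rv2_shift gs.
Qed.

End PairKernels.

(** * Moments of the displacements *)

Section ArithmeticSums.
Variable R : realType.

Lemma sum_affine (x : R) k : \sum_(a < k) (x - 2 * a%:R) = k%:R * x - k%:R * (k%:R - 1).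
Proof.
elim: k => [|k IH]; first by rewrite big_ord0 !mul0r subrr.
by rewrite big_ord_recr /= IH -natr1; ring.
Qed.

Lemma sum_sqr_affine (x : R) k :
  3 * \sum_(a < k) (x - 2 * a%:R) ^+ 2 =
  3 * k%:R * x ^+ 2 - 6 * x * k%:R * (k%:R - 1) + 2 * k%:R * (k%:R - 1) * (2 * k%:R - 1).
Proof.
elim: k => [|k IH]; first by rewrite big_ord0 !(mul0r, mulr0, subrr, addr0).
by rewrite big_ord_recr /= mulrDr IH -natr1; ring.
Qed.

Lemma sum_sqr_displacement l :
  3 * \sum_(a < l.+1) (l%:R - 2 * a%:R) ^+ 2 = l%:R * (l%:R + 1) * (l%:R + 2) :> R.
Proof. by rewrite sum_sqr_affine -natr1; ring. Qed.

(** Divided by the number n (L + 1) of shapes, this gives a variance of order L^3 / n per step. *)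
Lemma sum_sqr_displacements L :
  12 * \sum_(l < L.+1) \sum_(a < l.+1) (l%:R - 2 * a%:R) ^+ 2 =
  L%:R * (L%:R + 1) * (L%:R + 2) * (L%:R + 3) :> R.
Proof.
elim: L => [|L IH].
  by rewrite !big_ord_recr !big_ord0 /=; ring.
have h := sum_sqr_displacement L.+1.
rewrite big_ord_recr /= mulrDr IH; move: h; set S := \sum_(a < L.+2) _ => h.
have -> : 12 * S = 4 * (3 * S) by ring.
by rewrite h -natr1; ring.
Qed.

Lemma cosh_ge (x : R) : x ^+ 2 / 4 <= expR x + expR (- x) - 2.
Proof.
have pos (y : R) : 0 <= y -> y ^+ 2 / 4 <= expR y + expR (- y) - 2.
  move=> y0; set a := expR (y / 2).
  have a1 : 1 + y / 2 <= a by apply: expR_ge1Dx.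
  have a0 : 0 < a by apply: expR_gt0.
  have -> : expR y = a ^+ 2 by rewrite -expRM_natl; congr expR; lra.
  have -> : expR (- y) = (a^-1) ^+ 2.
    by rewrite -expRN -expRM_natl; congr expR; lra.
  have -> : a ^+ 2 + a^-1 ^+ 2 - 2 = (a - a^-1) ^+ 2 by field; rewrite gt_eqF.
  have ia : a^-1 <= 1 by rewrite invf_le1 //; lra.
  have : y / 2 <= a - a^-1 by lra.
  nra.
have [x0|x0] := leP 0 x; first exact: pos.
have := pos (- x); rewrite opprK sqrrN; lra.
Qed.

Lemma natr_displacement L D l a : (L < D)%N -> (l <= L)%N -> (a <= l)%N ->
  (D + l - 2 * a)%N%:R = D%:R + (l%:R - 2 * a%:R) :> R.
Proof.
move=> LD lL al; have h : (2 * a <= D + l)%N by lia.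
by rewrite natrB // natrD natrM addrA.
Qed.

End ArithmeticSums.

(** * Holding and killing probabilities *)

Section PairKernelEstimates.
Variables (R : realType) (n' L : nat).
Local Notation n := n'.+1.
Hypothesis Ln : (4 * L <= n)%N.
Hypothesis L6 : (6 <= L)%N.
Local Notation E := ('I_n * 'I_L.+1)%type.
Local Notation pairs := ('I_n * 'I_n)%type.
Implicit Types (e : E) (i j v : 'I_n) (p : pairs) (c : bool) (g h : pairs -> R).
Local Notation N := (shapes R n' L).
Local Notation kernel_op := (@kernel_op R n' L).

Lemma shapesE : N = n%:R * (L%:R + 1).
Proof. by rewrite /shapes natrM natr1. Qed.

Lemma count_not_clear i : (\sum_(e : E) ~~ clear e i <= 4 * L.+1)%N.
Proof.
rewrite (sum_offset L (fun a l => nat_of_bool (~~ [&& a != 0, a != l, a != l.+1 & a.+1 != n]%N)) i).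
have -> : (4 * L.+1 = \sum_(l < L.+1) 4)%N by rewrite sum_nat_const card_ord mulnC.
apply: leq_sum => l _.
have one k : (\sum_(a < n) (nat_of_ord a == k) <= 1)%N.
  have := @count_interval n' (pred1 k) k k.+1; rewrite subSnn; apply.
  by move=> a /eqP->; rewrite leqnn ltnSn.
apply: (@leq_trans (\sum_(a < n) ((nat_of_ord a == 0) + (nat_of_ord a == l) +
   (nat_of_ord a == l.+1) + (nat_of_ord a == n')))).
  apply: leq_sum => a _; rewrite eqSS.
  by case: (nat_of_ord a == 0); case: (nat_of_ord a == l); case: (nat_of_ord a == l.+1);
    case: (nat_of_ord a == n').
rewrite !big_split /=; exact: leq_add (leq_add (leq_add (one 0%N) (one l)) (one l.+1)) (one n').
Qed.

Definition remote e i := let a := offset e.1 i in (e.2.+1 < a)%N && (a.+1 != n)%N.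

Lemma count_not_remote i : (\sum_(e : E) ~~ remote e i <= (L + 3) * L.+1)%N.
Proof.
rewrite (sum_offset L (fun a l => nat_of_bool (~~ ((l.+1 < a)%N && (a.+1 != n)%N))) i).
have -> : ((L + 3) * L.+1 = \sum_(l < L.+1) (L + 3))%N by rewrite sum_nat_const card_ord mulnC.
apply: leq_sum => l _.
have h1 : (\sum_(a < n) (nat_of_ord a == n') <= 1)%N.
  have := @count_interval n' (pred1 n') n' n'.+1; rewrite subSnn; apply.
  by move=> a /eqP->; rewrite leqnn ltnSn.
have h2 : (\sum_(a < n) (a <= l.+1) <= l.+2)%N.
  by have := @count_interval n' (fun a => a <= l.+1)%N 0 l.+2; rewrite subn0; apply.
apply: (@leq_trans (\sum_(a < n) ((nat_of_ord a <= l.+1) + (nat_of_ord a == n')))).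
  by apply: leq_sum => a _; rewrite eqSS; case: ltnP; case: (nat_of_ord a == n').
rewrite big_split /=; apply: leq_trans (leq_add h2 h1) _.
by have := ltn_ord l; lia.
Qed.

Lemma remote_fixed e i : remote e i -> rv e i = i.
Proof. by case/andP=> h _; rewrite /rv rev_posE; case: ifP => //; lia. Qed.

Lemma remote_clear e i : remote e i -> clear e i.
Proof. by rewrite /remote /clear => /andP[h ->]; rewrite andbT; lia. Qed.

(** For each length, a card is away from the interval and its neighbours for all but at most L + 3
    of the n starts, and 2 (L + 3) <= 3 L <= 3 n / 4. Holding serves to pass from even to odd times
    in [band_return]. *)
Lemma kernel_op_hold c g p : (forall p, 0 <= g p) -> g p / 4 <= kernel_op c g p.
Proof.
move=> g0; rewrite ler_pdivlMr ?shapes_gt0 //.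
rewrite [leRHS](bigID (fun e => remote e p.1 && remote e p.2)) /=.
apply: ler_wpDr; first by apply: sumr_ge0.
have -> : \sum_(e | allowed c e p && (remote e p.1 && remote e p.2)) g (rv2 e p) =
    \sum_(e | remote e p.1 && remote e p.2) g p.
  apply: eq_big => [e|e /andP[_ /andP[r1 r2]]].
    case r12 : (remote e p.1 && remote e p.2); last by rewrite andbF.
    rewrite andbT; apply/implyP => _.
    by move/andP: r12 => [/remote_clear-> /remote_clear->].
  by rewrite /rv2 !remote_fixed -?surjective_pairing.
rewrite sumr_const -[leRHS]mulr_natl mulrAC -mulrA mulrC ler_wpM2r //.
have h : (n * L.+1 <= #|[pred e | remote e p.1 && remote e p.2]| + 2 * ((L + 3) * L.+1))%N.
  have := count_not_remote p.1; have := count_not_remote p.2.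
  have -> : (n * L.+1 = \sum_(e : E) 1)%N by rewrite sum1_card card_prod !card_ord.
  have -> : #|[pred e | remote e p.1 && remote e p.2]| =
      (\sum_(e : E) (remote e p.1 && remote e p.2))%N.
    by rewrite -sum1_card big_mkcond /=; apply: eq_bigr => e _; rewrite inE; case: ifP.
  move=> h1 h2; apply: (@leq_trans (\sum_(e : E) ((remote e p.1 && remote e p.2) +
     (~~ remote e p.1 + ~~ remote e p.2)))).
    by apply: leq_sum => e _; do 2 case: (remote _ _).
  by rewrite !big_split /= leq_add2l mul2n -addnn leq_add.
have h' : (n * L.+1 <= 4 * #|[pred e | remote e p.1 && remote e p.2]|)%N by nia.
rewrite /shapes; move: h'; rewrite -(ler_nat R) natrM; lra.
Qed.

Lemma kernel_op_mass p : 1 - 8 / n%:R <= kernel_op true (fun=> 1) p :> R.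
Proof.
rewrite ler_pdivlMr ?shapes_gt0 // sumr_const.
have h : (n * L.+1 <= #|[pred e : E | allowed true e p]| + 8 * L.+1)%N.
  have := count_not_clear p.1; have := count_not_clear p.2.
  have -> : (n * L.+1 = \sum_(e : E) 1)%N by rewrite sum1_card card_prod !card_ord.
  have -> : #|[pred e : E | allowed true e p]| = (\sum_(e : E) allowed true e p)%N.
    by rewrite -sum1_card big_mkcond /=; apply: eq_bigr => e _; rewrite inE; case: ifP.
  move=> h1 h2; apply: (@leq_trans (\sum_(e : E) (allowed true e p +
     (~~ clear e p.1 + ~~ clear e p.2)))).
    by apply: leq_sum => e _; rewrite /allowed /=; do 2 case: (clear _ _).
  rewrite !big_split /= leq_add2l (_ : 8 * L.+1 = 4 * L.+1 + 4 * L.+1)%N; last by lia.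
  exact: leq_add.
move: h; rewrite -(ler_nat R) natrD !natrM => h.
have n0 : 0 < n%:R :> R by rewrite ltr0n.
rewrite /shapes natrM mulrBl mul1r.
have -> : 8 / n%:R * (n%:R * L.+1%:R) = 8 * L.+1%:R :> R by rewrite mulrA divfK // gt_eqF.
rewrite lerBlDr; apply: le_trans h _; rewrite lerD2r ler_nat.
by apply/subset_leq_card/subsetP => e.
Qed.

End PairKernelEstimates.

(** * Exponential drift and variance of the distance *)

Section DistanceDrift.
Variables (R : realType) (n' L : nat).
Local Notation n := n'.+1.
Hypothesis Ln : (4 * L <= n)%N.
Hypothesis L6 : (6 <= L)%N.
Local Notation E := ('I_n * 'I_L.+1)%type.
Local Notation pairs := ('I_n * 'I_n)%type.
Implicit Types (e : E) (i j v : 'I_n) (p : pairs).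
Local Notation N := (shapes R n' L).
Local Notation kernel_op := (@kernel_op R n' L).

Definition dist p : R := (cyc_dist p.1 p.2)%:R.

Lemma kernel_op_false g p : kernel_op false g p = (\sum_(e : E) g (rv2 e p)) / N.
Proof. by []. Qed.

Lemma dist_rv2_swap e i j : dist (rv2 e (i, j)) = dist (rv2 e (j, i)).
Proof. by rewrite /dist cyc_distC. Qed.

Lemma kernel_op_dist_swap (Phi : R -> R) i j :
  kernel_op false (Phi \o dist) (i, j) = kernel_op false (Phi \o dist) (j, i).
Proof. by congr (_ / _); apply: eq_bigr => e _ /=; rewrite dist_rv2_swap. Qed.

(** Exchanging a with l - a pairs opposite displacements, so the first order cancels and a
    hyperbolic cosine remains. The constant is 48 = 4 * 12, from [cosh_ge] and
    [sum_sqr_displacements]. *)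
Lemma kernel_op_expR (lam : R) p : 0 <= lam -> (L < cyc_dist p.1 p.2)%N ->
  (1 + lam ^+ 2 * L%:R ^+ 3 / (48 * n%:R)) * expR (- (lam * dist p)) <=
  kernel_op false (fun p => expR (- (lam * dist p))) p.
Proof.
move=> lam0; case: p => i j /=.
wlog Dn : i j / (offset i j <= n - offset i j)%N => [hw|].
  have [h|h] := leqP (offset i j) (n - offset i j); first exact: hw.
  move=> Lr; have := hw j i; rewrite (kernel_op_dist_swap (fun x => expR (- (lam * x)))).
  rewrite /dist /= (cyc_distC j i); apply => //.
  by rewrite (offset_rev i j); have := offset_lt i j; case: eqP; lia.
rewrite kernel_op_false /dist /cyc_dist /= (minn_idPl Dn); set D := offset i j => LD.
have Dn' : (D + L < n)%N by have := offset_lt i j; lia.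
pose Phi (d : nat) : R := expR (- (lam * d%:R)).
rewrite ler_pdivlMr ?shapes_gt0 //.
(* The new distance is at most the offset along the formerly shorter arc, and the exponential is
   decreasing. *)
apply: (@le_trans _ _ (\sum_(e : E) Phi (offset (rv e i) (rv e j)))); last first.
  apply: ler_sum => e _; rewrite ler_expR lerN2 ler_wpM2l // ler_nat; exact: geq_minl.
rewrite sum_far // -/D sum_shapes.
have step (l : 'I_L.+1) : Phi D * (lam ^+ 2 / 4 * \sum_(a < l.+1) (l%:R - 2 * a%:R) ^+ 2) <=
    \sum_(a < l.+1) (Phi (D + l - 2 * a)%N - Phi D) *+ 2.
  have lL : (l <= L)%N by rewrite -ltnS.
  pose m (a : 'I_l.+1) : R := l%:R - 2 * a%:R.
  have e1 (a : 'I_l.+1) : Phi (D + l - 2 * a)%N = Phi D * expR (- (lam * m a)).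
    rewrite /Phi (natr_displacement R LD lL) //; last by rewrite -ltnS.
    by rewrite -expRD; congr expR; rewrite /m; lra.
  have -> : \sum_(a < l.+1) (Phi (D + l - 2 * a)%N - Phi D) *+ 2 =
     \sum_(a < l.+1) Phi D * (expR (- (lam * m a)) + expR (lam * m a) - 2).
    transitivity (\sum_(a < l.+1) Phi D * (expR (- (lam * m a)) - 1) +
       \sum_(a < l.+1) Phi D * (expR (lam * m a) - 1)); last first.
      by rewrite -big_split /=; apply: eq_bigr => a _; ring.
    rewrite [X in _ = _ + X](reindex_inj rev_ord_inj) /= -big_split /=.
    apply: eq_bigr => a _; rewrite e1.
    have -> : lam * m (rev_ord a) = - (lam * m a).
      rewrite /m /= subSS natrB; last by rewrite -ltnS.
      by ring.
    by rewrite mulr2n; ring.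
  rewrite -mulr_sumr ler_pM2l ?expR_gt0 // mulr_sumr; apply: ler_sum => a _.
  have := cosh_ge (lam * m a); rewrite exprMn -/(m a).
  by set x := expR _; set y := expR _; lra.
have s12 := sum_sqr_displacements R L.
set S := \sum_(l < L.+1) _ in s12.
have h : Phi D * (lam ^+ 2 / 4 * S) <=
    \sum_(l < L.+1) \sum_(a < l.+1) (Phi (D + l - 2 * a)%N - Phi D) *+ 2.
  by rewrite !mulr_sumr; apply: ler_sum => l _; apply: step.
rewrite -/(Phi D); apply: le_trans (lerD (lexx _) h).
set X := 1 + _; suff h2 : N * X <= N + lam ^+ 2 / 4 * S.
  by have := ler_wpM2r (expR_ge0 (- (lam * D%:R))) h2; rewrite -/(Phi D); lra.
rewrite /X {X}.
rewrite shapesE; have n0 : 0 < n%:R :> R by rewrite ltr0n.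
have -> : n%:R * (L%:R + 1) * (1 + lam ^+ 2 * L%:R ^+ 3 / (48 * n%:R)) =
   n%:R * (L%:R + 1) + lam ^+ 2 * (L%:R ^+ 3 * (L%:R + 1)) / 48 :> R.
  by move: (n%:R : R) n0 => x x0; field; rewrite gt_eqF.
rewrite lerD2l.
have L0 : 0 <= L%:R :> R by rewrite ler0n.
have hS : L%:R ^+ 3 * (L%:R + 1) <= 12 * S.
  by rewrite s12; have := mulr_ge0 L0 L0; nra.
have := ler_wpM2l (sqr_ge0 lam) hS; lra.
Qed.

End DistanceDrift.

Section DistanceVariance.
Variables (R : realType) (n' L : nat).
Local Notation n := n'.+1.
Hypothesis Ln : (4 * L <= n)%N.
Hypothesis L6 : (6 <= L)%N.
Local Notation E := ('I_n * 'I_L.+1)%type.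
Local Notation pairs := ('I_n * 'I_n)%type.
Implicit Types (e : E) (i j v : 'I_n) (p : pairs).
Local Notation N := (shapes R n' L).
Local Notation kernel_op := (@kernel_op R n' L).
Local Notation dist := (@dist R n').

Lemma cyc_dist_rv2 e i j :
  (cyc_dist (rv e i) (rv e j) ^ 2 <= cyc_dist i j ^ 2 +
    ((offset e.1 i <= e.2) + (offset e.1 j <= e.2)) * (2 * cyc_dist i j * L + L ^ 2))%N.
Proof.
have lL : (e.2 <= L)%N by rewrite -ltnS.
have lti := offset_lt e.1 i; have ltj := offset_lt e.1 j; have := offset_trans i e.1 j.
rewrite modn_if ?offset_lt // (offset_rev e.1 i) => D.
have [ci|ci] := leqP (offset e.1 i) e.2; have [cj|cj] := leqP (offset e.1 j) e.2.
- have -> : cyc_dist (rv e i) (rv e j) = cyc_dist i j.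
    by rewrite {1}/cyc_dist /rv offset_rev_pos_both -/(cyc_dist j i) 1?cyc_distC //; lia.
  exact: leq_addr.
- suff h : (cyc_dist (rv e i) (rv e j) <= cyc_dist i j + L)%N.
    by rewrite -!mulnn; have := leq_mul h h; lia.
  rewrite /cyc_dist /rv !rev_posE ci (leqNgt (offset e.1 j)) cj /=.
  have h : offset (e.1 + inZp (e.2 - offset e.1 i)) e.1 =
      (if offset e.1 i == e.2 :> nat then 0 else n - (e.2 - offset e.1 i))%N.
    rewrite offset_rev offset_self; last by lia.
    by case: eqP => ?; case: eqP => ?; lia.
  rewrite (offset_trans _ e.1 j) h modn_if ?offset_lt //; last by case: eqP; lia.
  by move: D; case: eqP => ?; case: eqP => ?; repeat case: ifP; lia.
- suff h : (cyc_dist (rv e i) (rv e j) <= cyc_dist i j + L)%N.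
    by rewrite -!mulnn; have := leq_mul h h; lia.
  rewrite /cyc_dist /rv !rev_posE cj (leqNgt (offset e.1 i)) ci /=.
  rewrite offset_addr (offset_rev e.1 i) modn_if; first last.
  - by lia.
  - by case: eqP; lia.
  by move: D; case: eqP => ?; repeat case: ifP; lia.
- by rewrite /rv !rev_posE (leqNgt (offset e.1 i)) (leqNgt (offset e.1 j)) ci cj leq_addr.
Qed.

(** For cards farther than L the linear term cancels by symmetry and the second moment of the
    displacements remains. For closer cards [sum_far] does not apply, but the square then grows by
    at most 3 L^2 per covered card, which has the same order. *)
Lemma kernel_op_dist_sqr p :
  kernel_op false (fun p => dist p ^+ 2) p <=
  dist p ^+ 2 + 6 * L%:R ^+ 2 * (L%:R + 1) / n%:R.
Proof.
case: p => i j; have n0 : 0 < n%:R :> R by rewrite ltr0n.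
have L0 : 0 <= L%:R :> R by rewrite ler0n.
rewrite kernel_op_false ler_pdivrMr ?shapes_gt0 // mulrDl.
have -> : 6 * L%:R ^+ 2 * (L%:R + 1) / n%:R * N = 6 * L%:R ^+ 2 * (L%:R + 1) ^+ 2.
  by rewrite shapesE; move: (n%:R : R) n0 => x x0; field; rewrite gt_eqF.
have cov x : \sum_(e : E) (offset e.1 x <= e.2)%N%:R <= (L%:R + 1) ^+ 2 :> R.
  rewrite (eq_bigr (fun e : E => if (offset e.1 x <= e.2)%N then 1 else 0)); last first.
    by move=> e _; case: leqP.
  rewrite (sum_covered Ln L6 (fun _ _ => 1)) expr2 natr1 -natrM.
  rewrite (eq_bigr (fun l : 'I_L.+1 => l.+1%:R)); last first.
    by move=> l _; rewrite sumr_const card_ord.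
  rewrite -natr_sum ler_nat -[X in (X * _)%N]card_ord -sum_nat_const.
  by apply: leq_sum => l _; apply: ltn_ord.
have [near|far] := leqP (cyc_dist i j) L.
  have pw (e : E) : dist (rv2 e (i, j)) ^+ 2 <= dist (i, j) ^+ 2 +
      3 * L%:R ^+ 2 * ((offset e.1 i <= e.2)%N%:R + (offset e.1 j <= e.2)%N%:R).
    have h : (cyc_dist (rv e i) (rv e j) ^ 2 <= cyc_dist i j ^ 2 +
        3 * L ^ 2 * ((offset e.1 i <= e.2) + (offset e.1 j <= e.2)))%N.
      apply: leq_trans (cyc_dist_rv2 e i j) _; rewrite leq_add2l mulnC leq_mul2r.
      by apply/orP; right; rewrite -!mulnn; have := leq_mul near (leqnn L); lia.
    by rewrite /dist -!natrX -natrD -!natrM -natrD ler_nat.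
  apply: le_trans (ler_sum _ (fun e _ => pw e)) _.
  rewrite big_split /= sum_shapes mulrC lerD2l -mulr_sumr big_split /=.
  have := lerD (cov i) (cov j); set u := _ + _ => hu.
  have : 0 <= L%:R ^+ 2 :> R by apply: sqr_ge0.
  by move=> h; have := ler_wpM2l h hu; lra.
wlog Dn : i j far / (offset i j <= n - offset i j)%N => [hw|].
  have [h|h] := leqP (offset i j) (n - offset i j); first exact: hw.
  have := hw j i; rewrite cyc_distC => /(_ far).
  rewrite /dist /= (cyc_distC j i).
  rewrite (eq_bigr (fun e : E => (cyc_dist (rv e i) (rv e j))%:R ^+ 2)); last first.
    by move=> e _; rewrite cyc_distC.
  by apply; rewrite (offset_rev i j); have := offset_lt i j; case: eqP; lia.
have eD : cyc_dist i j = offset i j by rewrite /cyc_dist (minn_idPl Dn).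
rewrite {2}/dist eD; rewrite eD in far; set D := offset i j in far *.
have Dn' : (D + L < n)%N by have := offset_lt i j; lia.
pose Phi (d : nat) : R := d%:R ^+ 2.
apply: (@le_trans _ _ (\sum_(e : E) Phi (offset (rv e i) (rv e j)))).
  apply: ler_sum => e _; rewrite /Phi /dist ler_sqr ?nnegrE // ler_nat; exact: geq_minl.
rewrite sum_far // -/D sum_shapes mulrC /Phi lerD2l.
have -> : \sum_(l < L.+1) \sum_(a < l.+1) (Phi (D + l - 2 * a)%N - Phi D) *+ 2 =
   2 * \sum_(l < L.+1) \sum_(a < l.+1) (l%:R - 2 * a%:R) ^+ 2.
  rewrite mulr_sumr; apply: eq_bigr => l _.
  have lL : (l <= L)%N by rewrite -ltnS.
  transitivity (\sum_(a < l.+1) (2 * (l%:R - 2 * a%:R) ^+ 2 + 4 * D%:R * (l%:R - 2 * a%:R)) : R).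
    apply: eq_bigr => a _; rewrite /Phi (natr_displacement R far lL) //; last by rewrite -ltnS.
    by rewrite mulr2n; ring.
  rewrite big_split /= -!mulr_sumr sum_affine -[l.+1%:R]natr1.
  by rewrite addrK subrr mulr0 addr0.
have := sum_sqr_displacements R L; set S := \sum_(l < L.+1) _ => hS.
have : 12 * S <= 12 * (L%:R ^+ 2 * (L%:R + 1) ^+ 2).
  rewrite hS; have L1 : 1 <= L%:R :> R by rewrite ler1n; lia.
  have : 0 <= L%:R * (L%:R + 1) :> R by rewrite mulr_ge0 //; lra.
  by nra.
have : 0 <= L%:R ^+ 2 * (L%:R + 1) ^+ 2 :> R by rewrite mulr_ge0 // sqr_ge0.
lra.
Qed.

End DistanceVariance.

(** * A minimum principle for cards within distance L *)

Section NearbyCards.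
Variables (R : realType) (n' L : nat).
Local Notation n := n'.+1.
Hypothesis Ln : (4 * L <= n)%N.
Hypothesis L64 : (64 <= L)%N.
Local Notation E := ('I_n * 'I_L.+1)%type.
Local Notation pairs := ('I_n * 'I_n)%type.
Implicit Types (e : E) (i j v : 'I_n) (p : pairs) (c : bool) (W : pairs -> R).
Local Notation N := (shapes R n' L).
Local Notation kernel_op := (@kernel_op R n' L).

Let L6 : (6 <= L)%N. Proof. by lia. Qed.

Definition symmetric_fun W := forall i j, W (i, j) = W (j, i).

Lemma kernel_op_symmetric c W : symmetric_fun W -> symmetric_fun (kernel_op c W).
Proof.
move=> Ws i j; rewrite /kernel_op; congr (_ / _); apply: eq_big => [e|e _]; last exact: Ws.
by rewrite /allowed /= andbC.
Qed.

(** The band consists of offsets from about L / 2 to 3 L / 4. From any offset in [1, L], each of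
    them is reached, by moving the second card only, from at least a sixteenth of the interval
    starts that allow such a move. *)
Definition band_lo := (L.+1 %/ 2)%N.
Definition band_hi := ((3 * L) %/ 4).+1.
Definition band_sum W i : R := \sum_(band_lo <= d < band_hi) W (i, i + inZp d).

Lemma sum_shape_nat (F : 'I_n -> 'I_L.+1 -> R) i :
  \sum_(e : E) F e.1 e.2 =
  \sum_(0 <= x < n) \sum_(0 <= l < L.+1) F (i + inZp x) (inord l).
Proof.
rewrite (sum_shape _ i) exchange_big /= big_mkord; apply: eq_bigr => x _.
by rewrite big_mkord valZpK; apply: eq_bigr => l _; rewrite inord_val.
Qed.

Lemma sum_nat_sub (F : nat -> R) a b m : (b <= m)%N -> (forall k, 0 <= F k) ->
  \sum_(a <= k < b) F k <= \sum_(0 <= k < m) F k.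
Proof.
move=> bm F0; have [ba|ab] := leqP b a.
  by rewrite big_geq // sumr_ge0.
rewrite [leRHS](big_cat_nat (n := b)) //=.
rewrite [X in _ <= X + _](big_cat_nat (n := a)) //=; last exact: ltnW.
by rewrite -addrA addrCA lerDl addr_ge0 ?sumr_ge0.
Qed.

Let right_only e p := (offset e.1 p.2 <= e.2)%N && (e.2 < offset e.1 p.1)%N.
Let left_only e p := (offset e.1 p.1 <= e.2)%N && (e.2 < offset e.1 p.2)%N.

Lemma offset_left i j x : (x < n)%N -> offset i j = ((x + offset (i + inZp x)%R j) %% n)%N /\
  offset (i + inZp x) i = (if x == 0 then 0 else n - x)%N.
Proof.
move=> xn; split; last by rewrite offset_rev offset_self.
by rewrite (offset_trans i (i + inZp x)) offset_self.
Qed.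

(** The interval must start after i and not after j, which leaves d = [offset i j] starts, and
    killing removes one at each end. The same factor d - 2 c multiplies the gain in
    [sum_right_only_ge_all], so gain and loss compare even for adjacent cards, which are rarely
    separated. *)
Lemma count_right_only c i j : (offset i j <= L)%N ->
  \sum_(e : E) (allowed c e (i, j) && right_only e (i, j))%:R <=
  (offset i j - 2 * c)%N%:R * (L%:R + 1) :> R.
Proof.
set d := offset i j => dL.
rewrite (sum_shape_nat (fun v l => (allowed c (v, l) (i, j) && right_only (v, l) (i, j))%:R) i).
rewrite exchange_big /= big_mkord natr1.
have -> : (d - 2 * c)%N%:R * L.+1%:R = \sum_(l < L.+1) (d - 2 * c)%N%:R :> R.
  by rewrite sumr_const card_ord mulr_natr.
apply: ler_sum => l _; rewrite inord_val big_mkord -natr_sum ler_nat.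
pose Q x := (1 + c <= x < 1 + c + (d - 2 * c))%N.
apply: (@leq_trans (\sum_(x < n) Q x)); last first.
  have := @count_interval n' Q (1 + c) (1 + c + (d - 2 * c)); rewrite addKn; apply.
  by [].
apply: leq_sum => x _; case: (boolP (_ && _)) => // /andP[al ro]; rewrite lt0b /Q.
move: al ro; have [] := offset_left i j (ltn_ord x); rewrite modn_if ?offset_lt //.
rewrite /right_only /allowed /clear /= -/d => -> ->.
have := offset_lt (i + inZp x) j; have := ltn_ord l; have := ltn_ord x.
set b := offset _ j => xn ll bn.
clear Q; by case: c; repeat case: ifP; lia.
Qed.

Lemma count_left_only c i j : (offset i j <= L)%N ->
  \sum_(e : E) (allowed c e (i, j) && left_only e (i, j))%:R <=
  (offset i j - 2 * c)%N%:R * (L%:R + 1) :> R.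
Proof.
set d := offset i j => dL.
pose P l a := ((l + 1 + c - d <= a) && (a + c < l.+1))%N.
apply: (@le_trans _ _ (\sum_(e : E) (P e.2 (offset e.1 i))%:R)).
  apply: ler_sum => e _; rewrite ler_nat.
  case: (boolP (_ && _)) => // /andP[al lo]; rewrite lt0b /P.
  move: al lo; rewrite /left_only /allowed /clear /=.
  rewrite (offset_trans e.1 i j) -/d modn_if ?offset_lt // -?/d.
  have := offset_lt e.1 i; have := ltn_ord e.2; set a := offset _ i.
  have := offset_lt i j; rewrite -/d => dn lL an.
  clear P; by case: c; repeat case: ifP; lia.
rewrite (sum_offset L (fun a l => (P l a)%:R)) natr1.
have -> : (d - 2 * c)%N%:R * L.+1%:R = \sum_(l < L.+1) (d - 2 * c)%N%:R :> R.
  by rewrite sumr_const card_ord mulr_natr.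
apply: ler_sum => l _; rewrite -natr_sum ler_nat.
have := @count_interval n' (P l) (l + 1 + c - d) (l.+1 - c).
move/(_ _)/leq_trans; apply; last by lia.
by move=> a; rewrite /P; lia.
Qed.

Lemma sum_nat_shift (F : nat -> R) a b d t : (t <= a + d)%N ->
  \sum_(a <= k < b) F (k + d - t)%N = \sum_(a + d - t <= k < b + d - t) F k.
Proof.
move=> tad; rewrite -{1}[a]add0n -{1}[(a + d - t)%N]add0n !big_addn.
have [ba|ab] := leqP b a; first by rewrite !big_geq //; lia.
have -> : (b + d - t - (a + d - t) = b - a)%N by lia.
by apply: eq_bigr => k _; congr F; lia.
Qed.

Let shape i x l : E := (i + inZp x, inord l).

(** For an interval starting at i + x, the length d' + d - 2 x fixes i and brings j to offset d'
    from i; the conditions on x make these lengths admissible over the whole band. *)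
Lemma sum_right_only_ge c W i j x : (forall p, 0 <= W p) -> (offset i j <= L)%N ->
  (1 + c <= x)%N -> (x + c <= offset i j)%N -> (x < band_lo)%N ->
  (4 * offset i j <= 8 * x + L)%N ->
  band_sum W i <= \sum_(0 <= l < L.+1)
    (if allowed c (shape i x l) (i, j) && right_only (shape i x l) (i, j)
     then W (rv2 (shape i x l) (i, j)) else 0).
Proof.
move=> W0; set d := offset i j => dL xc xd xlo dx.
have [lo2 hi4] : (L <= 2 * band_lo /\ 4 * band_hi <= 3 * L + 4)%N.
  by rewrite /band_lo /band_hi; lia.
pose F (l : nat) : R := if allowed c (shape i x l) (i, j) && right_only (shape i x l) (i, j)
  then W (rv2 (shape i x l) (i, j)) else 0.
have F0 l : 0 <= F l by rewrite /F; case: ifP.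
have le : (band_hi + d - 2 * x <= L.+1)%N by lia.
apply: le_trans (sum_nat_sub (band_lo + d - 2 * x) le F0).
rewrite -sum_nat_shift; last by lia.
rewrite /band_sum big_nat_cond [leRHS]big_nat_cond.
apply: ler_sum => d' /andP[/andP[lo hi] _].
have xn : (x < n)%N by lia.
have lE : nat_of_ord (inord (d' + d - 2 * x) : 'I_L.+1) = (d' + d - 2 * x)%N.
  by rewrite inordK //; lia.
have [dE iE] := offset_left i j xn.
have jE : offset (i + inZp x) j = (d - x)%N.
  move: dE; rewrite modn_if ?offset_lt // -/d.
  by have := offset_lt (i + inZp x) j; case: ifP; lia.
have ro : right_only (shape i x (d' + d - 2 * x)) (i, j).
  by rewrite /right_only /= lE jE iE; case: eqP; lia.
have al : allowed c (shape i x (d' + d - 2 * x)) (i, j).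
  rewrite /allowed /clear /= lE jE iE; move: xc xd; clear F F0 ro dE; case: (c) => //=.
  rewrite !addn1 => xc xd; rewrite ifN_eq; last by lia.
  by apply/andP; split; apply/and4P; split; lia.
rewrite /F al ro /= /rv2 /rv /= !rev_posE.
case/andP: (ro) => /= r1 r2; rewrite r1 leqNgt r2 /= lE jE.
suff -> : i + inZp x + inZp (d' + d - 2 * x - (d - x)) = i + inZp d' :> 'I_n by [].
rewrite -addrA; congr (_ + _); apply: val_inj => /=; rewrite modnDm; congr (_ %% _)%N; lia.
Qed.

Lemma sum_right_only_ge_all c W i j : (forall p, 0 <= W p) -> (0 < offset i j <= L)%N ->
  shift_invariant W ->
  (offset i j - 2 * c)%N%:R * band_sum W i <= 16 *
  \sum_(e : E | allowed c e (i, j) && right_only e (i, j)) W (rv2 e (i, j)).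
Proof.
move=> W0; set d := offset i j => /andP[d0 dL] Ws.
set b := (d - 2 * c)%N.
pose m := ((b + 15) %/ 16)%N.
(* The least start with 1 + c <= x and 4 d <= 8 x + L; the m starts from there also meet the upper
   bounds on x. *)
pose x0 := (if 4 * d <= L + 8 * (1 + c) then 1 + c else (4 * d - L + 7) %/ 8)%N.
have S0 : 0 <= band_sum W i by apply: sumr_ge0.
rewrite big_mkcond /=.
rewrite (sum_shape_nat (fun v l => if allowed c (v, l) (i, j) && right_only (v, l) (i, j)
  then W (rv2 (v, l) (i, j)) else 0) i) /=.
have x0mn : (x0 + m <= n)%N.
  by rewrite /x0 /m /b; move: dL Ln L64; clear; case: c; case: ifP; lia.
have F0 (x : nat) : 0 <= \sum_(0 <= l < L.+1)
    (if allowed c (shape i x l) (i, j) && right_only (shape i x l) (i, j)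
     then W (rv2 (shape i x l) (i, j)) else 0).
  by apply: sumr_ge0 => l _; case: ifP.
have lo2 : (L <= 2 * band_lo)%N by rewrite /band_lo; lia.
have h : m%:R * band_sum W i <= \sum_(x0 <= x < x0 + m) band_sum W i.
  by rewrite sumr_const_nat addKn mulr_natl.
have h1 : \sum_(x0 <= x < x0 + m) band_sum W i <= \sum_(x0 <= x < x0 + m)
  \sum_(0 <= l < L.+1)
    (if allowed c (shape i x l) (i, j) && right_only (shape i x l) (i, j)
     then W (rv2 (shape i x l) (i, j)) else 0).
  rewrite big_nat_cond [leRHS]big_nat_cond; apply: ler_sum => x /andP[/andP[lo hi] _].
  apply: sum_right_only_ge => //; move: lo hi; rewrite /x0 /m /b -/d;
    move: d0 dL lo2 L64; clear; case: c; case: ifP; lia.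
have h2 := sum_nat_sub x0 x0mn F0.
have bm : b%:R <= 16 * m%:R :> R by rewrite -natrM ler_nat /m; lia.
apply: le_trans (ler_wpM2r S0 bm) _; rewrite -mulrA ler_pM2l //.
exact: le_trans (le_trans h h1) h2.
Qed.

(** Only moves of exactly one card can bring a pair out of the region where W >= x. There are at
    most 2 (d - 2 c) (L + 1) of them, and the loss is made up by the moves into the band, worth at
    least (d - 2 c) / 16 times [band_sum]: hence 32 = 2 * 16. *)
Lemma kernel_op_near_aux c W (x : R) i j : (forall p, 0 <= W p) -> shift_invariant W ->
  0 <= x -> (0 < offset i j <= L)%N ->
  (forall p, (0 < cyc_dist p.1 p.2 <= L)%N -> x <= W p) ->
  32 * (L%:R + 1) * x <= band_sum W i ->
  x * \sum_(e : E) (allowed c e (i, j))%:R <= \sum_(e : E | allowed c e (i, j)) W (rv2 e (i, j)).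
Proof.
move=> W0 Ws x0 dij Wx bS; have /andP[d0 dL] := dij.
set S1 := \sum_(e : E) _.
have same (e : E) : ~~ right_only e (i, j) -> ~~ left_only e (i, j) -> x <= W (rv2 e (i, j)).
  rewrite /right_only /left_only /= !negb_and -!leqNgt => h1 h2; apply: Wx.
  suff -> : cyc_dist (rv e i) (rv e j) = cyc_dist i j by rewrite /cyc_dist; lia.
  have [ci|ci] := leqP (offset e.1 i) e.2; have [cj|cj] := leqP (offset e.1 j) e.2.
  - rewrite {1}/cyc_dist /rv offset_rev_pos_both -/(cyc_dist j i) 1?cyc_distC //.
    by have := ltn_ord e.2; lia.
  - by move: h2; rewrite ci (leqNgt (offset e.1 j)) cj.
  - by move: h1; rewrite cj (leqNgt (offset e.1 i)) ci.
  - by rewrite /rv !rev_posE (leqNgt (offset e.1 i)) (leqNgt (offset e.1 j)) ci cj.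
have base := sum_right_only_ge_all c W0 dij Ws.
have c1 := count_right_only c dL; have c2 := count_left_only c dL.
set b := (offset i j - 2 * c)%N%:R in base c1 c2.
set SR := \sum_(e : E) _ in c1; set SL := \sum_(e : E) _ in c2.
set WR := \sum_(e : E | _ && _) _ in base.
have b0 : 0 <= b :> R by rewrite ler0n.
have split1 : x * (S1 - SR - SL) <=
    \sum_(e : E | allowed c e (i, j) && ~~ right_only e (i, j)) W (rv2 e (i, j)).
  rewrite /S1 /SR /SL -!sumrB mulr_sumr [leRHS]big_mkcond /=; apply: ler_sum => e _.
  have := same e; case: (allowed c e _) => /=; last by rewrite !subr0 mulr0.
  case: (right_only e _) => /=; case: (left_only e _) => /= sm.
  - by rewrite subrr sub0r mulrN1 oppr_le0.
  - by rewrite subrr subr0 mulr0.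
  - by rewrite subr0 subrr mulr0.
  - by rewrite !subr0 mulr1; apply: sm.
rewrite (bigID (fun e => right_only e (i, j))) /= -/WR.
have h1 : x * (SR + SL) <= x * (b * (L%:R + 1) + b * (L%:R + 1)).
  by apply: ler_wpM2l => //; apply: lerD.
have h2 := ler_wpM2l b0 bS.
move: split1; set Y := \sum_(e | _ && ~~ _) _ => split1; lra.
Qed.

Lemma kernel_op_near c W (x : R) p : (forall p, 0 <= W p) -> shift_invariant W ->
  symmetric_fun W -> 0 <= x -> (0 < cyc_dist p.1 p.2 <= L)%N ->
  (forall p, (0 < cyc_dist p.1 p.2 <= L)%N -> x <= W p) ->
  (forall i, 32 * (L%:R + 1) * x <= band_sum W i) ->
  x * kernel_op c (fun=> 1) p <= kernel_op c W p.
Proof.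
case: p => i j W0 Ws Wsym x0 /=.
wlog Dn : i j / (offset i j <= n - offset i j)%N => [hw|] dij Wx bS.
  have [h|h] := leqP (offset i j) (n - offset i j); first exact: hw.
  rewrite (kernel_op_symmetric c Wsym).
  rewrite (kernel_op_symmetric c (W := fun=> 1)) //.
  apply: hw => //; last by rewrite cyc_distC.
  by rewrite (offset_rev i j); have := offset_lt i j; case: eqP; lia.
rewrite /kernel_op mulrA ler_pM2r ?invr_gt0 ?shapes_gt0 //.
rewrite big_mkcond (eq_bigr (fun e : E => (allowed c e (i, j))%:R)); last first.
  by move=> e _; case: ifP.
by apply: kernel_op_near_aux => //; move: dij; rewrite /cyc_dist (minn_idPl Dn).
Qed.

End NearbyCards.

Lemma band_bounds L : (64 <= L)%N ->
  (L <= 2 * band_lo L)%N /\ (4 * band_hi L <= 3 * L + 4)%N /\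
  (L <= 8 * (band_hi L - band_lo L))%N.
Proof. by rewrite /band_lo /band_hi; lia. Qed.

(** * Mass and spread of the two-card evolution *)

Section TwoCardEvolution.
Variables (R : realType) (n' L : nat).
Local Notation n := n'.+1.
Hypothesis Ln : (4 * L <= n)%N.
Hypothesis L64 : (64 <= L)%N.
Local Notation pairs := ('I_n * 'I_n)%type.
Implicit Types (i j v : 'I_n) (p : pairs) (c : bool) (g : pairs -> R).
Local Notation kernel_op := (@kernel_op R n' L).
Local Notation dist := (@dist R n').
Local Notation band_sum := (@band_sum R n' L).
Local Notation band_lo := (band_lo L).
Local Notation band_hi := (band_hi L).

Let L6 : (6 <= L)%N. Proof. by lia. Qed.
Let n0 : 0 < n%:R :> R. Proof. by rewrite ltr0n. Qed.
Let L0 : 0 < L%:R :> R. Proof. by rewrite ltr0n; lia. Qed.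

(** The kernels applied first to g are the killed ones. Seen from the starting pair, the free steps
    therefore come first in time and the killed window last. *)
Fixpoint evol w u g : pairs -> R :=
  if u is u'.+1 then kernel_op (u' < w)%N (evol w u' g) else g.

Lemma evol_ge0 w u g : (forall p, 0 <= g p) -> forall p, 0 <= evol w u g p.
Proof. by move=> g0; elim: u => //= u IH; apply: kernel_op_ge0. Qed.

Lemma evol_le w u g h : (forall p, g p <= h p) -> forall p, evol w u g p <= evol w u h p.
Proof. by move=> gh; elim: u => //= u IH p; apply: kernel_op_le. Qed.

Lemma evol_shift w u g : shift_invariant g -> shift_invariant (evol w u g).
Proof. by move=> gs; elim: u => //= u IH; apply: kernel_op_shift. Qed.

Lemma evol_symmetric w u g : symmetric_fun g -> symmetric_fun (evol w u g).
Proof. by move=> gs; elim: u => //= u IH; apply: kernel_op_symmetric. Qed.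

Definition band_ind p : R := (band_lo <= offset p.1 p.2 < band_hi)%N%:R.
Definition near_ind p : R := (0 < cyc_dist p.1 p.2 <= L)%N%:R.
Definition band_size : R := (band_hi - band_lo)%N%:R.

Lemma band_ind_shift : shift_invariant band_ind.
Proof. by move=> s p; rewrite /band_ind /= offset_shift. Qed.

Lemma near_ind_shift : shift_invariant near_ind.
Proof. by move=> s p; rewrite /near_ind /cyc_dist /= offset_shift. Qed.

Lemma near_ind_symmetric : symmetric_fun near_ind.
Proof. by move=> i j; rewrite /near_ind /= cyc_distC. Qed.

Lemma band_ind_le_near p : band_ind p <= near_ind p.
Proof.
rewrite ler_nat; case: (boolP (_ <= _ < _)%N) => // h.
have [? [? ?]] := band_bounds L64; suff -> : (0 < cyc_dist p.1 p.2 <= L)%N by [].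
by move: h; rewrite /cyc_dist; have := offset_lt p.1 p.2; lia.
Qed.

Lemma sum_pairs_offset g : shift_invariant g ->
  forall i, \sum_p band_ind p * g p = n%:R * band_sum g i.
Proof.
move=> gs i.
rewrite (eq_bigr (fun p => band_ind (p.1, p.2) * g (p.1, p.2))); last by case.
rewrite -(pair_bigA _ (fun i j => band_ind (i, j) * g (i, j))) /=.
have -> : n%:R * band_sum g i = \sum_(j < n) band_sum g i.
  by rewrite sumr_const card_ord mulr_natl.
apply: eq_bigr => j _.
rewrite (reindex_inj (addrI j)) /= /band_sum.
have [? [? ?]] := band_bounds L64.
have hn : (band_hi <= n)%N by lia.
rewrite (big_nat_widen _ _ n) // [RHS]big_geq_mkord [RHS]big_mkcond /=.
apply: eq_bigr => k _.
  have ok : offset j (j + k) = k by rewrite -{1}[k]valZpK (offset_self _ (ltn_ord k)).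
rewrite /band_ind /= ok.
rewrite [in RHS]andbC; case: (_ <= _ < _)%N; last by rewrite mul0r.
rewrite mul1r -(gs (j - i) (i, i + inZp k)) /=; congr g; congr (_, _).
  by rewrite addrC subrK.
by rewrite addrAC addrC valZpK [X in _ = _ + X](addrC i) subrK addrC.
Qed.

Lemma sum_evol_swap w a b : (a <= b)%N ->
  \sum_p evol w a.+1 band_ind p * evol w b band_ind p <=
  \sum_p evol w a band_ind p * evol w b.+1 band_ind p.
Proof.
move=> ab; have b0 p : 0 <= band_ind p by rewrite ler0n.
rewrite (eq_bigr (fun p =>
      evol w b band_ind p * kernel_op (a < w)%N (evol w a band_ind) p)); last first.
  by move=> p _; rewrite mulrC.
rewrite kernel_op_sym //; apply: ler_sum => p _; rewrite mulrC ler_wpM2l ?evol_ge0 //.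
apply: kernel_op_allowed; last exact: evol_ge0.
by apply/implyP; apply: leq_ltn_trans.
Qed.

(* Symmetry of the kernels, together with the fact that the killed kernel is
   smaller and comes first. *)
Lemma sum_evol_sqr_le w h :
  \sum_p evol w h band_ind p ^+ 2 <= \sum_p band_ind p * evol w (2 * h) band_ind p.
Proof.
suff hk k : (k <= h)%N -> \sum_p evol w h band_ind p ^+ 2 <=
    \sum_p evol w (h - k) band_ind p * evol w (h + k) band_ind p.
  by apply: le_trans (hk h (leqnn h)) _; rewrite subnn addnn -mul2n.
elim: k => [|k IH] kh; first by rewrite subn0 addn0; apply: ler_sum => p _; rewrite expr2.
apply: le_trans (IH (ltnW kh)) _.
have -> : (h - k = (h - k.+1).+1)%N by lia.
by rewrite addnS; apply: sum_evol_swap; lia.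
Qed.

Let m0 : R := \sum_p band_ind p.

Lemma kernel_op1_le c p : kernel_op c (fun=> 1) p <= 1.
Proof.
apply: (@le_trans _ _ (kernel_op false (fun=> 1) p)).
  by apply: kernel_op_allowed; rewrite ?implyFb.
by rewrite /kernel_op /= sum_shapes mulr1 divff // gt_eqF ?shapes_gt0.
Qed.

Lemma kernel_op_false1 p : kernel_op false (fun=> 1) p = 1.
Proof. by rewrite /kernel_op /= sum_shapes mulr1 divff // gt_eqF ?shapes_gt0. Qed.

Lemma sum_kernel_op c g : \sum_p kernel_op c g p = \sum_p kernel_op c (fun=> 1) p * g p.
Proof. by rewrite -kernel_op_sym //; apply: eq_bigr => p _; rewrite mul1r. Qed.

(** By symmetry of the kernels, [evol w u band_ind] is also, up to normalization, the law at time u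
    of a pair started uniformly in the band and killed during the first w steps. Its mass and its
    spread are bounded in this reading. *)
Lemma sum_evol_le w u : \sum_p evol w u band_ind p <= m0.
Proof.
have b0 p : 0 <= band_ind p by rewrite ler0n.
elim: u => //= u IH; rewrite sum_kernel_op; apply: le_trans IH; apply: ler_sum => p _.
by rewrite ler_piMl ?kernel_op1_le ?evol_ge0.
Qed.

Lemma sum_evol_ge w u :
  (1 - 8 * (minn u w)%:R / n%:R) * m0 <= \sum_p evol w u band_ind p.
Proof.
have b0 p : 0 <= band_ind p by rewrite ler0n.
elim: u => [|u IH]; first by rewrite min0n mulr0 mul0r subr0 mul1r.
rewrite /= sum_kernel_op.
have h1 := sum_evol_le w u; have m00 : 0 <= m0 by apply: sumr_ge0.
have [uw|wu] := ltnP u w; last first.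
  have -> : minn u.+1 w = minn u w by lia.
  by apply: le_trans IH _; apply: ler_sum => p _; rewrite kernel_op_false1 mul1r.
apply: (@le_trans _ _ (\sum_p (1 - 8 / n%:R) * evol w u band_ind p)); last first.
  by apply: ler_sum => p _; rewrite ler_wpM2r ?evol_ge0 ?kernel_op_mass.
rewrite -mulr_sumr; move: IH.
have -> : minn u.+1 w = (minn u w).+1 by lia.
rewrite -[(minn u w).+1%:R]natr1; set S := \sum_p _ in h1 * => IHu.
have : 8 / n%:R * S <= 8 / n%:R * m0 by rewrite ler_wpM2l // divr_ge0 // ltW.
move: IHu; set a := 8 * (minn u w)%:R / n%:R; set b := 8 / n%:R.
have -> : 8 * ((minn u w)%:R + 1) / n%:R = a + b :> R by rewrite /a /b mulrDr mulr1 mulrDl.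
lra.
Qed.

Definition variance_rate : R := 6 * L%:R ^+ 2 * (L%:R + 1) / n%:R.

Lemma variance_rate_ge0 : 0 <= variance_rate.
Proof.
apply: divr_ge0; last exact: ltW.
by apply: mulr_ge0; [rewrite mulr_ge0 // sqr_ge0 | rewrite addr_ge0 // ltW].
Qed.

Lemma sum_dist_evol w u :
  \sum_p dist p ^+ 2 * evol w u band_ind p <= (L%:R ^+ 2 + u%:R * variance_rate) * m0.
Proof.
have b0 p : 0 <= band_ind p by rewrite ler0n.
have vr := variance_rate_ge0.
elim: u => [|u IH].
  rewrite mul0r addr0 mulr_sumr; apply: ler_sum => p _ /=; rewrite /band_ind.
  case: (boolP (_ <= _ < _)%N) => h; last by rewrite !mulr0.
  rewrite !mulr1 ler_sqr ?nnegrE ?ler0n // ler_nat; move: h.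
  by have [? [? ?]] := band_bounds L64; rewrite /cyc_dist; lia.
rewrite /= kernel_op_sym //.
have h1 := sum_evol_le w u.
apply: (@le_trans _ _ (\sum_p (dist p ^+ 2 + variance_rate) * evol w u band_ind p)).
  apply: ler_sum => p _; rewrite ler_wpM2r ?evol_ge0 //.
  apply: le_trans (kernel_op_dist_sqr R Ln L6 p).
  by apply: kernel_op_allowed => // q; rewrite sqr_ge0.
rewrite (eq_bigr (fun p => dist p ^+ 2 * evol w u band_ind p +
  variance_rate * evol w u band_ind p)); last by move=> p _; rewrite mulrDl.
rewrite big_split /= -mulr_sumr; apply: le_trans (lerD IH (ler_wpM2l vr h1)) _.
by rewrite -[u.+1%:R]natr1; lra.
Qed.

Lemma count_close (R0 : nat) :
  #|[pred p : pairs | (cyc_dist p.1 p.2 <= R0)%N]|%:R <= n%:R * (2 * R0%:R + 1) :> R.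
Proof.
have -> : n%:R * (2 * R0%:R + 1) = (n * (2 * R0 + 1))%:R :> R by rewrite natrM natrD natrM.
rewrite ler_nat -sum1_card big_mkcond /=.
rewrite (eq_bigr (fun p : pairs => (nat_of_bool (cyc_dist p.1 p.2 <= R0)))%N); last first.
  by move=> p _; rewrite inE; case: ifP.
rewrite -(pair_bigA _ (fun i j => nat_of_bool (cyc_dist i j <= R0)%N)) /=.
rewrite -[X in (_ <= X * _)%N]card_ord -sum_nat_const; apply: leq_sum => i _.
rewrite (reindex_inj (addrI i)) /=.
apply: (@leq_trans (\sum_(x < n) ((nat_of_ord x <= R0) + (n - R0 <= nat_of_ord x)))).
  apply: leq_sum => x _; rewrite /cyc_dist -{1 2}[x]valZpK (offset_self _ (ltn_ord x)).
  by have := ltn_ord x; case: leqP; case: leqP; case: leqP; lia.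
rewrite big_split /=.
have h1 := @count_interval n' (fun a => a <= R0)%N 0 R0.+1 (fun a h => h).
have h2 : (\sum_(x < n) (n - R0 <= x) <= R0)%N.
  rewrite (eq_bigr (fun x : 'I_n => nat_of_bool ((n - R0 <= x) && (x < n)))%N); last first.
    by move=> x _; rewrite ltn_ord andbT.
  apply: leq_trans (_ : _ <= n - (n - R0))%N _; last by lia.
  exact: (@count_interval n' (fun a => (n - R0 <= a) && (a < n))%N (n - R0) n (fun a h => h)).
by apply: leq_trans (leq_add h1 h2) _; lia.
Qed.

End TwoCardEvolution.

(** * Lower bounds on the probability that two cards come close *)

Section TwoCardLowerBound.
Variables (R : realType) (n' L : nat).
Local Notation n := n'.+1.
Hypothesis Ln : (4 * L <= n)%N.
Hypothesis L64 : (64 <= L)%N.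
Local Notation pairs := ('I_n * 'I_n)%type.
Implicit Types (i j v : 'I_n) (p : pairs) (c : bool) (g : pairs -> R).
Local Notation kernel_op := (@kernel_op R n' L).
Local Notation dist := (@dist R n').
Local Notation band_sum := (@band_sum R n' L).
Local Notation evol := (@evol R n' L).
Local Notation band_ind := (@band_ind R n' L).
Local Notation near_ind := (@near_ind R n' L).
Local Notation band_size := (band_size R L).
Local Notation variance_rate := (variance_rate R n' L).

Let L6 : (6 <= L)%N. Proof. by lia. Qed.
Let n0 : 0 < n%:R :> R. Proof. by rewrite ltr0n. Qed.
Let L0 : 0 < L%:R :> R. Proof. by rewrite ltr0n; lia. Qed.

Let band_ind_ge0 p : 0 <= band_ind p. Proof. by rewrite ler0n. Qed.

Lemma sum_band_ind : \sum_p band_ind p = n%:R * band_size.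
Proof.
rewrite (eq_bigr (fun p => band_ind p * 1)); last by move=> p _; rewrite mulr1.
rewrite (@sum_pairs_offset R n' L Ln L64 (fun=> 1) (fun _ _ => erefl) 0); congr (_ * _).
by rewrite /band_sum sumr_const_nat.
Qed.

Lemma band_size_gt0 : 0 < band_size.
Proof. by rewrite ltr0n; have [? [? ?]] := band_bounds L64; lia. Qed.

(** At most a quarter of the mass is killed, since 32 w <= n, and at most a quarter lies beyond R0
    by Chebyshev. The remaining half sits on at most n (2 R0 + 1) pairs. *)
Lemma sum_evol_sqr_ge w h (R0 : nat) : (32 * w <= n)%N -> (0 < R0)%N ->
  4 * (L%:R ^+ 2 + h%:R * variance_rate) <= R0%:R ^+ 2 ->
  n%:R * (band_size ^+ 2 / (4 * (2 * R0%:R + 1))) <= \sum_p evol w h band_ind p ^+ 2.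
Proof.
move=> wn R00 hR; set V := evol w h band_ind.
have V0 p : 0 <= V p by apply: evol_ge0.
pose m0 : R := \sum_p band_ind p.
have m0E : m0 = n%:R * band_size by apply: sum_band_ind.
have m00 : 0 < m0 by rewrite m0E mulr_gt0 ?band_size_gt0.
have R0p : 0 < R0%:R :> R by rewrite ltr0n.
have mass : 3 / 4 * m0 <= \sum_p V p.
  apply: le_trans (sum_evol_ge R Ln L64 w h); rewrite ler_pM2r //.
  have : 8 * (minn h w)%:R / n%:R <= 1 / 4 :> R.
    rewrite ler_pdivrMr // mul1r ler_pdivlMl // mulrA -!natrM ler_nat; lia.
  by set a := 8 * (minn h w)%:R / n%:R; lra.
pose close : pred pairs := fun p => (cyc_dist p.1 p.2 <= R0)%N.
have far : \sum_(p | ~~ close p) V p <= m0 / 4.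
  apply: (@le_trans _ _ ((\sum_p dist p ^+ 2 * V p) / R0%:R ^+ 2)).
    rewrite mulr_suml [leRHS](bigID close) /= ler_wpDl //.
      by apply: sumr_ge0 => p _; rewrite divr_ge0 ?sqr_ge0 // mulr_ge0 ?sqr_ge0.
    apply: ler_sum => p; rewrite /close -ltnNge => pR.
    rewrite ler_pdivlMr ?exprn_gt0 // mulrC ler_wpM2r //.
    by rewrite ler_sqr ?nnegrE ?ler0n // ler_nat ltnW.
  rewrite ler_pdivrMr ?exprn_gt0 //.
  apply: le_trans (sum_dist_evol R Ln L64 w h) _.
  have := ler_wpM2r (ltW m00) hR; rewrite -/m0; lra.
pose M : R := n%:R * (2 * R0%:R + 1).
have M0 : 0 < M by rewrite mulr_gt0 //; lra.
have cM : #|[pred p | close p]|%:R <= M by apply: (count_close R Ln L64 R0).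
(* The height of that half if spread evenly; summing V^2 >= 2 t V - t^2 is then Cauchy-Schwarz. *)
pose t : R := m0 / 2 / M.
have t0 : 0 < t by rewrite !divr_gt0.
have S2 : m0 / 2 <= \sum_(p | close p) V p.
  by move: mass; rewrite (bigID close) /=; lra.
apply: (@le_trans _ _ (\sum_(p | close p) V p ^+ 2)); last first.
  rewrite [leRHS](bigID close) /= lerDl; apply: sumr_ge0 => p _; exact: sqr_ge0.
have : \sum_(p | close p) (2 * t * V p - t ^+ 2) <= \sum_(p | close p) V p ^+ 2.
  apply: ler_sum => p _; rewrite -subr_ge0.
  have -> : V p ^+ 2 - (2 * t * V p - t ^+ 2) = (V p - t) ^+ 2 by ring.
  exact: sqr_ge0.
apply: le_trans; rewrite sumrB -mulr_sumr sumr_const -[_ *+ _]mulr_natr.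
have h1 : t ^+ 2 * #|[pred p | close p]|%:R <= t ^+ 2 * M by rewrite ler_wpM2l ?sqr_ge0.
have h2 : 2 * t * (m0 / 2) <= 2 * t * \sum_(p | close p) V p.
  by apply: ler_wpM2l => //; rewrite mulr_ge0 // ltW.
have h3 : t ^+ 2 * M = t * (m0 / 2) by rewrite /t; field; rewrite gt_eqF.
apply: (@le_trans _ _ (t * (m0 / 2))); last by move: h1; rewrite h3; lra.
rewrite /t m0E /M le_eqVlt; apply/orP; left; apply/eqP.
have R1 : 0 < 2 * R0%:R + 1 :> R by lra.
move: n0 R1; move: (n%:R : R) (2 * R0%:R + 1 : R) => x y x0 y0.
by field; rewrite !gt_eqF.
Qed.

Lemma band_return w u (R0 : nat) i : (32 * w <= n)%N -> (0 < R0)%N ->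
  4 * (L%:R ^+ 2 + u%:R * variance_rate) <= R0%:R ^+ 2 ->
  band_size ^+ 2 / (16 * (2 * R0%:R + 1)) <= band_sum (evol w u band_ind) i.
Proof.
move=> wn R00 uR.
have vr : 0 <= variance_rate by apply: variance_rate_ge0.
have even h : (h <= u)%N ->
    band_size ^+ 2 / (4 * (2 * R0%:R + 1)) <= band_sum (evol w (2 * h) band_ind) i.
  move=> hu; rewrite -(ler_pM2l n0) -sum_pairs_offset //; last first.
    by apply: evol_shift; apply: band_ind_shift.
  apply: le_trans (sum_evol_sqr_le R Ln L64 w h); apply: sum_evol_sqr_ge => //.
  apply: le_trans uR; rewrite ler_pM2l // lerD2l ler_wpM2r // ler_nat //.
set b := band_size ^+ 2 in even *.
have R1 : 0 < 2 * R0%:R + 1 :> R by have := ltr0n R R0; rewrite R00; lra.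
have b0 : 0 <= b / (4 * (2 * R0%:R + 1)).
  by rewrite divr_ge0 ?sqr_ge0 // mulr_ge0 // ltW.
have -> : b / (16 * (2 * R0%:R + 1)) = b / (4 * (2 * R0%:R + 1)) / 4.
  by move: (2 * R0%:R + 1) R1 => y y0; field; rewrite gt_eqF.
have hu : (u./2 <= u)%N by rewrite -{2}[u]odd_double_half -addnn; lia.
have [e|o] := boolP (odd u); last first.
  have := even u./2 hu; have -> : (2 * u./2 = u)%N by rewrite mul2n even_halfK.
  lra.
have uE : u = (2 * u./2).+1 by rewrite mul2n -[LHS]odd_double_half e.
have h := even u./2 hu; rewrite uE.
apply: (@le_trans _ _ (band_sum (evol w (2 * u./2) band_ind) i / 4)).
  by rewrite ler_pM2r ?invr_gt0.
rewrite /band_sum mulr_suml; apply: ler_sum => d _ /=.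
by apply: kernel_op_hold => // p; apply: evol_ge0.
Qed.

Variables (w T : nat) (x0 : R).
Hypothesis wn : (32 * w <= n)%N.
Hypothesis x00 : 0 <= x0.
Hypothesis x01 : x0 <= 1.
Hypothesis band : forall u i, (u <= w + T)%N ->
  32 * (L%:R + 1) * x0 <= band_sum (evol w u band_ind) i.

Let W u := evol w u near_ind.
Let W0 u p : 0 <= W u p. Proof. by apply: evol_ge0 => q; rewrite ler0n. Qed.

(** Minimum principle: [kernel_op_near] carries the bound from u to u + 1, the hypothesis [band]
    making up for the pairs that leave, and each killed step costs a mass 8 / n. *)
Lemma near_lower u p : (u <= w + T)%N -> (0 < cyc_dist p.1 p.2 <= L)%N ->
  (1 - 8 * (minn u w)%:R / n%:R) * x0 <= W u p.
Proof.
elim: u p => [|u IH] p uT pn.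
  by rewrite min0n mulr0 mul0r subr0 mul1r /W /= /near_ind pn.
have uT' := ltnW uT; pose x : R := (1 - 8 * (minn u w)%:R / n%:R) * x0.
have mw : 8 * (minn u w)%:R / n%:R <= 1 :> R.
  by rewrite ler_pdivrMr // mul1r -natrM ler_nat; lia.
have x_ge0 : 0 <= x by rewrite mulr_ge0 // subr_ge0.
have xx0 : x <= x0 by rewrite ler_piMl // gerBl divr_ge0 ?mulr_ge0 // ltW.
have step : x * kernel_op (u < w)%N (fun=> 1) p <= W u.+1 p.
  apply: kernel_op_near => //; first exact: W0.
  - by apply: evol_shift; apply: near_ind_shift.
  - by apply: evol_symmetric; apply: near_ind_symmetric.
  - by move=> q qn; apply: IH.
  - move=> i; apply: (@le_trans _ _ (32 * (L%:R + 1) * x0)).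
      by apply: ler_wpM2l => //; rewrite mulr_ge0 // addr_ge0 // ltW.
    apply: le_trans (band i uT') _; apply: ler_sum => d _.
    by apply: evol_le => q; apply: band_ind_le_near.
apply: le_trans step; have [uw|wu] := ltnP u w; last first.
  by rewrite kernel_op_false1 // mulr1; have -> : minn u.+1 w = minn u w by lia.
apply: (@le_trans _ _ (x * (1 - 8 / n%:R))); last first.
  by rewrite ler_wpM2l // kernel_op_mass.
have -> : minn u.+1 w = (minn u w).+1 by lia.
rewrite /x -[(minn u w).+1%:R]natr1.
have -> : 8 * ((minn u w)%:R + 1) / n%:R = 8 * (minn u w)%:R / n%:R + 8 / n%:R :> R.
  by rewrite mulrDr mulr1 mulrDl.
rewrite [leRHS]mulrAC ler_wpM2r //.
have a0 : 0 <= 8 * (minn u w)%:R / n%:R :> R by rewrite divr_ge0 ?mulr_ge0 // ltW.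
have b0 : 0 <= 8 / n%:R :> R by rewrite divr_ge0 // ltW.
have := mulr_ge0 a0 b0; set a := _ / _; set b := 8 / _; lra.
Qed.

Variables (k : R) (delta : R).
Hypothesis k0 : 0 < k.
Hypothesis deltaE : delta = L%:R ^+ 3 / (48 * n%:R * k ^+ 2).

(* [(1 + s delta) e^(-dist/k) - 1] is a subsolution of the heat equation away
   from the diagonal, and it is nonpositive at time 0. *)
Lemma far_lower s p : (s <= T)%N -> p.1 != p.2 ->
  3 / 4 * x0 / (1 + T%:R * delta) * ((1 + s%:R * delta) * expR (- (dist p / k)) - 1) <=
  W (w + s) p.
Proof.
have d0 : 0 <= delta.
  rewrite deltaE; apply: divr_ge0; first by rewrite exprn_ge0 // ltW.
  by rewrite mulr_ge0 ?sqr_ge0 // mulr_ge0 // ltW.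
have T1 : 0 < 1 + T%:R * delta by rewrite ltr_pwDl ?mulr_ge0.
set y := 3 / 4 * x0 / (1 + T%:R * delta).
have y0 : 0 <= y by rewrite divr_ge0 ?(ltW T1) // mulr_ge0 // divr_ge0.
have e1 q : expR (- (dist q / k)) <= 1.
  by rewrite expR_le1 oppr_le0 divr_ge0 ?ler0n // ltW.
elim: s p => [|s IH] p sT pn.
  rewrite mul0r addr0 mul1r addn0; apply: le_trans (W0 _ _).
  by rewrite mulr_ge0_le0 // subr_le0.
(* Within distance L the comparison function is at most 3/4 of [x0], thanks to the division by 1 + T
   delta, and [near_lower] gives as much because 8 w / n <= 1/4. *)
have [near|far] := leqP (cyc_dist p.1 p.2) L.
  have h : (0 < cyc_dist p.1 p.2 <= L)%N by rewrite near andbT cyc_dist_gt0.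
  have := @near_lower (w + s.+1) p; rewrite h leq_add2l sT => /(_ isT isT); apply: le_trans.
  have -> : minn (w + s.+1) w = w by lia.
  have w4 : 8 * w%:R / n%:R <= 1 / 4 :> R.
    rewrite ler_pdivrMr // mul1r ler_pdivlMl // mulrA -!natrM ler_nat; lia.
  apply: (@le_trans _ _ (3 / 4 * x0)); last first.
    by rewrite ler_wpM2r //; set a := 8 * w%:R / n%:R in w4 *; lra.
  rewrite /y mulrAC ler_pdivrMr //; apply: ler_wpM2l; first by rewrite mulr_ge0 // divr_ge0.
  have sT' : s.+1%:R * delta <= T%:R * delta by rewrite ler_wpM2r // ler_nat.
  have s0 : 0 <= 1 + s.+1%:R * delta by rewrite addr_ge0 // mulr_ge0.
  by have := ler_wpM2l s0 (e1 p); lra.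
rewrite addnS /W /=; have -> : (w + s < w)%N = false by lia.
rewrite -/(W (w + s)).
pose psi q := expR (- (k^-1 * dist q)).
have psiE q : expR (- (dist q / k)) = psi q by rewrite /psi mulrC.
apply: (@le_trans _ _
      (kernel_op false (fun q => y * ((1 + s%:R * delta) * psi q - 1)) p)); last first.
  apply: kernel_op_le => e; rewrite -psiE; apply: IH; first exact: ltnW.
  by rewrite /rv2 /= (inj_eq (inv_inj (rvK Ln L6 e))).
have -> : kernel_op false (fun q => y * ((1 + s%:R * delta) * psi q - 1)) p =
    y * ((1 + s%:R * delta) * kernel_op false psi p - kernel_op false (fun=> 1) p).
  rewrite /kernel_op /= -mulr_sumr sumrB -mulr_sumr.
  by rewrite [in RHS]mulrA -mulrBl mulrA.
rewrite kernel_op_false1 // ler_wpM2l // lerD2r psiE.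
have ik0 : 0 <= k^-1 by rewrite invr_ge0 ltW.
have := kernel_op_expR Ln L6 ik0 far; rewrite -/(psi p) -/psi.
have -> : k^-1 ^+ 2 * L%:R ^+ 3 / (48 * n%:R) = delta.
  rewrite deltaE; move: (n%:R : R) n0 => z z0; field; by rewrite !gt_eqF.
have s0 : 0 <= 1 + s%:R * delta by rewrite addr_ge0 // mulr_ge0.
move=> /(ler_wpM2l s0); apply: le_trans; rewrite mulrA ler_wpM2r ?expR_ge0 //.
rewrite -[s.+1%:R]natr1.
have := mulr_ge0 (mulr_ge0 (ler0n R s) d0) d0; lra.
Qed.

End TwoCardLowerBound.

(** * Entropy decay of the reversal chain *)

Section ReversalCollisions.
Variables (R : realType) (n' L : nat).
Local Notation n := n'.+1.
Hypothesis Ln : (4 * L <= n)%N.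
Hypothesis L6 : (6 <= L)%N.
Local Notation E := ('I_n * 'I_L.+1)%type.
Local Notation pairs := ('I_n * 'I_n)%type.
Implicit Types (i j v : 'I_n) (p : pairs) (e : E) (x : E * bool).

Definition rev_perm e : 'S_n := perm (inv_inj (rvK Ln L6 e)).

Lemma rev_permE e i : rev_perm e i = rv e i. Proof. by rewrite permE. Qed.

Definition coin_rev x : 'S_n := rev_perm x.1.

(* The reversal of length l at v differs from that of length l - 2 at v + 1 by
   the transposition of v and v + l; the boolean tells which of its two
   possible partners a reversal is paired with. *)
Definition coin_pair x : option pairs :=
  let: ((v, l), b) := x in
  if b then if (l.+2 <= L)%N then Some (v - inZp 1, v + inZp l.+1) else None
  else Some (v, v + inZp (maxn l 1)).

(** Lengths 0 and 1 at the same v are partners: they differ by the swap of v and v + 1, whence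
    [maxn l 1] in [coin_pair]. An inner reversal whose outer one would be longer than L has no pair
    and is its own partner. *)
Definition coin_partner x : E * bool :=
  let: ((v, l), b) := x in
  if b then if (l.+2 <= L)%N then ((v - inZp 1, inord l.+2), false) else x
  else if (2 <= l)%N then ((v + inZp 1, inord (l - 2)), true)
  else ((v, inord (1 - l)), false).

Lemma offset_inj v : injective (offset v).
Proof. by move=> i j /(congr1 (fun a => v + inZp a)); rewrite !add_offset. Qed.

Lemma rev_inner v l i : (2 <= l <= L)%N ->
  rev_pos (v + inZp 1) (l - 2) i = rev_pos v l (tperm v (v + inZp l) i).
Proof.
move=> /andP[l2 lL]; apply: (@offset_inj v).
have step k : (k < n)%N -> offset (v + inZp 1) (v + inZp k) = (if k == 0 then n - 1 else k - 1)%N.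
  move=> kn; rewrite (offset_trans _ v) offset_rev !offset_self //; last by lia.
  by rewrite /= modn_if //; [case: eqP; case: ifP; lia | lia].
have rL k : (k < n)%N -> offset v (rev_pos v l (v + inZp k)) = (if k <= l then l - k else k)%N.
  move=> kn; rewrite rev_posE offset_self //; case: ifP => h; rewrite offset_self //; lia.
have rS k : (k < n)%N -> offset v (rev_pos (v + inZp 1) (l - 2) (v + inZp k)) =
    (if (0 < k < l)%N then l - k else k)%N.
  move=> kn; rewrite rev_posE step //; case: ifP => h.
    rewrite offset_addr offset_self; last by lia.
    move: h; case: (k =P 0%N) => k0 h; first by lia.
    by rewrite modn_small; [case: ifP; lia | lia].
  by rewrite offset_self //; move: h; case: (k =P 0%N) => k0 h; case: ifP; lia.
rewrite -(add_offset v i); set a := offset v i.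
have an : (a < n)%N by apply: offset_lt.
case: tpermP => [/(congr1 (offset v))|/(congr1 (offset v))|].
- rewrite offset_self // offset_id => a0; rewrite rS // rL; last by lia.
  by rewrite a0 leqnn subnn.
- rewrite !offset_self //; last by lia.
  have v0 : v + inZp 0 = v by rewrite (_ : inZp 0 = 0) ?addr0 //; apply: val_inj.
  by move=> al; rewrite rS // al -[X in rev_pos v l X]v0 rL //=; case: ifP; lia.
- move=> h1 h2; rewrite rS // rL //.
  have a0 : a <> 0%N.
    by move=> a0; apply: h1; rewrite a0 (_ : inZp 0 = 0) ?addr0 //; apply: val_inj.
  have al : a <> l by move=> al; apply: h2; rewrite al.
  by case: ifP; case: ifP; lia.
Qed.

Lemma rev_short v i : rev_pos v 1 i = tperm v (v + inZp 1) i.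
Proof.
apply: (@offset_inj v); rewrite -(add_offset v i); set a := offset v i.
have an : (a < n)%N by apply: offset_lt.
rewrite rev_posE offset_self //; case: tpermP => [/(congr1 (offset v))|/(congr1 (offset v))|].
- by rewrite offset_self // offset_id => ->; rewrite subn0.
- rewrite !offset_self //; last by lia.
  by move=> ->; rewrite subnn offset_self // offset_id.
- move=> h1 h2; case: ifP => // a1; exfalso.
  have [a0|a0] : a = 0%N \/ a = 1%N by lia.
    by apply: h1; rewrite a0 (_ : inZp 0 = 0) ?addr0 //; apply: val_inj.
  by apply: h2; rewrite a0.
Qed.

Lemma rev_trivial v i : rev_pos v 0 i = i.
Proof.
rewrite rev_posE; case: ifP => //; rewrite leqn0 offset_eq0 => /eqP->.
by rewrite sub0n (_ : inZp 0 = 0) ?addr0 //; apply: val_inj.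
Qed.

Lemma inZp_shift v k : v + inZp 1 + inZp k = v + inZp k.+1.
Proof.
rewrite -addrA; congr (_ + _); apply: val_inj => /=.
by rewrite modnDm add1n.
Qed.

Lemma coin_partner_pair x : coin_pair (coin_partner x) = coin_pair x.
Proof.
case: x => [[v l] []] /=; have lL := ltn_ord l.
  case: ifP => lL2 /=; last by rewrite lL2.
  rewrite inordK; last by lia.
  congr (Some (_, _)); rewrite -{2}(subrK (inZp 1) v) inZp_shift; congr (_ + inZp _); lia.
case: ifP => l2 /=.
  rewrite inordK; last by lia.
  rewrite (_ : (l - 2).+2 <= L)%N; last by lia.
  rewrite addrK inZp_shift; congr (Some (_, _ + inZp _)); lia.
rewrite inordK; last by lia.
by congr (Some (_, _ + inZp _)); lia.
Qed.

Lemma coin_partnerK : involutive coin_partner.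
Proof.
case=> [[v l] []] /=; have lL := ltn_ord l.
  case: ifP => lL2 /=; last by rewrite lL2.
  rewrite inordK; last by lia.
  rewrite /= subrK; congr ((_, _), _); apply: val_inj; rewrite /= inordK; lia.
case: ifP => l2 /=.
  rewrite inordK; last by lia.
  rewrite (_ : (l - 2).+2 <= L)%N; last by lia.
  rewrite addrK; congr ((_, _), _); apply: val_inj; rewrite /= inordK; lia.
rewrite inordK; last by lia.
rewrite (_ : 1 < 1 - l = false)%N; last by lia.
congr ((_, _), _); apply: val_inj; rewrite /= inordK; lia.
Qed.

Lemma coin_rev_partner x p : coin_pair x = Some p ->
  coin_rev (coin_partner x) = (tperm p.1 p.2 * coin_rev x)%g.
Proof.
case: x => [[v l] []] /=; have lL := ltn_ord l.
  case: ifP => // lL2 [<-]; apply/permP => i; rewrite permM !rev_permE /rv /=.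
  rewrite inordK; last by lia.
  set u := v - inZp 1; have -> : v = u + inZp 1 by rewrite subrK.
  rewrite inZp_shift.
  have -> : nat_of_ord l = (l.+2 - 2)%N by lia.
  rewrite rev_inner; last by lia.
  have -> : ((l.+2 - 2).+2 = l.+2)%N by lia.
  by rewrite tpermK.
case: ifP => l2 [<-]; apply/permP => i; rewrite permM !rev_permE /rv /=.
  rewrite inordK; last by lia.
  by rewrite rev_inner; [congr (rev_pos _ _ (tperm _ (_ + inZp _) _)); lia | lia].
rewrite inordK; last by lia.
have [l0|l1] : nat_of_ord l = 0%N \/ nat_of_ord l = 1%N by lia.
  by rewrite l0 rev_trivial -rev_short.
by rewrite l1 rev_trivial rev_short tpermK.
Qed.

Lemma coin_pair_neq x p : coin_pair x = Some p -> p.1 != p.2.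
Proof.
case: x => [[v l] []] /=; have lL := ltn_ord l.
  case: ifP => // lL2 [<-] /=.
  set u := v - inZp 1; have -> : v = u + inZp 1 by rewrite subrK.
  rewrite inZp_shift -offset_eq0 offset_self; lia.
by move=> [<-] /=; rewrite -offset_eq0 offset_self; lia.
Qed.

End ReversalCollisions.

(** * Collisions of the reversal chain *)

Section ReversalEntropyDecrease.
Variables (R : realType) (n' L : nat).
Local Notation n := n'.+1.
Hypothesis Ln : (4 * L <= n)%N.
Hypothesis L64 : (64 <= L)%N.
Local Notation E := ('I_n * 'I_L.+1)%type.
Local Notation pairs := ('I_n * 'I_n)%type.
Implicit Types (i j v : 'I_n) (p : pairs) (e : E) (x : E * bool) (f : 'S_n -> R).

Let L6 : (6 <= L)%N. Proof. by lia. Qed.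

Local Notation N := (shapes R n' L).
Local Notation rev_perm := (rev_perm Ln L6).
Local Notation coin_rev := (coin_rev Ln L6).
Local Notation coin_pair := (@coin_pair n' L).
Local Notation kernel_op := (@kernel_op R n' L).
Local Notation near_ind := (@near_ind R n' L).

Definition rev_step f : 'S_n -> R := mean_op rev_perm f.

Lemma sum_coin (F : E -> R) : \sum_(x : E * bool) F x.1 = 2 * \sum_e F e.
Proof.
transitivity (\sum_(e : E) \sum_(b : bool) F e); first by rewrite pair_bigA.
rewrite mulr_sumr.
by apply: eq_bigr => e _; rewrite big_bool /=; ring.
Qed.

Lemma card_coin : #|{: E * bool}|%:R = 2 * N.
Proof. by rewrite !card_prod !card_ord card_bool mulnC natrM. Qed.

Lemma card_E : #|{: E}|%:R = N.
Proof. by rewrite card_prod !card_ord. Qed.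

Lemma div_coin (a : R) : 2 * a / (2 * N) = a / N.
Proof. by rewrite -mulf_div divff ?mul1r // pnatr_eq0. Qed.

Lemma mean_op_coin f : mean_op coin_rev f = rev_step f.
Proof.
apply: boolp.funext => y; rewrite /rev_step /mean_op card_coin card_E -div_coin.
by rewrite (sum_coin (fun e => f (rev_perm e * y)%g)).
Qed.

Lemma pair_op_coin (g : 'I_n -> 'I_n -> R) i j :
  pair_op coin_rev g i j = kernel_op false (fun p => g p.1 p.2) (i, j).
Proof.
rewrite /pair_op card_coin (sum_coin (fun e => g (rev_perm e i) (rev_perm e j))) div_coin.
by rewrite /kernel_op /=; congr (_ / _); apply: eq_bigr => e _; rewrite !rev_permE.
Qed.

Lemma clear_collided x i : clear x.1 i -> i \notin collided coin_pair x.
Proof.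
case: x => [[v l] b]; rewrite /clear /collided /=; have lL := ltn_ord l.
move=> /and4P[a0 al al1 an1].
have ne k : (k < n)%N -> offset v i != k -> i != v + inZp k.
  by move=> kn; apply: contra => /eqP->; rewrite offset_self.
have nv : i != v by rewrite eq_sym -offset_eq0.
have nm : i != v - inZp 1.
  apply: contra an1 => /eqP->; rewrite offset_rev.
  have -> : offset (v - inZp 1) v = 1%N by rewrite -{2}(subrK (inZp 1) v) offset_self; lia.
  by apply/eqP => /=; lia.
case: b; first case: ifP => lL2; rewrite ?in_set0 // !inE negb_or /=.
  by rewrite nm ne //; lia.
rewrite nv /=; have [h|h] := leqP l 1; last by rewrite ne //; lia.
rewrite ne //; first by lia.
have [l0|l1] : nat_of_ord l = 0%N \/ nat_of_ord l = 1%N by lia.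
  by rewrite l0 in al1.
by rewrite l1 in al.
Qed.

Lemma free_op_coin (g : 'I_n -> 'I_n -> R) i j : (forall i j, 0 <= g i j) ->
  kernel_op true (fun p => g p.1 p.2) (i, j) <= free_op coin_rev coin_pair g i j.
Proof.
move=> g0; rewrite /free_op card_coin /kernel_op -div_coin ler_pM2r; last first.
  by rewrite invr_gt0 mulr_gt0 // shapes_gt0.
rewrite big_mkcond -(sum_coin (fun e => if allowed true e (i, j) then
  g (rv2 e (i, j)).1 (rv2 e (i, j)).2 else 0)) [leRHS]big_mkcond.
apply: ler_sum => x _; case: ifP => [/andP[/clear_collided ci /clear_collided cj]|_].
  by rewrite ci cj !rev_permE.
by case: ifP.
Qed.

(** Two of the 2 N moves with coin have this pair: the reversal from i to j and its partner. *)
Lemma collision_prob_coin i j : (0 < offset i j <= L)%N ->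
  N^-1 <= collision_prob R coin_pair i j.
Proof.
move=> /andP[d0 dL]; rewrite /collision_prob card_coin.
have -> : N^-1 = 2 / (2 * N) by rewrite -{1}(mulr1 2) div_coin mul1r.
rewrite ler_pM2r; last by rewrite invr_gt0 mulr_gt0 // shapes_gt0.
rewrite ler_nat; set d := offset i j in d0 dL.
have dE : i + inZp d = j by apply: add_offset.
pose x1 : E * bool := ((i, inord d), false).
pose x2 : E * bool := coin_partner x1.
have q1 : coin_pair x1 = Some (i, j).
  by rewrite /= inordK // (_ : maxn d 1 = d) ?dE //; lia.
have x12 : x1 != x2.
  apply/eqP => h; have := coin_partner_pair Ln L6 x1.
  move: h; rewrite /x2 /x1 /= inordK //; case: ifP => // d2 [] /(congr1 val) /=.
  rewrite !inordK //; lia.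
apply: leq_trans (_ : #|[set x1; x2]| <= _)%N; first by rewrite cards2 x12.
rewrite subset_leq_card //.
by apply/subsetP => x; rewrite !inE => /orP[]/eqP->; rewrite ?coin_partner_pair // q1.
Qed.

Local Notation free_prob w := (match_prob R coin_rev coin_pair w).

Lemma kernel_op_sum c w (F : nat -> pairs -> R) p :
  kernel_op c (fun p => (\sum_(s < w) F s p) / N) p = (\sum_(s < w) kernel_op c (F s) p) / N.
Proof.
by rewrite /kernel_op -!mulr_suml exchange_big.
Qed.

Lemma near_ind_le p : near_ind p / N <=
  collision_prob R coin_pair p.1 p.2 + collision_prob R coin_pair p.2 p.1.
Proof.
have cp0 i j : 0 <= collision_prob R coin_pair i j by rewrite divr_ge0 ?ler0n.
rewrite /near_ind; case: (boolP (_ < _ <= _)%N) => h; last by rewrite mul0r addr_ge0.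
rewrite mul1r; have [d|d] : (0 < offset p.1 p.2 <= L)%N \/ (0 < offset p.2 p.1 <= L)%N.
- move: h; rewrite /cyc_dist (offset_rev p.1 p.2); have := offset_lt p.1 p.2.
  by case: eqP; lia.
- by apply: (@le_trans _ _ (collision_prob R coin_pair p.1 p.2));
    [exact: collision_prob_coin | rewrite lerDl].
by apply: (@le_trans _ _ (collision_prob R coin_pair p.2 p.1));
    [exact: collision_prob_coin | rewrite lerDr].
Qed.

(** Unfold the recursion: s moves without collision, then a collision of a pair within distance L.
    Both orientations are added because [near_ind] is symmetric whereas a collision is oriented. *)
Lemma match_prob_lower w p :
  (\sum_(s < w) iter s (kernel_op true) near_ind p) / N <=
  free_prob w p.1 p.2 + free_prob w p.2 p.1.
Proof.
elim: w p => [|w IH] p; first by rewrite big_ord0 mul0r addr0.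
rewrite big_ord_recl mulrDl /=; have h1 := near_ind_le p.
pose S q := free_prob w q.1 q.2 + free_prob w q.2 q.1.
have h2 : (\sum_(s < w) iter s.+1 (kernel_op true) near_ind p) / N <= kernel_op true S p.
  rewrite -(kernel_op_sum true _ (fun s => iter s (kernel_op true) near_ind)).
  by apply: kernel_op_le => e; apply: IH.
have h3 : kernel_op true S p <= free_op coin_rev coin_pair (free_prob w) p.1 p.2 +
    free_op coin_rev coin_pair (free_prob w) p.2 p.1.
  have mp0 i j : 0 <= free_prob w i j by apply: match_prob_ge0.
  apply: le_trans (lerD (free_op_coin p.1 p.2 mp0) (free_op_coin p.2 p.1 mp0)).
  rewrite le_eqVlt; apply/orP; left; apply/eqP.
  rewrite /kernel_op -mulrDl; congr (_ / _); rewrite big_split /=; congr (_ + _).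
  by apply: eq_bigl => e; rewrite andbC.
by apply: le_trans (lerD h1 (le_trans h2 h3)) _; rewrite addrACA.
Qed.

Lemma evolE w t g : iter t (kernel_op false) (iter w (kernel_op true) g) = evol L w (t + w) g.
Proof.
elim: t => [|t IH]; last by rewrite /= IH; have -> : (t + w < w)%N = false by lia.
suff h u : (u <= w)%N -> iter u (kernel_op true) g = evol L w u g by apply: h.
by elim: u => //= u IH uw; rewrite IH ?(ltnW uw) // uw.
Qed.

Lemma late_match_prob_lower t w p :
  (\sum_(s < w) evol L s (t + s) near_ind p) / N <=
  iter t (pair_op coin_rev) (free_prob w) p.1 p.2 +
  iter t (pair_op coin_rev) (free_prob w) p.2 p.1.
Proof.
have -> : \sum_(s < w) evol L s (t + s) near_ind p =
    \sum_(s < w) iter t (kernel_op false) (iter s (kernel_op true) near_ind) p.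
  by apply: eq_bigr => s _; rewrite evolE.
elim: t p => [|t IH] p; first exact: match_prob_lower.
rewrite /= -(kernel_op_sum false _ (fun s =>
      iter t (kernel_op false) (iter s (kernel_op true) near_ind))).
rewrite !pair_op_coin.
apply: le_trans (kernel_op_le (h := fun q => iter t (pair_op coin_rev) (free_prob w) q.1 q.2 +
  iter t (pair_op coin_rev) (free_prob w) q.2 q.1) _ _) _; first by move=> e; apply: IH.
by rewrite /kernel_op -mulrDl -big_split.
Qed.

Let coin_gt0 : (0 < #|{: E * bool}|)%N.
Proof. by rewrite !card_prod !card_ord card_bool. Qed.

Let coin_revK x : involutive (coin_rev x).
Proof. by move=> i; rewrite !rev_permE (rvK Ln L6). Qed.

Let partnerI := inv_inj (@coin_partnerK n' L Ln L6).

Theorem entropy_decrease_late t w f : (forall y, 0 <= f y) ->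
  (\sum_p (\sum_(s < w) evol L s (t + s) near_ind p) * ordered_gain f p.1 p.2) / N <=
  8 * (entropy f - entropy (iter (w + t) rev_step f)).
Proof.
move=> f0.
have := entropy_decrease_matching coin_gt0 coin_revK partnerI (coin_partner_pair Ln L6)
  (coin_rev_partner Ln L6) (coin_pair_neq Ln L6) t w f0.
have -> : iter (w + t) (mean_op coin_rev) f = iter (w + t) rev_step f.
  by apply: eq_iter => g; apply: mean_op_coin.
set X := \sum_p _ => hX.
have : 2 * X = \sum_p (iter t (pair_op coin_rev) (free_prob w) p.1 p.2 +
     iter t (pair_op coin_rev) (free_prob w) p.2 p.1) * ordered_gain f p.1 p.2.
  rewrite (eq_bigr (fun p => iter t (pair_op coin_rev) (free_prob w) p.1 p.2 *
      ordered_gain f p.1 p.2 +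
     iter t (pair_op coin_rev) (free_prob w) p.2 p.1 * ordered_gain f p.1 p.2)); last first.
    by move=> p _; rewrite mulrDl.
  rewrite big_split /= -/X.
  have -> : \sum_p iter t (pair_op coin_rev) (free_prob w) p.2 p.1 * ordered_gain f p.1 p.2 = X.
    have swI : involutive (fun p : pairs => (p.2, p.1)) by case.
    rewrite (reindex_inj (inv_inj swI)) /=; apply: eq_bigr => p _.
    by rewrite ordered_gainC.
  lra.
move=> e2; apply: (@le_trans _ _ (2 * X)); last by lra.
rewrite e2 mulr_suml; apply: ler_sum => p _.
by rewrite mulrAC ler_wpM2r ?ordered_gain_ge0 // late_match_prob_lower.
Qed.

Theorem entropy_decrease_once f : (forall y, 0 <= f y) ->
  (\sum_(p | (0 < offset p.1 p.2 <= L)%N) entropy_drop (tperm p.1 p.2) f) / N <=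
  entropy f - entropy (rev_step f).
Proof.
move=> f0; have := entropy_decrease_step coin_gt0 coin_revK partnerI (coin_partner_pair Ln L6)
  (coin_rev_partner Ln L6) (coin_pair_neq Ln L6) f0.
rewrite mean_op_coin; apply: le_trans.
rewrite mulr_suml [leRHS](bigID (fun p : pairs => 0 < offset p.1 p.2 <= L)%N) /=.
have cp0 i j : 0 <= collision_prob R coin_pair i j by rewrite divr_ge0 ?ler0n.
apply: ler_wpDr.
  by apply: sumr_ge0 => p _; rewrite mulr_ge0 // entropy_drop_ge0.
by apply: ler_sum => p dp; rewrite mulrC ler_wpM2r ?entropy_drop_ge0 // collision_prob_coin.
Qed.

End ReversalEntropyDecrease.

(** * Entropy revealed position by position *)

Section ExposureEntropy.
Variables (R : realType) (n' L : nat).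
Local Notation n := n'.+1.
Hypothesis Ln : (4 * L <= n)%N.
Hypothesis L64 : (64 <= L)%N.
Implicit Types (f : 'S_n -> R) (i j : 'I_n) (k : nat).

Let L6 : (6 <= L)%N. Proof. by lia. Qed.
Let n0 : 0 < n%:R :> R. Proof. by rewrite ltr0n. Qed.

Local Notation rev_step := (@rev_step R n' L Ln L64).
Local Notation N := (shapes R n' L).

Definition below k : {set 'I_n} := [set x : 'I_n | (x < k)%N].
(** The cards at positions >= k keep their law and the others are shuffled uniformly. For a law f
    this interpolates, decreasingly in k, between the entropy of f and that of the uniform law. *)
Definition tail_entropy f k : R := entropy (sym_avg (below k) f).
Definition rel_entropy f : R := entropy f - tail_entropy f n.

Lemma expR1_le4 : expR 1 <= 4 :> R.
Proof.
have h : 1 / 2 <= expR (- (1 / 2)) :> R by have := expR_ge1Dx (- (1 / 2) : R); lra.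
have h2 : expR (- (1 / 2)) ^+ 2 = (expR 1)^-1 :> R.
  by rewrite -expRM_natl -expRN; congr expR; lra.
have e0 := expR_gt0 (1 : R).
rewrite -[leLHS]invrK -h2 invf_ple ?posrE ?exprn_gt0 ?expR_gt0 //.
by apply: le_trans (_ : _ <= (1 / 2) ^+ 2) _; [lra | rewrite ler_sqr ?nnegrE ?expR_ge0 //; lra].
Qed.

Lemma expR1_le_n : expR 1 <= n%:R :> R.
Proof. by apply: le_trans expR1_le4 _; rewrite ler_nat; lia. Qed.

Lemma ln_n_ge1 : 1 <= ln n%:R :> R.
Proof. by rewrite -[leLHS]expRK ler_ln ?posrE ?expR_gt0 // expR1_le_n. Qed.

Lemma below_upto i : upto i = below i.+1.
Proof. by apply/setP => x; rewrite !inE. Qed.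

Lemma below_upto_setD1 i : upto i :\ i = below i.
Proof. by apply/setP => x; rewrite !inE ltn_neqAle val_eqE. Qed.

Lemma card_below k : (k <= n)%N -> #|below k| = k.
Proof.
move=> kn; rewrite -sum1_card (eq_bigl (fun x : 'I_n => (x < k)%N)); last by move=> x; rewrite inE.
by rewrite -(big_ord_widen n (fun=> 1%N) kn) sum1_card card_ord.
Qed.

Lemma below_full k : (n <= k)%N -> below k = [set: 'I_n].
Proof. by move=> nk; apply/setP => x; rewrite !inE (leq_trans (ltn_ord x) nk). Qed.

Lemma belowS k l : (k <= l)%N -> below k \subset below l.
Proof. by move=> kl; apply/subsetP => x; rewrite !inE => /leq_trans; apply. Qed.

Lemma tail_entropy_full f k : (n <= k)%N -> tail_entropy f k = tail_entropy f n.
Proof. by move=> nk; rewrite /tail_entropy !below_full. Qed.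

Lemma tail_entropy0 f : tail_entropy f 0 = entropy f.
Proof. by rewrite /tail_entropy sym_avg_trivial // card_below. Qed.

Lemma tail_entropy_decr f k l : (forall y, 0 <= f y) -> (k <= l)%N ->
  tail_entropy f l <= tail_entropy f k.
Proof.
move=> f0 kl; rewrite -subr_ge0; apply: le_trans (hellinger_le_entropy_sub f0 _).
  exact: hellinger_ge0.
exact/SymS/belowS.
Qed.

Lemma rel_entropy_ge0 f : (forall y, 0 <= f y) -> 0 <= rel_entropy f.
Proof. by move=> f0; rewrite subr_ge0 -(tail_entropy0 f) tail_entropy_decr. Qed.

Lemma tail_entropy_step f i : (forall y, 0 <= f y) ->
  i.+1%:R * (tail_entropy f i - tail_entropy f i.+1) <=
  5 * ln n%:R * \sum_(j in upto i) ordered_gain f i j.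
Proof.
move=> f0; have ii : i \in upto i by rewrite inE.
have cu : #|upto i| = i.+1 by rewrite below_upto card_below.
have := @entropy_expose_le R _ f (upto i) i n%:R f0 ii expR1_le_n.
rewrite cu ler_nat ltn_ord => /(_ isT).
rewrite below_upto_setD1 below_upto -!/(tail_entropy _ _) => h; apply: le_trans h _.
rewrite -below_upto le_eqVlt; apply/orP; left; apply/eqP; congr (_ * _).
by apply: eq_bigr => j; rewrite inE /ordered_gain => ->.
Qed.

Lemma ordered_gain_diag f i : ordered_gain f i i = 0.
Proof.
rewrite /ordered_gain leqnn /pair_gain.
have -> : lshift (tperm i i) f = f by apply: boolp.funext => z; rewrite /lshift tperm1 mul1g.
by rewrite /hellinger big1 // => y _; rewrite subrr expr0n.
Qed.

(** Any two of the first L positions collide in one step with probability at least 1 / N, so the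
    decay for random transpositions applies to them. The 80 n is 20 * 2 * 2 n, from both orders of a
    pair and N <= 2 n L. *)
Lemma entropy_rev_step_small f : (forall y, 0 <= f y) ->
  (entropy f - tail_entropy f L) / (80 * n%:R * ln n%:R) <= entropy f - entropy (rev_step f).
Proof.
move=> f0; have ln1 := ln_n_ge1.
apply: le_trans (entropy_decrease_once Ln L64 f0).
set D := fun i j => entropy_drop (tperm i j) f.
have D0 i j : 0 <= D i j by apply: entropy_drop_ge0.
have Dii i : D i i = 0 by rewrite /D tperm1 entropy_drop1.
have Ln' : (L <= n)%N by lia.
have := @entropy_block_le R _ f (below L) n%:R f0 expR1_le_n.
rewrite card_below // ler_nat Ln' => /(_ isT); rewrite -/(tail_entropy f L) => h.
set S := \sum_(p | _) _.
have hS : \sum_(i in below L) \sum_(j in below L) D i j <= 2 * S.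
  have -> : 2 * S = S + S by ring.
  have {2}-> : S = \sum_(p : 'I_n * 'I_n | (0 < offset p.2 p.1 <= L)%N) D p.1 p.2.
    have swI : involutive (fun p : 'I_n * 'I_n => (p.2, p.1)) by case.
    rewrite [RHS](reindex_inj (inv_inj swI)) /=; apply: eq_bigr => p _.
    by rewrite /D tpermC.
  rewrite /S [X in _ <= X + _]big_mkcond [X in _ <= _ + X]big_mkcond -big_split /=.
  rewrite pair_big big_mkcond; apply: ler_sum => -[i j] _ /=.
  have pos (b : bool) : 0 <= (if b then D i j else 0) by case: b.
  rewrite -/(D i j); case: ifP => [/andP[]|_]; last by rewrite addr_ge0.
  rewrite !inE => iL jL.
  have [->|ij] := eqVneq i j; first by rewrite Dii !offset_id /= addr0.
  have off (a b : 'I_n) : (a < b)%N -> offset a b = (b - a)%N.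
    move=> ab; rewrite /offset /= modnDmr addnBA ?(ltnW (ltn_ord a)) // addnC -addnBA ?(ltnW ab) //.
    by rewrite modnDl modn_small //; apply: leq_ltn_trans (leq_subr _ _) (ltn_ord b).
  have [ltij|ltji|e] := ltngtP i j; last by rewrite (val_inj e) eqxx in ij.
    by rewrite off // (_ : 0 < j - i <= L)%N ?lerDl //; lia.
  by rewrite (off j) // (_ : 0 < i - j <= L)%N ?lerDr //; lia.
have L0 : 0 < L%:R :> R by rewrite ltr0n; lia.
have N0 : 0 < N by apply: shapes_gt0.
have NL : N <= 2 * n%:R * L%:R.
  by rewrite -!natrM ler_nat; nia.
rewrite ler_pdivlMr // mulrAC ler_pdivrMr; last by rewrite !mulr_gt0 //; lra.
have l20 : 0 <= 20 * ln n%:R :> R by lra.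
have S0 : 0 <= S by apply: sumr_ge0 => p _; apply: D0.
have e0 : 0 <= entropy f - tail_entropy f L.
  by rewrite subr_ge0 -[leRHS]tail_entropy0 tail_entropy_decr.
have h2 := ler_wpM2l l20 hS.
have h3 : (entropy f - tail_entropy f L) * N <= 2 * n%:R * (L%:R * (entropy f - tail_entropy f L)).
  by have := ler_wpM2l e0 NL; lra.
apply: le_trans h3 _.
apply: (@le_trans _ _ (2 * n%:R * (20 * ln n%:R * (2 * S)))).
  by rewrite ler_wpM2l ?mulr_ge0 ?(ltW n0) // (le_trans h h2).
by lra.
Qed.

End ExposureEntropy.

Lemma large_scale_constants (R : realFieldType) (l a b y d : R) :
  0 < l -> 0 <= a * b * d ->
  l / (40 * (4000 * 4000)) * y <= 5 * b * (8 * d * (2 * a * l)) ->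
  y <= 82 * (40 * (4000 * 4000)) * a * b * d.
Proof.
move=> l0 P0 h; rewrite -(ler_pM2l l0).
by have := mulr_ge0 (ltW l0) P0; lra.
Qed.

(** * Entropy decrease at one dyadic scale *)

Section LargeScale.
Variables (R : realType) (n' L : nat).
Local Notation n := n'.+1.
Hypothesis Ln : (4 * L <= n)%N.
Hypothesis L64 : (64 <= L)%N.
Implicit Types (f : 'S_n -> R) (i j : 'I_n).

Let L6 : (6 <= L)%N. Proof. by lia. Qed.
Let n0 : 0 < n%:R :> R. Proof. by rewrite ltr0n. Qed.
Let L0 : 0 < L%:R :> R. Proof. by rewrite ltr0n; lia. Qed.

Local Notation rev_step := (@rev_step R n' L Ln L64).
Local Notation N := (shapes R n' L).
Local Notation near_ind := (@near_ind R n' L).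

Variable k : nat.
Hypothesis kL : (2 * L <= k)%N.
Hypothesis kn : (k <= 2 * n)%N.

(* Time needed by a card to diffuse over a distance k. *)
Definition diffusion_time : R := k%:R ^+ 2 * n%:R / L%:R ^+ 3.
Local Notation rho := diffusion_time.

Let k0 : 0 < k%:R :> R. Proof. by rewrite ltr0n; lia. Qed.
Let k_ge1 : 1 <= k%:R :> R. Proof. by rewrite ler1n; lia. Qed.
Let L_ge1 : 1 <= L%:R :> R. Proof. by rewrite ler1n; lia. Qed.
Let L30 : 0 < L%:R ^+ 3 :> R. Proof. by rewrite exprn_gt0. Qed.

Lemma diffusion_time_ge : 16 <= rho.
Proof.
rewrite /diffusion_time ler_pdivlMr //.
have h1 : 4 * L%:R ^+ 2 <= k%:R ^+ 2 :> R.
  have -> : 4 * L%:R ^+ 2 = (2 * L%:R) ^+ 2 :> R by ring.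
  by rewrite ler_sqr ?nnegrE ?mulr_ge0 ?ler0n // -natrM ler_nat.
have h2 : 4 * L%:R <= n%:R :> R by rewrite -natrM ler_nat.
have h3 : 0 <= L%:R ^+ 2 :> R by apply: sqr_ge0.
have := ler_pM _ _ h1 h2; rewrite !mulr_ge0 ?(ltW L0) // => /(_ isT isT); lra.
Qed.

(** As delta rho = 1/48, the factor 240 yields t delta >= 5, so that at distance k the subsolution
    (1 + t delta) / e - 1 is at least 6/4 - 1 = 1/2. *)
Definition mixing_steps : nat := (Num.truncn (240 * rho)).+1.
Local Notation t := mixing_steps.

Lemma mixing_steps_bounds : 240 * rho <= t%:R <= 241 * rho.
Proof.
have r16 := diffusion_time_ge.
have r0 : 0 <= 240 * rho by lra.
have /andP[h1 h2] := Num.Theory.truncn_itv r0.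
by rewrite /mixing_steps (ltW h2) -natr1; lra.
Qed.

(** In [band_condition] the constant 4000 * 4000 has to exceed 64 * 64 * 3472: the factors come from
    32 (L + 1) <= 64 L, from the squared size of the band, at least L^2 / 64, and from the radius
    108 k. *)
Definition near_mass : R := L%:R / (4000 * 4000 * k%:R).
Definition far_growth : R := L%:R ^+ 3 / (48 * n%:R * k%:R ^+ 2).
Local Notation x0 := near_mass.
Local Notation delta := far_growth.

Lemma delta_rho : delta * rho = 1 / 48.
Proof.
rewrite /far_growth /diffusion_time.
move: (n%:R : R) (k%:R : R) (L%:R : R) n0 k0 L0 => a b c a0 b0 c0.
by field; rewrite !gt_eqF.
Qed.

Lemma band_condition s u i : (32 * s <= n)%N -> s%:R <= rho -> (u <= s + t)%N ->
  32 * (L%:R + 1) * x0 <= band_sum L (evol L s u (band_ind R L)) i.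
Proof.
move=> sn sr us.
have r16 := diffusion_time_ge; have /andP[_ t241] := mixing_steps_bounds.
have u242 : u%:R <= 242 * rho.
  by move: us; rewrite -(ler_nat R) natrD => us; lra.
have var : variance_rate R n' L <= 12 * L%:R ^+ 3 / n%:R.
  rewrite /variance_rate ler_pM2r ?invr_gt0 //.
  by have := sqr_ge0 (L%:R : R); have := L_ge1; nra.
have uv : u%:R * variance_rate R n' L <= 2904 * k%:R ^+ 2.
  apply: le_trans (_ : _ <= 242 * rho * (12 * L%:R ^+ 3 / n%:R)) _.
    by apply: ler_pM => //; apply: variance_rate_ge0.
  rewrite /diffusion_time; move: (n%:R : R) n0 => a a0.
  rewrite le_eqVlt; apply/orP; left; apply/eqP.
  by move: (L%:R : R) L0 => c c0; field; rewrite !gt_eqF.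
have Lk : 4 * L%:R ^+ 2 <= k%:R ^+ 2 :> R.
  have -> : 4 * L%:R ^+ 2 = (2 * L%:R) ^+ 2 :> R by ring.
  by rewrite ler_sqr ?nnegrE ?mulr_ge0 ?ler0n // -natrM ler_nat.
(* In at most 242 rho steps the mean squared distance grows by at most 2904 k^2, and 4 (1/4 + 2904)
   <= 108^2. *)
have R0p : (0 < 108 * k)%N by rewrite muln_gt0 /= (leq_trans _ kL) // muln_gt0 /= (leq_trans _ L64).
have cond : 4 * (L%:R ^+ 2 + u%:R * variance_rate R n' L) <= (108 * k)%N%:R ^+ 2.
  have -> : (108 * k)%N%:R ^+ 2 = 108 * 108 * k%:R ^+ 2 :> R by rewrite natrM; ring.
  by have := sqr_ge0 (k%:R : R); lra.
apply: le_trans (band_return Ln L64 i sn R0p cond).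
rewrite /near_mass mulrA ler_pdivrMr ?mulr_gt0 // [leRHS]mulrAC.
have d0 : 0 < 16 * (2 * (108 * k)%N%:R + 1) :> R by rewrite mulr_gt0 // ltr_wpDl // mulr_ge0.
rewrite ler_pdivlMr //.
have bs : L%:R <= 8 * band_size R L.
  by rewrite /band_size -natrM ler_nat; have [_ [_ h]] := band_bounds L64.
have bs2 : L%:R ^+ 2 <= 64 * band_size R L ^+ 2.
  have -> : 64 * band_size R L ^+ 2 = (8 * band_size R L) ^+ 2 by ring.
  by rewrite ler_sqr ?nnegrE ?mulr_ge0 ?ler0n.
have L1 : L%:R + 1 <= 2 * L%:R :> R by have := L_ge1; lra.
have k1 := k_ge1; rewrite natrM.
have h1 : 32 * (L%:R + 1) * L%:R <= 64 * L%:R ^+ 2 :> R.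
  by have := ler_wpM2r (ltW L0) L1; lra.
have h2 : 16 * (2 * (108 * k%:R) + 1) <= 3472 * k%:R :> R by lra.
have h3 : 0 <= L%:R ^+ 2 :> R by apply: sqr_ge0.
apply: (@le_trans _ _ (64 * L%:R ^+ 2 * (3472 * k%:R))).
  by apply: ler_pM => //; rewrite ?mulr_ge0 ?addr_ge0 ?mulr_ge0 // ltW.
have h4 : 0 <= band_size R L ^+ 2 * k%:R by rewrite mulr_ge0 ?sqr_ge0 // ltW.
by have := ler_wpM2r (ltW k0) bs2; lra.
Qed.

Lemma evol_lower s p : (32 * s <= n)%N -> s%:R <= rho -> p.1 != p.2 ->
  (cyc_dist p.1 p.2 <= k)%N ->
  L%:R / (20 * (4000 * 4000) * k%:R) <= evol L s (t + s) near_ind p.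
Proof.
move=> sn sr pn pk.
have r16 := diffusion_time_ge; have /andP[t240 t241] := mixing_steps_bounds.
have x00 : 0 <= x0 by rewrite divr_ge0 ?mulr_ge0 // ltW.
have Lk : L%:R <= k%:R :> R by rewrite ler_nat (leq_trans _ kL) // leq_pmull.
have x01 : x0 <= 1.
  rewrite /near_mass ler_pdivrMr ?mulr_gt0 // mul1r; apply: le_trans Lk _.
  by rewrite ler_peMl ?(ltW k0) // mulr_ege1 // ler1n.
have d0 : 0 < delta by rewrite divr_gt0 ?mulr_gt0 ?exprn_gt0.
have dr := delta_rho.
have band u i : (u <= s + t)%N -> 32 * (L%:R + 1) * x0 <= band_sum L (evol L s u (band_ind R L)) i.
  exact: band_condition.
have := far_lower Ln L64 sn x00 x01 band k0 (erefl delta) (leqnn t) pn.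
rewrite addnC; apply: le_trans.
have td5 : 5 <= t%:R * delta.
  by have := ler_wpM2r (ltW d0) t240; lra.
have td6 : t%:R * delta <= 6.
  by have := ler_wpM2r (ltW d0) t241; lra.
set T := t%:R * delta in td5 td6 *.
have e4 : 1 / 4 <= expR (- (dist R p / k%:R)).
  apply: (@le_trans _ _ (expR (- 1))).
    by rewrite expRN ler_pdivrMr // mulrC ler_pdivlMr ?expR_gt0 // mul1r expR1_le4.
  by rewrite ler_expR lerN2 ler_pdivrMr // mul1r ler_nat.
have h1 : 1 / 2 <= (1 + T) * expR (- (dist R p / k%:R)) - 1.
  have T0 : 0 <= 1 + T by lra.
  by have := ler_wpM2l T0 e4; lra.
have T1 : 0 < 1 + T by lra.
have y0 : 0 <= 3 / 4 * x0 / (1 + T).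
  by apply: divr_ge0; [apply: mulr_ge0; [rewrite divr_ge0|] | exact: ltW].
apply: le_trans (ler_wpM2l y0 h1).
have -> : L%:R / (20 * (4000 * 4000) * k%:R) = x0 / 20.
  by rewrite /near_mass; move: (k%:R : R) k0 => b b0; field; rewrite gt_eqF.
rewrite [leRHS]mulrAC ler_pdivlMr //.
by have := ler_wpM2l x00 td6; lra.
Qed.

(** For j < i < k the cards are at distance below k, so by [evol_lower] every gain has weight at
    least of order w L / k. The loss of the factor 1 / k is compensated by i + 1 >= m = k / 2 in
    [tail_entropy_step]. *)
Lemma entropy_rev_step_large (w m : nat) f : (forall y, 0 <= f y) ->
  (32 * w <= n)%N -> w%:R <= rho -> (k = 2 * m)%N ->
  w%:R * (tail_entropy f m - tail_entropy f k) <=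
  82 * (40 * (4000 * 4000)) * n%:R * ln n%:R * (entropy f - entropy (iter (w + t) rev_step f)).
Proof.
move=> f0 wn wr km; have ln1 := ln_n_ge1 R Ln L64.
have min_lt : (minn k n < m)%N -> (n <= m)%N /\ minn k n = n by clear -km; lia.
set Del := entropy f - _.
set c0 : R := L%:R / (20 * (4000 * 4000) * k%:R).
have c00 : 0 <= c0 by apply: ltW; rewrite divr_gt0 ?mulr_gt0.
have N0 : 0 < N by apply: shapes_gt0.
have NL : N <= 2 * n%:R * L%:R by rewrite -!natrM ler_nat; clear -Ln L64; nia.
have og0 (i j : 'I_n) : 0 <= ordered_gain f i j by apply: ordered_gain_ge0.
have := entropy_decrease_late Ln L64 t w f0; rewrite -/Del ler_pdivrMr //.
set X := \sum_p _ => hX.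
have hG : w%:R * c0 * \sum_(i < n | (m <= i < k)%N) \sum_(j in upto i) ordered_gain f i j <= X.
  rewrite mulr_sumr.
  have -> : X = \sum_(i < n) \sum_(j < n)
      (\sum_(s < w) evol L s (t + s) near_ind (i, j)) * ordered_gain f i j.
    by rewrite pair_bigA; apply: eq_bigr => -[i j].
  have ev0 (i j : 'I_n) : 0 <= \sum_(s < w) evol L s (t + s) near_ind (i, j).
    by apply: sumr_ge0 => s _; apply: evol_ge0 => q; rewrite ler0n.
  rewrite [leRHS](bigID (fun i : 'I_n => m <= i < k)%N) /=.
  apply: ler_wpDr.
    by apply: sumr_ge0 => i _; apply: sumr_ge0 => j _; apply: mulr_ge0 (ev0 i j) (og0 i j).
  apply: ler_sum => i /andP[mi ik]; rewrite mulr_sumr.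
  rewrite [leRHS](bigID (fun j : 'I_n => j \in upto i)) /=.
  apply: ler_wpDr; first by apply: sumr_ge0 => j _; apply: mulr_ge0 (ev0 i j) (og0 i j).
  apply: ler_sum => j; rewrite inE => ji.
  have [->|ij] := eqVneq i j; first by rewrite ordered_gain_diag !mulr0.
  rewrite ler_wpM2r //.
  have -> : w%:R * c0 = \sum_(s < w) c0 by rewrite sumr_const card_ord mulr_natl.
  apply: ler_sum => s _; apply: evol_lower => //.
  - by apply: leq_trans wn; rewrite leq_mul2l /= ltnW.
  - by apply: le_trans wr; rewrite ler_nat ltnW.
  - by apply: leq_trans (cyc_dist_le ji) _; apply: leq_trans (leq_subr _ _) (ltnW ik).
have hE : m%:R * (tail_entropy f m - tail_entropy f k) <=
    5 * ln n%:R * \sum_(i < n | (m <= i < k)%N) \sum_(j in upto i) ordered_gain f i j.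
  have -> : tail_entropy f m - tail_entropy f k =
     \sum_(i < n | (m <= i < k)%N) (tail_entropy f i - tail_entropy f i.+1).
    (* At the last scale k may exceed n; beyond n the tail entropy is constant. *)
    have kE : tail_entropy f k = tail_entropy f (minn k n).
      by have [h|h] := leqP k n; rewrite // tail_entropy_full // ltnW.
    have -> : \sum_(i < n | (m <= i < k)%N) (tail_entropy f i - tail_entropy f i.+1) =
        \sum_(m <= i < minn k n) (tail_entropy f i - tail_entropy f i.+1).
      rewrite (big_nat_widen _ _ n) ?geq_minr // big_geq_mkord; apply: eq_bigl => i /=.
      by rewrite leq_min ltn_ord andbT andbC.
    rewrite kE.
    have [h|h] := leqP m (minn k n).
      have <- : \sum_(m <= i < minn k n) (- tail_entropy f i.+1 - - tail_entropy f i) =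
          \sum_(m <= i < minn k n) (tail_entropy f i - tail_entropy f i.+1).
        by apply: eq_bigr => i _; rewrite opprK addrC.
      by rewrite (telescope_sumr (fun a : nat => - tail_entropy f a) h) opprK addrC.
    have [nm ->] := min_lt h.
    by rewrite big_geq // tail_entropy_full // subrr.
  rewrite !mulr_sumr; apply: ler_sum => i /andP[mi _].
  apply: le_trans (tail_entropy_step Ln L64 i f0); apply: ler_wpM2r.
    by rewrite subr_ge0 tail_entropy_decr.
  by rewrite ler_nat; apply: leq_trans mi (leqnSn _).
set S := \sum_(i < n | _) _ in hG hE.
set H := tail_entropy f m - _ in hE *.
have D0 : 0 <= Del * 8 * N -> 0 <= Del by rewrite -mulrA pmulr_lge0 // mulr_gt0.
have S0 : 0 <= S by apply: sumr_ge0 => i _; apply: sumr_ge0.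
have X0 : 0 <= X by apply: le_trans hG; apply: mulr_ge0 S0; apply: mulr_ge0.
have Del0 : 0 <= Del by apply: D0; lra.
have m0 : 0 < m%:R :> R by rewrite ltr0n; clear -km kL L64; lia.
have w0 : 0 <= w%:R * c0 by rewrite mulr_ge0.
have h1 : w%:R * c0 * (m%:R * H) <= 5 * ln n%:R * (8 * Del * (2 * n%:R * L%:R)).
  apply: (@le_trans _ _ (5 * ln n%:R * X)).
    apply: le_trans (ler_wpM2l w0 hE) _.
    rewrite mulrCA; apply: ler_wpM2l hG; apply: mulr_ge0 => //.
    exact: le_trans ler01 ln1.
  apply: ler_wpM2l; first by apply: mulr_ge0 => //; exact: le_trans ler01 ln1.
  by apply: le_trans hX _; apply: ler_wpM2l NL; apply: mulr_ge0.
have kmR : k%:R = 2 * m%:R :> R by rewrite km natrM.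
have e1 : w%:R * c0 * (m%:R * H) = L%:R / (40 * (4000 * 4000)) * (w%:R * H).
  by rewrite /c0 kmR; move: (m%:R : R) m0 => a a0; field; rewrite gt_eqF.
rewrite e1 in h1.
have P0 : 0 <= n%:R * ln n%:R * Del.
  by apply: mulr_ge0 => //; apply: mulr_ge0; [exact: ltW | exact: le_trans ler01 ln1].
exact: large_scale_constants L0 P0 h1.
Qed.

End LargeScale.

(** w is the integer part of the smaller of rho and n / 32, which is at least 8, so rounding loses
    at most half. In the first case t is at most of order w and n <= X; in the second w is of order
    n and t <= 964 X. Either way the rate w / (n (w + t)) is at least of order 1 / X. *)
Lemma window_exists (R : realType) (n X rho t : R) :
  256 <= n -> n <= X -> 16 <= rho -> rho <= 4 * X -> 0 <= t -> t <= 241 * rho ->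
  exists w : nat, [/\ w%:R <= rho, 32 * w%:R <= n, w%:R + t <= 968 * X &
    n * (w%:R + t) <= 64 * 968 * X * w%:R].
Proof.
move=> n256 nX r16 r4 t0 t241.
pose mn := Num.min rho (n / 32).
have mn1 : 8 <= mn by rewrite le_min; apply/andP; split; lra.
have mn0 : 0 <= mn by lra.
have [mr mnn] : mn <= rho /\ mn <= n / 32 by rewrite !ge_min !lexx orbT.
have mE : mn = rho \/ mn = n / 32.
  by have [h|/ltW h] := leP rho (n / 32); [left; apply/min_idPl | right; apply/min_idPr].
have /andP[w1 w2] := Num.Theory.truncn_itv mn0.
clearbody mn; exists (Num.truncn mn); move: (Num.truncn mn) w1 w2 => w w1.
rewrite -[w.+1%:R]natr1; move: (w%:R : R) (ler0n R w) w1 => v v0 w1 w2.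
split; [lra | lra | lra |].
have h1 : mn / 2 <= v by lra.
case: mE => mE; rewrite mE in h1.
  have h2 : n * (v + t) <= n * (484 * v) by apply: ler_wpM2l; lra.
  have h3 : n * v <= X * v by rewrite ler_wpM2r.
  have : 0 <= n * v by rewrite mulr_ge0 //; lra.
  by lra.
have h2 : n * (v + t) <= n * (968 * X) by apply: ler_wpM2l; lra.
have h3 : X * n <= X * (64 * v) by apply: ler_wpM2l; lra.
by lra.
Qed.

(** * Exponential decay of the relative entropy *)

Section Contraction.
Variables (R : realType) (n' L : nat).
Local Notation n := n'.+1.
Hypothesis Ln : (4 * L <= n)%N.
Hypothesis L64 : (64 <= L)%N.
Implicit Types (f g : 'S_n -> R) (i j : 'I_n).

Let L6 : (6 <= L)%N. Proof. by lia. Qed.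
Let n0 : 0 < n%:R :> R. Proof. by rewrite ltr0n. Qed.
Let Lpos : (0 < L)%N. Proof. by lia. Qed.
Let n1 : (1 < n)%N. Proof. by lia. Qed.
Let L0 : 0 < L%:R :> R. Proof. by rewrite ltr0n. Qed.

Local Notation rev_step := (@rev_step R n' L Ln L64).

Definition time_scale : R := Num.max n%:R (n%:R ^+ 3 / L%:R ^+ 3).
Local Notation X := time_scale.

Lemma time_scale_ge : n%:R <= X. Proof. by rewrite le_max lexx. Qed.

Lemma diffusion_time_le k : (k <= 2 * n)%N -> diffusion_time R n' L k <= 4 * X.
Proof.
move=> kn; apply: (@le_trans _ _ (4 * (n%:R ^+ 3 / L%:R ^+ 3))); last first.
  by rewrite ler_pM2l // le_max lexx orbT.
rewrite /diffusion_time mulrA ler_pM2r ?invr_gt0 ?exprn_gt0 //.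
have : k%:R ^+ 2 <= (2 * n%:R) ^+ 2 :> R.
  by rewrite ler_sqr ?nnegrE ?mulr_ge0 ?ler0n // -natrM ler_nat.
move=> h; apply: le_trans (ler_wpM2r (ltW n0) h) _.
by rewrite le_eqVlt; apply/orP; left; apply/eqP; ring.
Qed.

Definition collision_const : R := 82 * (40 * (4000 * 4000)).
Local Notation K := collision_const.

Lemma collision_const_ge : 100 <= K.
Proof. by rewrite /collision_const; lra. Qed.

Lemma scale_step k m f : (forall y, 0 <= f y) -> (2 * L <= k)%N -> (k <= 2 * n)%N ->
  (k = 2 * m)%N ->
  exists2 tau : nat, (0 < tau)%N /\ tau%:R <= 968 * X &
    tau%:R * (tail_entropy f m - tail_entropy f k) <=
    64 * 968 * K * X * ln n%:R * (entropy f - entropy (iter tau rev_step f)).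
Proof.
move=> f0 kL kn km.
have r16 := diffusion_time_ge R Ln L64 kL; have r4 := diffusion_time_le kn.
have /andP[_ t241] := mixing_steps_bounds R Ln L64 kL.
have n256 : 256 <= n%:R :> R by rewrite ler_nat; clear -Ln L64; lia.
have mk : (m <= k)%N by rewrite km leq_pmull.
have H0 : 0 <= tail_entropy f m - tail_entropy f k by rewrite subr_ge0 tail_entropy_decr.
have [w [wr wn wtX wt]] := window_exists n256 time_scale_ge r16 r4 (ler0n _ _) t241.
have wn' : (32 * w <= n)%N by rewrite -(ler_nat R) natrM.
have main := entropy_rev_step_large Ln L64 kL kn f0 wn' wr km.
exists (w + mixing_steps R n' L k)%N; first by rewrite addn_gt0 orbT natrD.
have X0 : 0 <= 64 * 968 * X.
  by apply: mulr_ge0; [rewrite mulr_ge0 | exact: le_trans (ltW n0) time_scale_ge].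
rewrite -(ler_pM2l n0) natrD [leLHS]mulrA; apply: le_trans (ler_wpM2r H0 wt) _.
rewrite -[leLHS]mulrA; apply: le_trans (ler_wpM2l X0 main) _.
by rewrite le_eqVlt /collision_const; apply/orP; left; apply/eqP; ring.
Qed.

Lemma sum_scales f J :
  tail_entropy f L - tail_entropy f (2 ^ J * L) =
  \sum_(j < J) (tail_entropy f (2 ^ j * L) - tail_entropy f (2 * (2 ^ j * L))).
Proof.
elim: J => [|J IH]; first by rewrite big_ord0 expn0 mul1n subrr.
by rewrite big_ord_recr /= -IH expnS -mulnA; lra.
Qed.

Lemma log2_le : exists2 J, (n <= 2 ^ J)%N & J%:R <= 3 * ln n%:R :> R.
Proof.
have ln1 := ln_n_ge1 R Ln L64.
exists (up_log 2 n); first exact: up_logP.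
have [->|J0] := posnP (up_log 2 n); first by rewrite mulr_ge0 //; lra.
have h : (2 ^ (up_log 2 n).-1 < n)%N by apply: up_log_gtn; lia.
have ln2 : 1 / 2 <= ln 2 :> R.
  have h2 : expR (1 / 2) <= 2 :> R.
    rewrite -(ler_sqr (x := expR _)) ?nnegrE ?expR_ge0 //.
    rewrite -expRM_natl (_ : 2 * (1 / 2) = 1); last by lra.
    by apply: le_trans (expR1_le4 R) _; lra.
  by rewrite -[leLHS]expRK ler_ln ?posrE ?expR_gt0.
have : ln (2 ^+ (up_log 2 n).-1) <= ln n%:R :> R.
  by rewrite ler_ln ?posrE ?exprn_gt0 // -natrX ler_nat ltnW.
rewrite lnXn // -[X in X <= _ -> _]mulr_natl => h3.
have -> : (up_log 2 n)%:R = (up_log 2 n).-1%:R + 1 :> R by rewrite natr1 prednK.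
have : (up_log 2 n).-1%:R * (1 / 2) <= (up_log 2 n).-1%:R * ln 2 :> R by rewrite ler_wpM2l.
lra.
Qed.

Lemma sym_avg_full f y : \sum_y f y = 1 -> sym_avg (below n' n) f y = #|{: 'S_n}|%:R^-1.
Proof.
move=> f1; rewrite /sym_avg /group_avg below_full //=.
have -> : Sym [set: 'I_n] = [set: 'S_n].
  by apply/setP => s; rewrite !inE; apply/subsetP => x _; rewrite inE.
rewrite cardsT -[RHS]mul1r -f1; congr (_ / _).
rewrite [RHS](reindex_inj (mulIg y)) /=.
by apply: eq_bigl => s; rewrite inE.
Qed.

Lemma tail_entropy_const f g : \sum_y f y = 1 -> \sum_y g y = 1 ->
  tail_entropy f n = tail_entropy g n.
Proof.
by move=> f1 g1; apply: eq_bigr => y _; rewrite !sym_avg_full.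
Qed.

Lemma iter_rev_step_ge0 t f : (forall y, 0 <= f y) -> forall y, 0 <= iter t rev_step f y.
Proof. exact: iter_mean_op_ge0. Qed.

Lemma sum_iter_rev_step t f : \sum_y iter t rev_step f y = \sum_y f y.
Proof.
elim: t => //= t <-; apply: sum_mean_op; by rewrite card_prod !card_ord.
Qed.

Lemma entropy_rev_step_le f : (forall y, 0 <= f y) -> entropy (rev_step f) <= entropy f.
Proof.
move=> f0; rewrite -subr_ge0; apply: le_trans (entropy_rev_step_small Ln L64 f0).
have := ln_n_ge1 R Ln L64 => ln1.
rewrite divr_ge0 ?mulr_ge0 //; last by lra.
by rewrite subr_ge0 -[leRHS]tail_entropy0 tail_entropy_decr.
Qed.

Lemma entropy_iter_le s t f : (forall y, 0 <= f y) -> (s <= t)%N ->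
  entropy (iter t rev_step f) <= entropy (iter s rev_step f).
Proof.
move=> f0 /subnK <-; elim: (t - s)%N => //= d IH.
by apply: le_trans IH; apply: entropy_rev_step_le; apply: iter_rev_step_ge0.
Qed.

(** The 6 is 2 * 3: if the scales carry half of the relative entropy, one of the at most 3 ln n
    scales carries its share of that half. The other logarithm comes from [scale_step]. *)
Definition decay_time : R := 6 * (64 * 968 * K) * X * ln n%:R ^+ 2.
Local Notation A := decay_time.

(* Either the first L positions or one of the dyadic scales carries a
   1 / log n fraction of the entropy. *)
Lemma rel_entropy_contraction f : (forall y, 0 <= f y) -> \sum_y f y = 1 ->
  exists2 tau : nat, (0 < tau)%N /\ tau%:R <= 968 * X &
    tau%:R * rel_entropy f <= A * (rel_entropy f - rel_entropy (iter tau rev_step f)).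
Proof.
move=> f0 f1; have ln1 := ln_n_ge1 R Ln L64; have Xn := time_scale_ge.
have K100 := collision_const_ge; have n256 : 256 <= n%:R :> R by rewrite ler_nat; lia.
have relE tau : rel_entropy f - rel_entropy (iter tau rev_step f) =
    entropy f - entropy (iter tau rev_step f).
  rewrite /rel_entropy (tail_entropy_const (f := iter tau rev_step f) (g := f)) //; first by lra.
  by rewrite sum_iter_rev_step.
have Del0 tau : 0 <= entropy f - entropy (iter tau rev_step f).
  by rewrite subr_ge0; apply: (entropy_iter_le f0 (leq0n tau)).
have rel0 : 0 <= rel_entropy f by apply: rel_entropy_ge0.
have X0 : 0 <= X by lra.
have l0 : 0 <= ln n%:R :> R by lra.
have Xl : 0 <= X * ln n%:R by rewrite mulr_ge0.
have AE : A = 6 * (64 * 968 * K) * ln n%:R * (X * ln n%:R) by rewrite /decay_time; ring.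
have [small|big] := leP (rel_entropy f / 2) (entropy f - tail_entropy f L).
  exists 1%N; first by split => //; lra.
  rewrite relE mul1r; have := entropy_rev_step_small Ln L64 f0.
  rewrite ler_pdivrMr; last by rewrite !mulr_gt0 //; lra.
  have := Del0 1%N; rewrite /=; set D := entropy f - _ => D0 h.
  have h1 : n%:R * ln n%:R <= X * ln n%:R by rewrite ler_wpM2r.
  have h2 := ler_wpM2r D0 h1.
  have XlD : 0 <= X * ln n%:R * D by rewrite mulr_ge0.
  have h3 : 160 <= 6 * (64 * 968 * K) * ln n%:R.
    have K1 : 160 <= 6 * (64 * 968 * K) by lra.
    move: (6 * _) K1 => B K1.
    by apply: le_trans (K1) _; rewrite ler_peMr // (le_trans _ K1).
  have h4 := ler_wpM2r XlD h3.
  rewrite AE -[leRHS]mulrA; apply: le_trans h4.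
  have h5 := le_trans small h.
  apply: (@le_trans _ _ (160 * (n%:R * ln n%:R * D))); last by rewrite ler_wpM2l.
  have -> : 160 * (n%:R * ln n%:R * D) = 2 * (D * (80 * n%:R * ln n%:R)) by ring.
  by rewrite -ler_pdivrMl // mulrC.
have [J nJ Jl] := log2_le.
have tot : rel_entropy f / 2 <= \sum_(j < J)
    (tail_entropy f (2 ^ j * L) - tail_entropy f (2 * (2 ^ j * L))).
  rewrite -sum_scales (tail_entropy_full f (k := 2 ^ J * L)); last first.
    by apply: leq_trans nJ _; rewrite leq_pmulr.
  by move: big; rewrite /rel_entropy; lra.
have [rz|rn] := eqVneq (rel_entropy f) 0.
  exists 1%N; first by split => //; lra.
  rewrite relE rz mulr0; apply: mulr_ge0 (Del0 _); rewrite AE; apply: mulr_ge0 Xl.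
  by apply: mulr_ge0 l0; lra.
have relp : 0 < rel_entropy f by rewrite lt_def rn.
have J0 : (0 < J)%N by case: (J) nJ => //; rewrite expn0 leqNgt n1.
have [j hj] : exists j : 'I_J, rel_entropy f / (2 * J%:R) <=
    tail_entropy f (2 ^ j * L) - tail_entropy f (2 * (2 ^ j * L)).
  apply/existsP; rewrite -[[exists _, _]]negbK negb_exists; apply/negP => /forallP h.
  have : \sum_(j < J) (tail_entropy f (2 ^ j * L) - tail_entropy f (2 * (2 ^ j * L))) <
      \sum_(j < J) rel_entropy f / (2 * J%:R).
    apply: ltr_sum => [|j _]; first by apply/hasP; exists (Ordinal J0); rewrite ?mem_index_enum.
    by rewrite ltNge.
  rewrite sumr_const card_ord -[_ *+ J]mulr_natr.
  have -> : rel_entropy f / (2 * J%:R) * J%:R = rel_entropy f / 2.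
    have JR : 0 < J%:R :> R by rewrite ltr0n.
    by move: (J%:R : R) JR => a a0; field; rewrite gt_eqF.
  by rewrite ltNge tot.
(* A scale beyond n carries no entropy, so it cannot be the chosen one. *)
have jn : (2 ^ j * L < n)%N.
  rewrite ltnNge; apply/negP => h; move: hj; rewrite !tail_entropy_full //;
    last by apply: leq_trans h _; rewrite leq_pmull.
  by rewrite subrr leNgt divr_gt0 // mulr_gt0 // ltr0n.
have kL : (2 * L <= 2 * (2 ^ j * L))%N by rewrite leq_mul2l /= leq_pmull // expn_gt0.
have kn : (2 * (2 ^ j * L) <= 2 * n)%N by rewrite leq_mul2l /= ltnW.
have [tau [t0 tX] ht] := scale_step f0 kL kn erefl.
exists tau => //; rewrite relE.
set D := entropy f - _ in ht *; have D0 : 0 <= D by apply: Del0.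
have h6 : rel_entropy f <= 6 * ln n%:R *
    (tail_entropy f (2 ^ j * L) - tail_entropy f (2 * (2 ^ j * L))).
  have JR : 0 < J%:R :> R by rewrite ltr0n.
  move: hj; rewrite ler_pdivrMr ?mulr_gt0 // => hj.
  apply: le_trans hj _; rewrite mulrC.
  apply: ler_wpM2r; last by lra.
  by rewrite subr_ge0 tail_entropy_decr // leq_pmull.
set Hj := tail_entropy f _ - _ in ht h6.
have t0R : 0 <= tau%:R :> R by rewrite ler0n.
have l6 : 0 <= 6 * ln n%:R :> R by rewrite mulr_ge0.
apply: le_trans (ler_wpM2l t0R h6) _; rewrite mulrCA.
apply: le_trans (ler_wpM2l l6 ht) _.
by rewrite /decay_time le_eqVlt; apply/orP; left; apply/eqP; ring.
Qed.

Lemma decay_time_gt0 : 0 < A.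
Proof.
have ln1 := ln_n_ge1 R Ln L64; have Xn := time_scale_ge; have K100 := collision_const_ge.
have X0 : 0 < X by apply: lt_le_trans Xn.
apply: mulr_gt0; last by rewrite exprn_gt0 //; lra.
by apply: mulr_gt0 X0; lra.
Qed.

(** The duration of a contraction depends on the law, through its dominant scale. Blocks of varying
    lengths are concatenated until m is reached, and the last one overshoots by at most 968 X. *)
Lemma rel_entropy_decay m f : (forall y, 0 <= f y) -> \sum_y f y = 1 ->
  exists2 tau : nat, tau%:R <= m%:R + 968 * X &
    rel_entropy (iter tau rev_step f) <= rel_entropy f * expR (- (m%:R / A)).
Proof.
have A0 := decay_time_gt0; have Xn := time_scale_ge.
move: {2}m (leqnn m) => M; elim: M m f => [|M IH] m f mM f0 f1.
  exists 0%N; first by rewrite addr_ge0 ?ler0n // mulr_ge0 //; apply: le_trans Xn; exact: ltW.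
  by move: mM; rewrite leqn0 => /eqP->; rewrite mul0r oppr0 expR0 mulr1.
have [tau [t0 tX] ht] := rel_entropy_contraction f0 f1.
have rel0 : 0 <= rel_entropy f by apply: rel_entropy_ge0.
have h1 : rel_entropy (iter tau rev_step f) <= rel_entropy f * expR (- (tau%:R / A)).
  apply: (@le_trans _ _ (rel_entropy f * (1 - tau%:R / A))); last first.
    by rewrite ler_wpM2l // expR_ge1Dx.
  rewrite -(ler_pM2l A0).
  have -> : A * (rel_entropy f * (1 - tau%:R / A)) = A * rel_entropy f - tau%:R * rel_entropy f.
    by move: (A) A0 => a a0; field; rewrite gt_eqF.
  by move: ht; rewrite mulrBr; lra.
have [mt|tm] := leqP m tau.
  exists tau; first by apply: le_trans tX _; rewrite lerDr ler0n.
  apply: le_trans h1 _; rewrite ler_wpM2l // ler_expR lerN2 ler_pM2r ?invr_gt0 //.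
  by rewrite ler_nat.
have f0' := iter_rev_step_ge0 tau f0.
have f1' : \sum_y iter tau rev_step f y = 1 by rewrite sum_iter_rev_step.
have [|s sX hs] := IH (m - tau)%N _ _ f0' f1'.
  by rewrite leq_subLR; apply: leq_trans mM _; rewrite -add1n leq_add2r.
exists (s + tau)%N.
  by move: sX; rewrite natrD (natrB _ (ltnW tm)); lra.
rewrite iterD; apply: le_trans hs _.
apply: le_trans (ler_wpM2r (expR_ge0 _) h1) _.
rewrite -mulrA -expRD -opprD -mulrDl -natrD subnKC ?lexx //; exact: ltnW.
Qed.

End Contraction.

(** * From relative entropy to the mixing time *)

Section MixingBound.
Variables (R : realType) (n' L : nat).
Local Notation n := n'.+1.
Hypothesis Ln : (4 * L <= n)%N.
Hypothesis L64 : (64 <= L)%N.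
Implicit Types (f : 'S_n -> R) (x y z : 'S_n).

Local Notation rev_step := (@rev_step R n' L Ln L64).
Local Notation X := (time_scale R n' L).
Local Notation A := (decay_time R n' L).

Definition point_mass x : 'S_n -> R := fun y => (x == y)%:R.

Lemma point_mass_ge0 x y : 0 <= point_mass x y.
Proof. exact: ler0n. Qed.

Lemma sum_point_mass x : \sum_y point_mass x y = 1.
Proof.
rewrite (bigD1 x) //= big1 ?addr0 /point_mass ?eqxx // => y /negPf yx.
by rewrite eq_sym yx.
Qed.

(** The chain pushes mass from z to r z, whereas [mean_op] evaluates f at r y; the two agree because
    reversals are involutions. *)
Lemma sum_reversal_kernel f y :
  \sum_z f z * reversal_kernel R L z y = rev_step f y.
Proof.
rewrite /rev_step /mean_op; set r := rev_perm _ _.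
have rE e i : r e i = rev_pos e.1 e.2 i by exact: rev_permE.
have rr e z : (y == (r e * z)%g) = ((r e * y)%g == z).
  apply/eqP/eqP => [->|<-]; rewrite mulgA (_ : r e * r e = 1)%g ?mul1g //;
    by apply/permP => i; rewrite permM !rE perm1 rev_posK //; have := ltn_ord e.2; lia.
rewrite card_prod !card_ord mulr_suml.
transitivity (\sum_e \sum_z f z * ((r e * y)%g == z)%:R / (n * L.+1)%:R); last first.
  apply: eq_bigr => e _; rewrite (bigD1 (r e * y)%g) //= eqxx mulr1 big1 ?addr0 // => z.
  by rewrite eq_sym => /negPf ->; rewrite mulr0 mul0r.
rewrite exchange_big; apply: eq_bigr => z _ /=.
rewrite -mulr_suml -mulr_sumr mulrA -natr_sum; congr (_ * _%:R / _).
rewrite -sum1dep_card big_mkcond; apply: eq_bigr => e _.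
rewrite -rr; case: ifP => [/forallP h|/forallP h].
  by apply/esym/eqP; rewrite eqb1; apply/eqP/permP => i; rewrite permM rE; apply/eqP.
apply/esym/eqP; rewrite eqb0; apply/eqP => yz; apply: h => i.
by rewrite yz permM rE.
Qed.

Lemma kstep_reversal k x y :
  kstep (@reversal_kernel n R L) k x y = iter k rev_step (point_mass x) y.
Proof.
elim: k y => [|k IH] y //=; rewrite -sum_reversal_kernel.
by apply: eq_bigr => z _; rewrite IH.
Qed.

Lemma hellinger_uniform_le f : (forall y, 0 <= f y) -> \sum_y f y = 1 ->
  hellinger f (@uniform R 'S_n) <= rel_entropy f.
Proof.
move=> f0 f1.
have -> : @uniform R 'S_n = sym_avg (below n' n) f.
  by apply: boolp.funext => y; rewrite sym_avg_full.
have e0 : sym_avg (below n' 0) f = f by rewrite sym_avg_trivial // card_below.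
rewrite /rel_entropy -(tail_entropy0 f) -{1}e0.
by apply: hellinger_le_entropy_sub => //; apply/SymS/belowS.
Qed.

(** With a and b the square roots of the two densities, |a^2 - b^2| <= (a^2 + b^2) / 16 + 8 (a -
    b)^2, and summing gives 2/16 + 8/64 = 1/4. *)
Lemma l1dist_uniform_le f : (forall y, 0 <= f y) -> \sum_y f y = 1 ->
  rel_entropy f <= 1 / 64 -> l1dist f (@uniform R 'S_n) <= 4^-1.
Proof.
move=> f0 f1 hf; have h := le_trans (hellinger_uniform_le f0 f1) hf.
have u0 y : 0 <= @uniform R 'S_n y by rewrite invr_ge0.
have u1 : \sum_y @uniform R 'S_n y = 1.
  rewrite sumr_const -[_ *+ _]mulr_natr mulVf // pnatr_eq0 -lt0n.
  by apply/card_gt0P; exists 1%g.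
have : l1dist f (@uniform R 'S_n) <= \sum_y ((f y + uniform R y) / 16 +
    8 * (Num.sqrt (f y) - Num.sqrt (uniform R y)) ^+ 2).
  apply: ler_sum => y _.
  have := sqr_sqrtr (f0 y); have := sqr_sqrtr (u0 y).
  move: (Num.sqrt (f y)) (Num.sqrt (uniform R y)) => a b <- <-.
  have := sqr_ge0 (a + b - 16 * (a - b)); have := sqr_ge0 (a + b + 16 * (a - b)).
  have := sqr_ge0 (a - b); rewrite !expr2 => h1 h2 h3.
  by rewrite ler_norml; apply/andP; split; lra.
move=> /le_trans; apply.
rewrite big_split /= -mulr_suml -mulr_sumr big_split /= f1 u1; move: h; rewrite /hellinger; lra.
Qed.

Lemma fact_le_expn k : (k`! <= k ^ k)%N.
Proof.
by rewrite fact_prod -[X in (_ <= _ ^ X)%N](subn1 k.+1) -prod_nat_const_nat big_nat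
  [leqRHS]big_nat leq_prod // => i /andP[].
Qed.

Lemma rel_entropy_point_mass x : rel_entropy (point_mass x) <= n%:R ^+ 2.
Proof.
have n0 : 0 < n%:R :> R by rewrite ltr0n.
have e0 : entropy (point_mass x) = 0.
  by rewrite /entropy big1 // => y _; rewrite /point_mass; case: eqP; rewrite ?ln1 ?mulr0 ?mul0r.
have c0 : 0 < #|{: 'S_n}|%:R :> R by rewrite ltr0n; apply/card_gt0P; exists 1%g.
have cn : #|{: 'S_n}| = n`!.
  exact: card_Sn.
rewrite /rel_entropy e0 sub0r /tail_entropy /entropy.
rewrite (eq_bigr (fun=> #|{: 'S_n}|%:R^-1 * - ln #|{: 'S_n}|%:R)); last first.
  by move=> y _; rewrite sym_avg_full ?sum_point_mass // lnV.
rewrite sumr_const -[_ *+ _]mulr_natr mulrAC mulVf ?gt_eqF // mul1r opprK cn.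
apply: (@le_trans _ _ (ln (n%:R ^+ n))).
  rewrite ler_ln ?posrE ?exprn_gt0 //; last by rewrite ltr0n fact_gt0.
  by rewrite -natrX ler_nat fact_le_expn.
rewrite lnXn // -[leLHS]mulr_natl expr2 ler_pM2l //.
exact: ltW (ln_sublinear n0).
Qed.

Definition mixing_const : R := 4 * (6 * (64 * 968 * collision_const R)) + 970.

Lemma mixed_reversal : exists2 k : nat, mixed (@reversal_kernel n R L) k &
  k%:R <= mixing_const * X * ln n%:R ^+ 3.
Proof.
have ln1 := ln_n_ge1 R Ln L64; have A0 := decay_time_gt0 R Ln L64.
have n0 : 0 < n%:R :> R by rewrite ltr0n.
have n8 : 64 <= n%:R :> R by rewrite ler_nat; lia.
have Xn := time_scale_ge R n' L.
have X0 : 0 <= X by apply: le_trans Xn; exact: ltW.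
(* This time makes the decay factor at most n^-4, which beats the initial n^2 and leaves n^-2 <=
   1/64. The additional 968 X absorbs the overshoot, and two roundings turn 968 into 970. *)
pose M := 4 * A * ln n%:R.
have M0 : 0 <= M by rewrite /M; apply: mulr_ge0; [apply: mulr_ge0 (ltW A0) | lra].
have Y0 : 0 <= 968 * X by rewrite mulr_ge0.
have /andP[m1 m2] := Num.Theory.truncn_itv M0.
have /andP[d1 d2] := Num.Theory.truncn_itv Y0.
move: (Num.truncn M) (Num.truncn (968 * X)) m1 m2 d1 d2 => m d m1 m2 d1 d2.
exists (m.+1 + d.+1)%N; last first.
  have X1 : 1 <= X by lra.
  have l3 : 1 <= ln n%:R ^+ 3 :> R by rewrite exprn_ege1.
  have XX : X <= X * ln n%:R ^+ 3 by rewrite ler_peMr.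
  have -> : mixing_const * X * ln n%:R ^+ 3 = M + 970 * (X * ln n%:R ^+ 3).
    by rewrite /mixing_const /M /decay_time; ring.
  rewrite natrD -[m.+1%:R]natr1 -[d.+1%:R]natr1.
  by clearbody M; lra.
move=> x; have p0 := point_mass_ge0 x; have p1 := sum_point_mass x.
have -> : kstep (@reversal_kernel n R L) (m.+1 + d.+1) x =
    iter (m.+1 + d.+1) rev_step (point_mass x).
  by apply: boolp.funext => y; apply: kstep_reversal.
have [tau tX ht] := rel_entropy_decay Ln L64 m.+1 p0 p1.
have tk : (tau <= m.+1 + d.+1)%N.
  rewrite -(ler_nat R) natrD; apply: le_trans tX _; rewrite lerD2l; exact: ltW.
apply: l1dist_uniform_le; first exact: iter_rev_step_ge0.
  by rewrite sum_iter_rev_step.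
apply: (@le_trans _ _ (rel_entropy (iter tau rev_step (point_mass x)))).
  rewrite /rel_entropy (@tail_entropy_const _ _ _ (iter tau rev_step (point_mass x))).
  - by rewrite lerD2r; apply: entropy_iter_le.
  - by rewrite sum_iter_rev_step.
  - by rewrite sum_iter_rev_step.
apply: le_trans ht _.
have e1 : expR (- (m.+1%:R / A)) <= n%:R ^- 4.
  rewrite -[leRHS]lnK ?posrE ?invr_gt0 ?exprn_gt0 // ler_expR lnV ?posrE ?exprn_gt0 //.
  rewrite lerN2 lnXn // ler_pdivlMr // -[X in X * _]mulr_natl.
  by apply: le_trans (ltW m2); rewrite /M le_eqVlt; apply/orP; left; apply/eqP; ring.
apply: le_trans (ler_pM _ (expR_ge0 _) (rel_entropy_point_mass x) e1) _.
  exact: rel_entropy_ge0.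
rewrite ler_pdivrMr ?exprn_gt0 // (exprD _ 2 2) mulrA ler_peMl ?exprn_ge0 ?(ltW n0) //.
have : 8 * 8 <= n%:R * n%:R :> R by rewrite ler_pM //; lra.
by rewrite expr2; lra.
Qed.

End MixingBound.

Unset Implicit Arguments.

Theorem lemma12 (R : realType) :
  exists (L0 : nat) (C : R), forall L n : nat,
    (L0 < L)%N -> (4 * L <= n)%N ->
    (Tmix (@reversal_kernel n R L) <=
     (C * Num.max n%:R (n%:R ^+ 3 / L%:R ^+ 3) * ln n%:R ^+ 3)%:E)%E.
Proof.
exists 64%N, (mixing_const R) => L [|n'] L64 Ln; first by lia.
have [k mk hk] := mixed_reversal R Ln (ltnW L64).
apply: (@le_trans _ _ (k%:R)%:E); last by rewrite lee_fin.
by apply: ereal.ereal_inf_lbound; exists k.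
Qed.
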